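(* Let $X=\mathbb{R}\times \mathbb{Z}(2)\times G$, where $G$ is a finite Abelian group containing no elements of order $2$. Let $\alpha=(a, I, \alpha_G)$ be a topological automorphism of the group $X$, that is, $\alpha(t,m,g)=(at,m,\alpha_G g)$ for $t\in\mathbb{R}$, $m\in\mathbb{Z}(2)$, $g\in G$, where $a\in\mathbb{R}$, $a\neq 0$, and $\alpha_G$ is an automorphism of $G$. Set $K={\rm Ker}(I+\alpha_{G})=\{g\in G: g+\alpha_G g=0\}$. Let $\xi_1,\xi_2$ be independent random variables with values in $X$ and distributions $\mu_1,\mu_2$ respectively, and suppose the characteristic functions $\hat\mu_1,\hat\mu_2$ are nonvanishing. Assume that the conditional distribution of the linear form $L_2 = \xi_1 + \alpha\xi_2$ given $L_1 = \xi_1 + \xi_2$ is symmetric. Then the following statements are true. I. If $a\ne -1$, then $\mu_j=\gamma_j*\omega_j*E_{g_j}$, $j=1,2$, where $\gamma_j$ are distributions of the class $\Theta$ on the subgroup $\mathbb{R}\times \mathbb{Z}(2)$, $\omega_j$ are distributions on the subgroup $\mathbb{Z}(2)\times K$ such that either $\omega_1=\omega_2*\vartheta_2$ for some $\vartheta_2\in \mathrm{M}^1(\mathbb{Z}(2))$ or $\omega_2=\omega_1*\vartheta_1$ for some $\vartheta_1\in \mathrm{M}^1(\mathbb{Z}(2))$, and $g_j\in G$. II. If $a=-1$, then $\mu_j=\omega_j*E_{g_j}$, $j=1,2$, where $\omega_j$ are distributions on the subgroup $\mathbb{R}\times\mathbb{Z}(2)\times K$ such that either $\omega_1=\omega_2*\vartheta_2$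 for some $\vartheta_2\in \mathrm{M}^1(\mathbb{Z}(2))$ or $\omega_2=\omega_1*\vartheta_1$ for some $\vartheta_1\in \mathrm{M}^1(\mathbb{Z}(2))$, and $g_j\in G$.
   Context: $\mathbb{Z}(2)=\{0,1\}$ is the additive group of integers modulo $2$; $I$ denotes the identity automorphism. ''Distribution'' means (Borel) probability measure, and $\mathrm{M}^1(X)$ is the set of all distributions on a locally compact Abelian group $X$. Convolution is $\mu*\nu(E)=\int_X\mu(E-x)\,d\nu(x)$. $E_x$ denotes the degenerate distribution concentrated at $x$. Distributions on a subgroup of $X$ (such as $\mathbb{R}\times\mathbb{Z}(2)$, $\mathbb{Z}(2)$, $G$, $\mathbb{Z}(2)\times K$, naturally embedded in $X$) are regarded as distributions on $X$ supported in that subgroup; all convolutions are taken in $X$. An element $g\in G$ is identified with $(0,0,g)\in X$. The characteristic function of $\mu\in\mathrm{M}^1(X)$ is $\hat\mu(y)=\int_X (x,y)\,d\mu(x)$, $y\in Y$, where $Y$ is the character group of $X$ and $(x,y)$ is the value of the character $y$ at $x$. For $X=\mathbb{R}\times\mathbb{Z}(2)\times G$, $Y$ is identified with $\mathbb{R}\times\mathbb{Z}(2)\times H$, where $H$ is the character group of $G$, via $((t,m,g),(s,n,h))=e^{its}(-1)^{mn}(g,h)$. Likewise the character group of $\mathbb{R}\times\mathbb{Z}(2)$ is identified with $\mathbb{R}\times\mathbb{Z}(2)$ via $((t,m),(s,n))=e^{its}(-1)^{mn}$. The conditional distribution of $L_2$ given $L_1$ is symmetric if the conditional distributions of $L_2$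 and of $-L_2$ given $L_1$ coincide; equivalently, the random vectors $(L_1,L_2)$ and $(L_1,-L_2)$ are identically distributed. Class $\Theta$: a distribution $\mu\in\mathrm{M}^1(\mathbb{R}\times\mathbb{Z}(2))$ belongs to $\Theta$ if its characteristic function has the form $$\hat\mu(s,n)=\begin{cases}\exp\{-\sigma s^2+i\mathfrak{m}s\}, & s\in\mathbb{R},\ n=0,\\ \varkappa\exp\{-\sigma' s^2+i\mathfrak{m}'s\}, & s\in\mathbb{R},\ n=1,\end{cases}$$ where $\sigma\ge 0$, $\sigma'\ge 0$, $\mathfrak{m},\mathfrak{m}',\varkappa\in\mathbb{R}$, and either $$0<\sigma'<\sigma,\quad 0<|\varkappa|\le\sqrt{\frac{\sigma'}{\sigma}}\exp\left\{-\frac{(\mathfrak{m}-\mathfrak{m}')^2}{4(\sigma-\sigma')}\right\},$$ or $$\sigma=\sigma',\quad \mathfrak{m}=\mathfrak{m}',\quad |\varkappa|\le 1.$$ *)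

(* Defs.v *)
From HB Require Import structures.
From mathcomp Require Import all_boot all_order all_algebra complex.
From mathcomp Require Import all_classical all_reals all_analysis.
From mathcomp Require Import measurable_realfun.

Set Implicit Arguments.
Unset Strict Implicit.
Unset Printing Implicit Defensive.

Import Order.TTheory GRing.Theory Num.Theory.
Local Open Scope classical_set_scope.
Local Open Scope ring_scope.

(* A finite Abelian group is discrete: its Borel sigma-algebra is the full     *)
(* power set. The alias carries that measurable structure.                     *)
Definition discr (G : finZmodType) : Type := G.
HB.instance Definition _ (G : finZmodType) := GRing.Zmodule.on (discr G).
HB.instance Definition _ (G : finZmodType) := Finite.on (discr G).
HB.instance Definition _ (G : finZmodType) := isPointed.Build (discr G) 0.
HB.instance Definition _ (G : finZmodType) :=
  @isMeasurable.Build default_measure_display (discr G)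
    discrete_measurable discrete_measurable0
    discrete_measurableC discrete_measurableU.

Notation Z2 := (discr 'Z_2).
Notation RZ2 R := (R * Z2)%type.
(* The group R x Z(2) x G; its elements are triples (t, m, g). *)
Notation XG R G := (R * Z2 * discr G)%type.

Section addition_measurable.
Context (R : realType) (G : finZmodType).

Lemma measurable_fun_add_discr d (T : measurableType d) (H : finZmodType)
    (f g : T -> discr H) :
  measurable_fun setT f -> measurable_fun setT g ->
  measurable_fun setT (fun x => f x + g x : discr H).
Proof.
move=> mf mg _ Y _; rewrite setTI.
have -> : (fun x => f x + g x : discr H) @^-1` Y =
    \bigcup_(h in [set: discr H])
      (f @^-1` [set h] `&` g @^-1` [set k | Y (h + k)]).
  by apply/seteqP; split=> [x Yx|x [h _ [/= <-]]] //; exists (f x).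
apply: fin_bigcup_measurable => // h _; apply: measurableI.
  by rewrite -[X in measurable X]setTI; exact: mf.
by rewrite -[X in measurable X]setTI; exact: mg.
Qed.

Definition addX (p : XG R G * XG R G) : XG R G := p.1 + p.2.

Lemma measurable_addX : measurable_fun setT addX.
Proof.
have m1 := @measurable_fst _ _ (XG R G) (XG R G).
have m2 := @measurable_snd _ _ (XG R G) (XG R G).
pose f1 (p : XG R G * XG R G) : R := p.1.1.1 + p.2.1.1.
pose f2 (p : XG R G * XG R G) : Z2 := p.1.1.2 + p.2.1.2.
pose f3 (p : XG R G * XG R G) : discr G := p.1.2 + p.2.2.
have -> : addX = fun p => (f1 p, f2 p, f3 p).
  by apply/funext => -[[[? ?] ?] [[? ?] ?]].
have mf1 : measurable_fun setT f1.
  by apply: measurable_funD; do 2 apply: measurableT_comp => //.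
have mf2 : measurable_fun setT f2.
  by apply: measurable_fun_add_discr; do 2 apply: measurableT_comp => //.
have mf3 : measurable_fun setT f3.
  by apply: measurable_fun_add_discr; apply: measurableT_comp.
exact: measurable_fun_pair (measurable_fun_pair mf1 mf2) mf3.
Qed.

HB.instance Definition _ :=
  @isMeasurableFun.Build _ _ (XG R G * XG R G)%type (XG R G) addX measurable_addX.

End addition_measurable.

Section convolution.
Context (R : realType) (G : finZmodType).
Local Open Scope ereal_scope.

Definition convol (mu nu : probability (XG R G) R) (E : set (XG R G)) : \bar R :=
  \int[nu]_x mu [set z - x | z in E]%R.

Variables mu nu : probability (XG R G) R.

Lemma convolE E : convol mu nu E = distribution (mu \x^ nu) (@addX R G) E.
Proof.
rewrite /convol; apply: eq_integral => x _ /=; congr (mu _).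
rewrite /ysection; apply/seteqP; split=> y /=.
  by move=> [z Ez <-]; rewrite inE /= /addX /= subrK.
by rewrite inE /addX /= => Eyx; exists (y + x)%R => //; rewrite addrK.
Qed.

Let convol0 : convol mu nu set0 = 0.
Proof. by rewrite convolE measure0. Qed.

Let convol_ge0 E : 0 <= convol mu nu E.
Proof. by rewrite convolE measure_ge0. Qed.

Let convol_sigma_additive : semi_sigma_additive (convol mu nu).
Proof. by rewrite (funext convolE); exact: measure_semi_sigma_additive. Qed.

HB.instance Definition _ := isMeasure.Build _ _ _ (convol mu nu)
  convol0 convol_ge0 convol_sigma_additive.

Let convol_setT : convol mu nu setT = 1.
Proof. by rewrite convolE probability_setT. Qed.

HB.instance Definition _ :=
  Measure_isProbability.Build _ _ _ (convol mu nu) convol_setT.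

End convolution.

(* Measures are total functions on all subsets, whose values are meaningful on *)
(* measurable sets only, so equality of distributions is restricted to those.  *)
Definition eq_dist d (T : measurableType d) (R : realType)
    (mu nu : probability T R) :=
  forall E, measurable E -> mu E = nu E.

Section embeddings.
Context (R : realType) (G : finZmodType).

Definition iRZ2 (y : RZ2 R) : XG R G := (y, 0).
Definition iZ2 (m : Z2) : XG R G := (0, m, 0).

Lemma measurable_iRZ2 : measurable_fun setT iRZ2.
Proof.
exact: measurable_fun_pair (@measurable_id _ (RZ2 R) setT)
  (@measurable_cst _ _ (RZ2 R) (discr G) setT 0).
Qed.
Lemma measurable_iZ2 : measurable_fun setT iZ2.
Proof.
exact: measurable_fun_pair
  (measurable_fun_pair (@measurable_cst _ _ Z2 R setT 0)
    (@measurable_id _ Z2 setT))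
  (@measurable_cst _ _ Z2 (discr G) setT 0).
Qed.

HB.instance Definition _ :=
  @isMeasurableFun.Build _ _ (RZ2 R) (XG R G) iRZ2 measurable_iRZ2.
HB.instance Definition _ :=
  @isMeasurableFun.Build _ _ Z2 (XG R G) iZ2 measurable_iZ2.

Definition embRZ2 (gamma : probability (RZ2 R) R) : probability (XG R G) R :=
  distribution gamma iRZ2.
Definition embZ2 (theta : probability Z2 R) : probability (XG R G) R :=
  distribution theta iZ2.

Definition Edeg (g : G) : probability (XG R G) R := dirac ((0, 0, g) : XG R G).

Definition concentrated_on (S : set (XG R G)) (mu : probability (XG R G) R) :=
  mu S = 1%E.

End embeddings.

Definition cexp (R : realType) (z : R[i]) : R[i] :=
  ((expR (complex.Re z) * cos (complex.Im z)) +i*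
   (expR (complex.Re z) * sin (complex.Im z)))%C.

Definition cintegral d (T : measurableType d) (R : realType)
    (mu : probability T R) (f : T -> R[i]) : R[i] :=
  ((\int[mu]_x complex.Re (f x)) +i* (\int[mu]_x complex.Im (f x)))%C.

Record char_group (R : realType) (G : finZmodType) := CharGroup {
  char_val :> G -> R[i];
  char_norm1 : forall g, `|char_val g| = 1;
  char_add : forall g g', char_val (g + g') = char_val g * char_val g' }.

(* The value of the character (s, n) of R x Z(2) at (t, m). *)
Definition pairRZ2 (R : realType) (x : RZ2 R) (s : R) (n : 'Z_2) : R[i] :=
  cexp (0 +i* (x.1 * s))%C * (-1) ^+ ((x.2 : 'Z_2) * n)%N.

Definition pairX (R : realType) (G : finZmodType) (x : XG R G)
    (s : R) (n : 'Z_2) (h : char_group R G) : R[i] :=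
  pairRZ2 x.1 s n * h x.2.

Definition charfunRZ2 (R : realType) (mu : probability (RZ2 R) R)
    (s : R) (n : 'Z_2) : R[i] :=
  cintegral mu (fun x => pairRZ2 x s n).

Definition charfunX (R : realType) (G : finZmodType)
    (mu : probability (XG R G) R) (s : R) (n : 'Z_2) (h : char_group R G) : R[i] :=
  cintegral mu (fun x => pairX x s n h).

Definition Theta (R : realType) (mu : probability (RZ2 R) R) : Prop :=
  exists sigma sigma' m m' kappa : R,
    [/\ 0 <= sigma, 0 <= sigma',
        forall s, charfunRZ2 mu s 0 = cexp ((- (sigma * s ^+ 2)) +i* (m * s))%C,
        forall s, charfunRZ2 mu s 1 =
          (kappa%:C)%C * cexp ((- (sigma' * s ^+ 2)) +i* (m' * s))%C
      & [/\ 0 < sigma', sigma' < sigma, 0 < `|kappa|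
          & `|kappa| <= Num.sqrt (sigma' / sigma) *
              expR (- ((m - m') ^+ 2 / (4 * (sigma - sigma'))))]
        \/ [/\ sigma = sigma', m = m' & `|kappa| <= 1]].

Section probability_notions.
Context (R : realType) (G : finZmodType).
Context d (Omega : measurableType d) (P : probability Omega R).

Definition independent_RV (xi1 xi2 : Omega -> XG R G) : Prop :=
  forall A B, measurable A -> measurable B ->
    P (xi1 @^-1` A `&` xi2 @^-1` B) = (P (xi1 @^-1` A) * P (xi2 @^-1` B))%E.

(* k is a (regular) conditional distribution of L2 given L1. *)
Definition cond_dist (L2 L1 : Omega -> XG R G)
    (k : R.-pker (XG R G) ~> (XG R G)) : Prop :=
  forall A B, measurable A -> measurable B ->
    P (L1 @^-1` A `&` L2 @^-1` B) = (\int[P]_(w in L1 @^-1` A) k (L1 w) B)%E.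

(* Conditional distributions given L1 are unique up to L1-null sets, and exist *)
(* since the group is Polish; so the conditional distributions of L2 and of    *)
(* - L2 coincide iff a single kernel is a conditional distribution of both.    *)
Definition cond_symmetric (L2 L1 : Omega -> XG R G) : Prop :=
  exists k : R.-pker (XG R G) ~> (XG R G),
    cond_dist L2 L1 k /\ cond_dist (fun w => - L2 w) L1 k.

End probability_notions.

Definition autX (R : realType) (G : finZmodType) (a : R) (alphaG : G -> G)
    (x : XG R G) : XG R G :=
  (a * x.1.1, x.1.2, alphaG x.2).

Definition kerIplus (G : finZmodType) (alphaG : G -> G) : set G :=
  [set g | g + alphaG g = 0].

Definition subZ2K (R : realType) (G : finZmodType) (K : set G) :
    set (XG R G) :=
  [set x | x.1.1 = 0 /\ K x.2].

Definition subRZ2K (R : realType) (G : finZmodType) (K : set G) :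
    set (XG R G) :=
  [set x | K x.2].

Definition Z2_related (R : realType) (G : finZmodType)
    (omega1 omega2 : probability (XG R G) R) : Prop :=
  (exists theta2 : probability Z2 R,
     eq_dist omega1 (convol omega2 (embZ2 G theta2))) \/
  (exists theta1 : probability Z2 R,
     eq_dist omega2 (convol omega1 (embZ2 G theta1))).

(* Main.v *)
(* Write f and g for the characteristic functions of mu1 and mu2. Symmetry and
   independence give Heyde's equation
     f(u + v) g(u + b v) = f(u - v) g(u - b v),
   where b is adjoint to alpha. On the characters of G, iterating it for
   -log|f| and -log|g|, which take finitely many values there, shows that both
   moduli are 1 on the image of the adjoint of I + alpha_G: up to shifts by
   elements g1 and g2 of G, mu1 and mu2 live on R x Z(2) x K. As alpha_G = -I
   on K, the equation then says that f(0, n, .) and g(0, n, .) are proportional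
   for each n, with ratio 1 for n = 0 and a real ratio c for n = 1. If a = -1
   this extends to all s, and |c| <= 1 or |1/c| <= 1 gives the distribution
   theta. If a <> -1, the variables separate, f(s, n, h) = E_n(s) f(0, n, h),
   and E_n solves a one-dimensional Heyde equation, hence is a Gaussian
   exponential. For each g in K the slices of mu1 over (0, g) and (1, g)
   have transforms (r E_0(s) +- k E_1(s)) / 2, where r and k are the sum and
   the difference of their masses; positivity against narrow Gaussians is the
   inequality defining Theta with kappa = k / r. The normalised restriction of
   mu1 to R x Z(2) x {g} with |k| / r maximal is gamma_1, and maximality makes
   the quotient of f by the characteristic function of gamma_1 that of a
   distribution omega on Z(2) x K; the same omega serves mu2. *)

Require Import Defs.
From HB Require Import structures.
From mathcomp Require Import all_boot all_order all_algebra complex.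
From mathcomp Require Import fingroup cyclic separable cyclotomic.
From mathcomp Require Import all_classical all_reals all_analysis.
From mathcomp Require Import measurable_realfun.
From mathcomp Require Import ring lra.

Set Implicit Arguments.
Unset Strict Implicit.
Unset Printing Implicit Defensive.

Import Order.TTheory GRing.Theory Num.Theory numFieldNormedType.Exports.
Local Open Scope classical_set_scope.
Local Open Scope ring_scope.

(** * Functional equations *)

(** Nonvanishing does not make a complex logarithm available for free, so differences are taken
    multiplicatively and only moduli go through [ln]. The absence of elements of order 2 allows
    halving in G. It gives the maps (I + alpha_G)/2 and (I - alpha_G)/2, and on K, where alpha_G =
    -I, the substitution u = (p + q)/2, v = (p - q)/2 turns the equation into f(s + s', n, p) g(s +
    a s', n, q) = f(s - s', n, q) g(s - a s', n, p). Proportionality and separation are special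
    cases of this form. On Z(2) the signs of v are invisible, so nothing ties f to g there beyond
    one constant for each n; this is the origin of the factor theta. The third-difference argument
    breaks down at a = 1, where s + t and s + a t coincide; there |f(s, 0, 1)| = 1 and the Gaussian
    part degenerates. The constant in Theta is the value of a quotient of two Gaussian peaks at the
    vertex of its exponent, in the limit of infinitely narrow test Gaussians. *)

Section real_functional_equations.
Context {R : realType}.

(** Dyadic multiples of [d] are dense: rounding [x] down at level [k] errs by at most [d / 2 ^+ k],
    and continuity does the rest. *)
Lemma eq_cst_dyadic (F : R -> R) (d c : R) : 0 < d -> continuous F ->
  (forall (n : int) k, F (n%:~R * (d / 2 ^+ k)) = c) -> forall x, F x = c.
Proof.
move=> d0 cF Fd x.
pose u k : R := (Num.floor (x / (d / 2 ^+ k)))%:~R * (d / 2 ^+ k).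
have dk k : 0 < d / 2 ^+ k by rewrite divr_gt0// exprn_gt0.
have ux : u k @[k --> \oo] --> x.
  have cg : d / 2 ^+ k @[k --> \oo] --> (0 : R).
    rewrite -(mulr0 d); apply: cvgM; first exact: cvg_cst.
    under eq_fun do rewrite -exprVn.
    by apply: cvg_expr; rewrite ger0_norm// invf_lt1// ltr1n.
  apply/cvgrPdist_le => e e0.
  move/cvgrPdist_le : cg => /(_ e e0); apply: filterS => k.
  rewrite sub0r normrN ger0_norm ?(ltW (dk k))// => ke.
  have := floor_le (x / (d / 2 ^+ k)); have := floorD1_gt (x / (d / 2 ^+ k)).
  rewrite intrD ler_pdivlMr// ltr_pdivrMr// mulrDl mul1r -/(u k) => h1 h2.
  by rewrite ler_norml; apply/andP; split; lra.
have FuF : F (u k) @[k --> \oo] --> F x by apply: cvg_comp ux (cF x).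
have Fuc : F (u k) @[k --> \oo] --> c.
  by under eq_fun do rewrite Fd; exact: cvg_cst.
exact: (cvg_unique _ FuF Fuc).
Qed.

(** The defect [Q] from the candidate obeys the same law and vanishes at 1. Halving, then induction
    on integer multiples, kills it at every dyadic point. *)
Lemma parallelogram_quadratic (phi : R -> R) : continuous phi ->
  (forall A B, phi (A + B) + phi (A - B) = 2 * phi A + 2 * phi B) ->
  forall s, phi s = phi 1 * s ^+ 2.
Proof.
move=> cphi pphi.
pose Q s := phi s - phi 1 * s ^+ 2.
have pQ A B : Q (A + B) + Q (A - B) = 2 * Q A + 2 * Q B.
  by rewrite /Q; have := pphi A B; nra.
have Q0 : Q 0 = 0 by have := pQ 0 0; rewrite addr0 subr0; lra.
have QN B : Q (- B) = Q B by have := pQ 0 B; rewrite add0r sub0r Q0; lra.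
have Q2 k : Q (1 / 2 ^+ k) = 0.
  elim: k => [|k IH]; first by rewrite expr0 divr1 /Q expr1n mulr1 subrr.
  have := pQ (1 / 2 ^+ k.+1) (1 / 2 ^+ k.+1); rewrite subrr Q0.
  have -> : 1 / 2 ^+ k.+1 + 1 / 2 ^+ k.+1 = 1 / 2 ^+ k :> R.
    by rewrite exprS; field; rewrite expf_neq0.
  by rewrite IH; lra.
have Qn h n : Q h = 0 -> Q (n%:R * h) = 0 /\ Q (n.+1%:R * h) = 0.
  move=> Qh; elim: n => [|n [IH1 IH2]]; first by rewrite mul0r mul1r.
  split => //; have := pQ (n.+1%:R * h) h; rewrite IH2 Qh.
  have -> : n.+1%:R * h - h = n%:R * h by rewrite -natr1; ring.
  have -> : n.+1%:R * h + h = n.+2%:R * h by rewrite -(natr1 n.+1); ring.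
  by rewrite IH1; lra.
have cQ : continuous Q.
  move=> x; apply: cvgB; first exact: cphi.
  by apply: cvgM; [exact: cvg_cst|exact: exprn_continuous].
move=> s; suff : Q s = 0 by rewrite /Q; lra.
apply: (@eq_cst_dyadic Q 1 0) => // n k.
have [h _] := Qn (1 / 2 ^+ k) `|n|%N (Q2 k).
case: n h => j; first by [].
by rewrite NegzE abszN mulrNz mulNr QN.
Qed.

(** Here [c + i d] is a continuous homomorphism from the line to the circle. Its angle is read off
    at one small [e] and halved repeatedly; since both cosines stay positive near 0, the half-angle
    formulas leave no choice of sign. *)
Lemma circle_character (c d : R -> R) : continuous c -> continuous d ->
  (forall s, c s ^+ 2 + d s ^+ 2 = 1) ->
  (forall x y, c (x + y) = c x * c y - d x * d y) ->
  (forall x y, d (x + y) = c x * d y + d x * c y) ->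
  exists m, forall s, c s = cos (m * s) /\ d s = sin (m * s).
Proof.
move=> cc cd n1 cD dD.
have [c0 d0] : c 0 = 1 /\ d 0 = 0.
  have := cD 0 0; have := dD 0 0; rewrite addr0 => h1 h2.
  have n0 := n1 0.
  have d0 : d 0 = 0.
    have : d 0 * (1 - 2 * c 0) = 0 by nra.
    by move/eqP; rewrite mulf_eq0 => /orP[/eqP//|/eqP h]; nra.
  by move: h2 n0; rewrite d0; split => //; nra.
have [e e0 ce] : exists2 e : R, 0 < e & forall s, `|s| <= e -> 0 < c s.
  have /cvgr_gt/(_ 0) : c s @[s --> (0:R)] --> (1:R) by rewrite -c0; exact: cc.
  rewrite ltr01 => /(_ isT) /nbhs_ballP[e /= e0 be].
  exists (e / 2); first by rewrite divr_gt0.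
  move=> s se; apply: be; rewrite /ball /= sub0r normrN (le_lt_trans se)//.
  by rewrite ltr_pdivrMr// ltr_pMr// ltr1n.
have cV s : c (- s) = c s /\ d (- s) = - d s.
  have := cD s (- s); have := dD s (- s); rewrite subrr c0 d0 => h1 h2.
  have := n1 s => h3; split.
    have : c s * (c s * c (- s) - d s * d (- s)) + d s * (c s * d (- s) + d s * c (- s)) = c s.
      by rewrite -h1 -h2; ring.
    have -> : c s * (c s * c (- s) - d s * d (- s)) + d s * (c s * d (- s) + d s * c (- s)) = (c s ^+ 2 + d s ^+ 2) * c (- s) by ring.
    by rewrite h3 mul1r.
  have : c s * (c s * d (- s) + d s * c (- s)) - d s * (c s * c (- s) - d s * d (- s)) = - d s.
    by rewrite -h1 -h2; ring.
  have -> : c s * (c s * d (- s) + d s * c (- s)) - d s * (c s * c (- s) - d s * d (- s)) = (c s ^+ 2 + d s ^+ 2) * d (- s) by ring.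
  by rewrite h3 mul1r.
have de1 : -1 <= d e <= 1.
  by have := n1 e => h; apply/andP; split; nra.
pose t := asin (d e).
have sint : sin t = d e by rewrite asinK// in_itv.
have tb : - (pi / 2) <= t <= pi / 2.
  by apply/andP; split; [exact: asin_geNpi2|exact: asin_lepi2].
have cost : cos t = c e.
  have ce0 : 0 <= c e by apply/ltW/ce; rewrite ger0_norm// ltW.
  have ct0 : 0 <= cos t by apply: cos_ge0_pihalf.
  apply/eqP; rewrite -(@eqrXn2 _ 2)//; apply/eqP.
  by have := cos2Dsin2 t; rewrite sint; have := n1 e; lra.
have ck k : c (e / 2 ^+ k) = cos (t / 2 ^+ k) /\ d (e / 2 ^+ k) = sin (t / 2 ^+ k).
  elim: k => [|k [IH1 IH2]]; first by rewrite expr0 !divr1.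
  have dbl (x : R) : x / 2 ^+ k = x / 2 ^+ k.+1 + x / 2 ^+ k.+1.
    by rewrite exprS; field; rewrite expf_neq0.
  have k0 : 0 < 2 ^+ k.+1 :> R by rewrite exprn_gt0.
  have k1 : 2 <= 2 ^+ k.+1 :> R by rewrite exprS ler_peMr// exprn_ege1// ler1n.
  have ck0 : 0 < c (e / 2 ^+ k.+1).
    apply: ce; rewrite ger0_norm; last by rewrite divr_ge0// ltW.
    by rewrite ler_pdivrMr// ler_peMr ?(ltW e0)//; lra.
  have tk0 : 0 < cos (t / 2 ^+ k.+1).
    apply: cos_gt0_pihalf.
    have := @pi_gt0 R; move: tb => /andP[tb1 tb2] pi0.
    by rewrite ltr_pdivlMr// ltr_pdivrMr//; apply/andP; split; nra.
  move: IH1 IH2; rewrite !dbl cD dD cosD sinD => h1 h2.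
  have h3 := n1 (e / 2 ^+ k.+1); have h4 := cos2Dsin2 (t / 2 ^+ k.+1).
  have h5 : c (e / 2 ^+ k.+1) = cos (t / 2 ^+ k.+1).
    by apply/eqP; rewrite -(@eqrXn2 _ 2)// ?ltW//; apply/eqP; nra.
  split => //; move: h2; rewrite h5 => h2.
  have : 2 * cos (t / 2 ^+ k.+1) != 0 by rewrite mulf_neq0// gt_eqF.
  by move/mulfI; apply; nra.
pose m := t / e.
(* [u + i v] is the product of [c + i d] with the conjugate of the candidate character, so it is
   again a homomorphism, to be shown trivial. *)
pose u s := c s * cos (m * s) + d s * sin (m * s).
pose v s := d s * cos (m * s) - c s * sin (m * s).
have uvD x y : u (x + y) = u x * u y - v x * v y /\ v (x + y) = u x * v y + v x * u y.
  by rewrite /u /v mulrDr cD dD cosD sinD; split; ring.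
have uvk k : u (e / 2 ^+ k) = 1 /\ v (e / 2 ^+ k) = 0.
  have -> : u (e / 2 ^+ k) = c (e / 2 ^+ k) ^+ 2 + d (e / 2 ^+ k) ^+ 2.
    rewrite /u; have [-> ->] := ck k.
    have -> : m * (e / 2 ^+ k) = t / 2 ^+ k by rewrite /m mulrA divfK// gt_eqF.
    by ring.
  rewrite n1; split => //; rewrite /v; have [-> ->] := ck k.
  have -> : m * (e / 2 ^+ k) = t / 2 ^+ k by rewrite /m mulrA divfK// gt_eqF.
  by ring.
have un h n : u h = 1 -> v h = 0 -> u (n%:R * h) = 1 /\ v (n%:R * h) = 0.
  move=> uh vh; elim: n => [|n [IH1 IH2]].
    by rewrite mul0r /u /v mulr0 c0 d0 cos0 sin0; split; ring.
  rewrite -natr1 mulrDl mul1r; have [-> ->] := uvD (n%:R * h) h.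
  by rewrite IH1 IH2 uh vh; split; ring.
have uN s : u (- s) = u s.
  by rewrite /u; have [-> ->] := cV s; rewrite mulrN cosN sinN mulrNN.
have ms : continuous (fun s : R => m * s).
  by move=> s; apply: cvgM; [exact: cvg_cst|exact: cvg_id].
have cu : continuous u.
  move=> s; apply: cvgD; apply: cvgM; [exact: cc| |exact: cd|].
    by apply: (@cvg_comp _ _ _ _ cos _ _ _ (ms s)); exact: continuous_cos.
  by apply: (@cvg_comp _ _ _ _ sin _ _ _ (ms s)); exact: continuous_sin.
have u1 s : u s = 1.
  apply: (@eq_cst_dyadic u e 1) => // n k.
  have [uk vk] := uvk k; have [h _] := un _ `|n|%N uk vk.
  case: n h => j; first by [].
  by rewrite NegzE abszN mulrNz mulNr uN.
exists m => s.
(* The sum of squares equals [2 - 2 * u s]. *)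
have : (c s - cos (m * s)) ^+ 2 + (d s - sin (m * s)) ^+ 2 = 0.
  by have := cos2Dsin2 (m * s); have := n1 s; have := u1 s; rewrite /u; lra.
move/eqP; rewrite paddr_eq0 ?sqr_ge0// !sqrf_eq0 !subr_eq0.
by case/andP => /eqP -> /eqP ->.
Qed.

End real_functional_equations.

Section complex_functional_equations.
Context {R : realType}.
Implicit Types (z w : R[i]) (f g : R -> R[i]).

Lemma ReM z w : complex.Re (z * w) = complex.Re z * complex.Re w - complex.Im z * complex.Im w.
Proof. by case: z => ? ?; case: w. Qed.

Lemma ImM z w : complex.Im (z * w) = complex.Re z * complex.Im w + complex.Im z * complex.Re w.
Proof. by case: z => ? ?; case: w. Qed.

Lemma ReZ (r : R) z : complex.Re (r%:C%C * z) = r * complex.Re z.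
Proof. by rewrite ReM /= mul0r subr0. Qed.

Lemma ImZ (r : R) z : complex.Im (r%:C%C * z) = r * complex.Im z.
Proof. by rewrite ImM /= mul0r addr0. Qed.

Lemma eqC z w : complex.Re z = complex.Re w -> complex.Im z = complex.Im w -> z = w.
Proof. by case: z w => ? ? [? ?] /= -> ->. Qed.

Lemma conjcM z w : (z * w)^*%C = z^*%C * w^*%C.
Proof. exact: rmorphM. Qed.

Lemma mulcJE z : z * z^*%C = (complex.Re z ^+ 2 + complex.Im z ^+ 2)%:C%C.
Proof. by apply: eqC; case: z => x y /=; ring. Qed.

Lemma sqr_Re_Im_gt0 z : z != 0 -> 0 < complex.Re z ^+ 2 + complex.Im z ^+ 2.
Proof.
move=> z0; rewrite lt_neqAle addr_ge0 ?sqr_ge0// andbT eq_sym.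
rewrite paddr_eq0 ?sqr_ge0// !sqrf_eq0; apply: contra z0 => /andP[h1 h2].
by rewrite eq_complex h1 h2.
Qed.

(* Each of the three difference operators is a shift of [(s, t)] that fixes one
   of the arguments [s + a t], [s - t], [s - a t] and so removes that factor. *)
Lemma triple_difference f g (a A B C : R) : a != 1 -> a != -1 ->
  (forall s, f s != 0) -> (forall s, g s != 0) ->
  (forall s t, f (s + t) * g (s + a * t) = f (s - t) * g (s - a * t)) ->
  f (A + B + C) * f A * f B * f C = f 0 * f (A + B) * f (B + C) * f (A + C).
Proof.
move=> a1 aN1 f0 g0 FE.
have a1' : a - 1 != 0 by rewrite subr_eq0.
have aN1' : 1 + a != 0 by rewrite addrC -[1]opprK subr_eq0.
(* The shifts of [(s, t)] are [(a k, - k)], [(p, p)] and [(a q, q)]; they move [s + t] by [A], [B]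
   and [C]. *)
pose k := A / (a - 1); pose p := B / 2; pose q := C / (1 + a).
have Ak : A = (a - 1) * k by rewrite /k mulrC divfK.
have Bp : B = 2 * p by rewrite /p mulrC divfK// pnatr_eq0.
have Cq : C = (1 + a) * q by rewrite /q mulrC divfK.
have E1 s t : f (s + t + A) / f (s + t) =
    f (s - t + (1 + a) * k) / f (s - t) * (g (s - a * t + 2 * a * k) / g (s - a * t)).
  have := FE (s + a * k) (t - k); have h2 := FE s t.
  have -> : s + a * k + (t - k) = s + t + A by rewrite Ak; ring.
  have -> : s + a * k + a * (t - k) = s + a * t by ring.
  have -> : s + a * k - (t - k) = s - t + (1 + a) * k by ring.
  have -> : s + a * k - a * (t - k) = s - a * t + 2 * a * k by ring.
  move=> h1.
  apply: (@mulIf _ (f (s + t) * g (s + a * t))); first by rewrite mulf_neq0.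
  rewrite [in RHS]h2 [LHS]mulrA divfK// h1; field.
  by rewrite !f0 !g0.
have E2 s t r : r = s + t -> (f (r + B + A) / f (r + B)) / (f (r + A) / f r) =
    (g (s - a * t + (1 - a) * p + 2 * a * k) / g (s - a * t + (1 - a) * p)) /
    (g (s - a * t + 2 * a * k) / g (s - a * t)).
  move=> ->; have := E1 (s + p) (t + p).
  have -> : s + p + (t + p) = s + t + B by rewrite Bp; ring.
  have -> : s + p - (t + p) = s - t by ring.
  have -> : s + p - a * (t + p) = s - a * t + (1 - a) * p by ring.
  move=> ->; rewrite [X in _ / X]E1; field.
  by rewrite !f0 !g0.
(* The points [(0, 0)] and [(a * q, q)] share the value [s - a t = 0], the only quantity on which
   the right side of [E2] depends. Hence the double ratio is the same at [r = 0] and [r = C]. *)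
have h1 := E2 0 0 0 (esym (addr0 0)).
have h2 : C = a * q + q by rewrite Cq; ring.
have := E2 _ _ _ h2.
have -> : a * q - a * q = 0 - a * 0 by ring.
rewrite -h1 !add0r.
have -> : C + B + A = A + B + C by ring.
rewrite [B + A]addrC [C + B]addrC [C + A]addrC => h.
have : f (A + B + C) = (f (A + B) / f B / (f A / f 0)) * (f (B + C) * (f (A + C) / f C)).
  by rewrite -h; field; rewrite !f0.
by move=> ->; field; rewrite !f0.
Qed.

(** The trivial third difference says that a logarithm of [f] would be quadratic. Modulus and phase
    are treated separately instead: the logarithm of the squared modulus obeys the parallelogram
    law, and the phase [th] is a continuous character of the line. *)
Lemma heyde_gaussian f g (a : R) : a != 1 -> a != -1 ->
  (forall s, f s != 0) -> (forall s, g s != 0) ->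
  continuous ((fun s => complex.Re (f s))) -> continuous ((fun s => complex.Im (f s))) ->
  (forall s, f (- s) = (f s)^*%C) ->
  (forall s t, f (s + t) * g (s + a * t) = f (s - t) * g (s - a * t)) ->
  exists sigma m, forall s,
    f s = f 0 * cexp ((- (sigma * s ^+ 2)) +i* (m * s))%C.
Proof.
move=> a1 aN1 f0 g0 cRf cIf fN FE.
have f0R : (f 0)^*%C = f 0 by rewrite -fN oppr0.
pose e s : R[i] := f s / f 0.
have eE s : e s = f s / f 0 by [].
clearbody e.
have e0 s : e s != 0 by rewrite eE mulf_neq0// invr_eq0.
have eN s : e (- s) = (e s)^*%C by rewrite !eE fN rmorphM /= conjc_inv f0R.
have e00 : e 0 = 1 by rewrite eE divff.
pose P s : R := complex.Re (e s) ^+ 2 + complex.Im (e s) ^+ 2.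
have eJ s : e s * e (- s) = (P s)%:C%C by rewrite eN mulcJE.
have P0 s : 0 < P s by exact: sqr_Re_Im_gt0.
have PN s : P (- s) = P s by rewrite /P eN; case: (e s) => x y /=; rewrite sqrrN.
(* The third-difference identity with [C = - A]. *)
have eP A B : e B ^+ 2 * (P A)%:C%C = e (A + B) * e (B - A).
  rewrite -eJ !eE.
  have := triple_difference A B (- A) a1 aN1 f0 g0 FE.
  rewrite subrr [A + B - A]addrAC subrr add0r => h.
  have -> : (f B / f 0) ^+ 2 * (f A / f 0 * (f (- A) / f 0)) =
    (f B * f A * f B * f (- A)) / f 0 ^+ 4 by field; rewrite f0.
  by rewrite h; field; rewrite f0.
have PP A B : P (A + B) * P (A - B) = P A ^+ 2 * P B ^+ 2.
  apply: (@complexI R); have := congr1 (fun z => z * z^*%C) (eP A B).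
  rewrite expr2 !conjcM conjc_real -!eN opprB => h.
  have -> : (P (A + B) * P (A - B))%:C%C =
      e (A + B) * e (- (A + B)) * (e (A - B) * e (- (A - B))) by rewrite rmorphM /= !eJ.
  have -> : (P A ^+ 2 * P B ^+ 2)%:C%C = (P A)%:C%C * (P A)%:C%C * ((e B * e (- B)) * (e B * e (- B))).
    by rewrite !eJ !expr2 !rmorphM.
  transitivity (e (A + B) * e (B - A) * (e (- (A + B)) * e (A - B))); first by rewrite opprB; ring.
  by rewrite -h; ring.
pose phi s := ln (P s).
have cRe : continuous ((fun s => complex.Re (e s))).
  have -> : (fun s => complex.Re (e s)) = fun s => complex.Re (f s) * complex.Re (f 0)^-1 - complex.Im (f s) * complex.Im (f 0)^-1.
    by apply/funext => s; rewrite eE ReM.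
  move=> s; apply: cvgB; apply: cvgM; [exact: cRf|exact: cvg_cst|exact: cIf|exact: cvg_cst].
have cIe : continuous ((fun s => complex.Im (e s))).
  have -> : (fun s => complex.Im (e s)) = fun s => complex.Re (f s) * complex.Im (f 0)^-1 + complex.Im (f s) * complex.Re (f 0)^-1.
    by apply/funext => s; rewrite eE ImM.
  move=> s; apply: cvgD; apply: cvgM; [exact: cRf|exact: cvg_cst|exact: cIf|exact: cvg_cst].
have cP : continuous P.
  move=> s; rewrite /P; apply: cvgD; apply: (@cvg_comp _ _ _ _ (fun x : R => x ^+ 2));
    [exact: cRe|exact: exprn_continuous|exact: cIe|exact: exprn_continuous].
have cphi : continuous phi.
  by move=> s; apply: (@continuous_comp _ _ _ P (@ln R) s (cP s)); exact/continuous_ln/P0.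
have phiE := @parallelogram_quadratic R phi cphi.
have {}phiE s : phi s = phi 1 * s ^+ 2.
  apply: phiE => A B; rewrite /phi -lnM ?posrE// PP lnM ?posrE ?exprn_gt0// !lnXn//.
  by rewrite !mulr_natl.
pose sigma : R := - phi 1 / 2.
pose r (s : R) : R := expR (- (sigma * s ^+ 2)).
have r0 s : r s != 0 by rewrite gt_eqF ?expR_gt0.
have Pr s : P s = r s ^+ 2.
  rewrite -[LHS]lnK ?posrE// -/(phi s) phiE [RHS]expr2 /r -expRD; congr expR.
  by rewrite /sigma; field.
pose th s : R[i] := e s / (r s)%:C%C.
have rC0 s : (r s)%:C%C != 0 :> R[i] by rewrite fmorph_eq0.
(* With [A] the half-difference and [B] the half-sum, [eP] at [(A, B)] yields [e x * e y] and at
   [(B, B)] yields [e (x + y)]; the moduli match by the parallelogram law for [s ^+ 2]. *)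
have thD x y : th (x + y) = th x * th y.
  pose A := (x - y) / 2; pose B := (x + y) / 2.
  have h1 : e B ^+ 2 * (P A)%:C%C = e x * e y.
    by rewrite eP; congr (e _ * e _); rewrite /A /B; field.
  have h2 : e B ^+ 2 * (P B)%:C%C = e (x + y).
    by rewrite eP subrr e00 mulr1; congr (e _); rewrite /B; field.
  have h3 : r (x + y) * r A ^+ 2 = r x * r y * r B ^+ 2.
    by rewrite (expr2 (r A)) (expr2 (r B)) /r -!expRD; congr expR; rewrite /A /B; field.
  have PC s : (P s)%:C%C = (r s)%:C%C ^+ 2 :> R[i] by rewrite Pr rmorphXn.
  rewrite /th mulrACA -h1 -h2 !PC -invfM -rmorphM /=.
  have rr0 : (r x * r y)%:C%C != 0 :> R[i] by rewrite fmorph_eq0 mulf_neq0.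
  apply: (@mulIf _ ((r (x + y))%:C%C * (r x * r y)%:C%C)).
    by rewrite mulf_neq0.
  have h3' : (r (x + y))%:C%C * (r A)%:C%C ^+ 2 = (r x * r y)%:C%C * (r B)%:C%C ^+ 2 :> R[i].
    by rewrite -!rmorphXn -!rmorphM h3.
  transitivity (e B ^+ 2 * ((r x * r y)%:C%C * (r B)%:C%C ^+ 2)).
    by field; rewrite rC0.
  by rewrite -h3'; field; rewrite ?rC0 ?r0.
have thE s : th s = (r s)^-1%:C%C * e s by rewrite /th mulrC fmorphV.
have cr : continuous (fun s => (r s)^-1).
  move=> s; apply: cvgV; first exact: r0.
  apply: (@continuous_comp _ _ _ (fun x : R => - (sigma * x ^+ 2)) (@expR R) s);
    last exact: continuous_expR.
  by apply: cvgN; apply: cvgM; [exact: cvg_cst|exact: exprn_continuous].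
have [m hm] : exists m, forall s, complex.Re (th s) = cos (m * s) /\ complex.Im (th s) = sin (m * s).
  apply: circle_character.
  - have -> : (fun s => complex.Re (th s)) = (fun s => (r s)^-1 * complex.Re (e s)).
      by apply/funext => s; rewrite thE ReZ.
    by move=> s; apply: cvgM; [exact: cr|exact: cRe].
  - have -> : (fun s => complex.Im (th s)) = (fun s => (r s)^-1 * complex.Im (e s)).
      by apply/funext => s; rewrite thE ImZ.
    by move=> s; apply: cvgM; [exact: cr|exact: cIe].
  - move=> s; rewrite thE ReZ ImZ !exprMn -mulrDr -/(P s) Pr -exprMn mulVf ?expr1n//.
  - by move=> x y; rewrite thD ReM.
  - by move=> x y; rewrite thD ImM; ring.
exists sigma, m => s.
have -> : f s = f 0 * (th s * (r s)%:C%C) by rewrite /th divfK// eE mulrC divfK.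
congr (_ * _); rewrite mulrC; have [hR hI] := hm s.
by apply: eqC; rewrite ?ReZ ?ImZ ?hR ?hI.
Qed.

End complex_functional_equations.

(** * Characters of a finite Abelian group *)

Section finite_fourier.
Context {R : realType} {G : finZmodType}.
Implicit Types (h : char_group R G) (F : G -> R[i]).

(** ['X^n - 1] splits with distinct roots, and [n] distinct [n]-th roots of unity include a
    primitive one. *)
Lemma prim_root_complex n : (0 < n)%N -> exists z : R[i], n.-primitive_root z.
Proof.
move=> n0; have [r rE] := closed_field_poly_normal ('X^n - 1 : {poly R[i]}).
move: rE; rewrite (monicP _) ?monicXnsubC// scale1r => rE.
have : has n.-primitive_root r.
  apply: has_prim_root => //.
  - by apply/allP => z; rewrite -root_prod_XsubC -rE.
  - by rewrite -separable_prod_XsubC -rE separable_Xn_sub_1// pnatr_eq0 -lt0n.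
  - by rewrite -ltnS -(size_prod_XsubC r id) -rE size_XnsubC.
by move=> /hasP[z _ zn]; exists z.
Qed.

Lemma mulrn_cardT (x : G) : x *+ #|G| = 0.
Proof. by rewrite -FinRing.zmodXgE -cardsT; apply: expg_cardG; rewrite inE. Qed.

Lemma cardT_gt0 : (0 < #|G|)%N.
Proof. by apply/card_gt0P; exists 0. Qed.

Definition translation_eigen (l : seq G) F :=
  forall x, x \in l -> exists lam, forall y, F (y + x) = lam * F y.

(** Translation by [x] has order dividing [#|G|], so averaging over its powers against roots of
    unity splits any function into eigenfunctions. Translations commute, hence the eigenfunctions
    for earlier elements of [l] stay such. *)
Lemma eigen_decomposition (l : seq G) F :
  exists (I : finType) (Fs : I -> G -> R[i]),
    (forall i, translation_eigen l (Fs i)) /\ forall g, F g = \sum_i Fs i g.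
Proof.
elim: l => [|x l [I [Fs [eFs FE]]]].
  by exists unit, (fun _ => F); split => // g; rewrite big_const card_unit /= addr0.
have [z zP] := prim_root_complex cardT_gt0.
have zm := prim_expr_order zP.
have m0 : #|G|%:R != 0 :> R[i] by rewrite pnatr_eq0 -lt0n cardT_gt0.
(* [Q j] projects onto the eigenspace of translation by [x] with eigenvalue [z ^+ j]. *)
pose Q (j : nat) F' y : R[i] := #|G|%:R^-1 * \sum_(k < #|G|) z ^+ j ^- k * F' (y + x *+ k).
exists (I * 'I_#|G|)%type, (fun p : I * 'I_#|G| => Q p.2 (Fs p.1)); split; last first.
  move=> g; rewrite FE -(pair_bigA _ (fun i (j : 'I_#|G|) => Q j (Fs i) g)) /=.
  apply: eq_bigr => i _; rewrite /Q -mulr_sumr exchange_big /=.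
  have lam (k : 'I_#|G|) : \sum_(j < #|G|) z ^+ j ^- k * Fs i (g + x *+ k) =
      if k == 0%N :> nat then #|G|%:R * Fs i g else 0.
    rewrite -mulr_suml; have [->|k0] := eqVneq (nat_of_ord k) 0%N.
      under eq_bigr do rewrite expr0 invr1.
      by rewrite sumr_const card_ord mulr0n addr0.
    have -> : \sum_(j < #|G|) z ^+ j ^- k = \sum_(j < #|G|) (z ^- k) ^+ j.
      by apply: eq_bigr => j _; rewrite -exprM mulnC exprM exprVn.
    suff -> : \sum_(j < #|G|) (z ^- k) ^+ j = 0 by rewrite mul0r.
    apply: (@mulfI _ (z ^- k - 1)).
      rewrite subr_eq0 invr_eq1 -(prim_order_dvd zP).
      by apply/negP => /(dvdn_leq _); rewrite lt0n k0 leqNgt ltn_ord => /(_ isT).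
    by rewrite mulr0 -subrX1 exprVn -exprM mulnC exprM zm expr1n invr1 subrr.
  under eq_bigr do rewrite lam.
  rewrite (bigD1 (Ordinal cardT_gt0))//= big1 ?addr0 ?mulKf//.
  by move=> k; rewrite -val_eqE /= => /negbTE ->.
move=> [i j] /= x'; rewrite inE => /orP[/eqP ->{x'}|x'l]; last first.
  have [lam hl] := eFs i x' x'l; exists lam => y.
  rewrite /Q mulrCA; congr (_ * _); rewrite mulr_sumr; apply: eq_bigr => k _.
  by rewrite addrAC hl mulrCA.
exists (z ^+ j) => y; rewrite /Q mulrCA; congr (_ * _).
have zj0 : z ^+ j != 0.
  apply/expf_neq0/eqP => z0; move: zm; rewrite z0 expr0n gtn_eqF ?cardT_gt0//.
  by move/esym/eqP; rewrite oner_eq0.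
pose u k := z ^+ j ^- k * Fs i (y + x *+ k).
transitivity (z ^+ j * \sum_(k < #|G|) u k.+1).
  rewrite mulr_sumr; apply: eq_bigr => k _.
  rewrite /u exprS invfM !mulrA divff// mul1r mulrS addrA; congr (_ * Fs i _).
congr (_ * _).
(* The sum is cyclic: [u #|G|] equals [u 0], so shifting the index changes nothing. *)
suff : \sum_(k < #|G|) u k.+1 + u 0%N = \sum_(k < #|G|) u k + u 0%N by move/addIr.
rewrite addrC -(big_ord_recl #|G| (fun k => u k)) big_ord_recr /=; congr (_ + _).
by rewrite /u mulrn_cardT mulr0n expr0 -exprM mulnC exprM zm expr1n.
Qed.

(** The eigenvalue for translation by [y] must be [F y / F 0], which makes [F / F 0] multiplicative;
    its values are roots of unity because [#|G|] annihilates the group. *)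
Lemma eigen_char F : translation_eigen (enum G) F -> F 0 != 0 ->
  exists h, forall g, F g = F 0 * h g.
Proof.
move=> eF F0.
have FD x y : F (x + y) = F x * F y / F 0.
  have [|lam hl] := eF y; first by rewrite mem_enum.
  have -> : F y = lam * F 0 by rewrite -{1}(add0r y) hl.
  by rewrite hl; field.
pose h g := F g / F 0.
have hD x y : h (x + y) = h x * h y by rewrite /h FD; field.
have h0 : h 0 = 1 by rewrite /h divff.
have hX x n : h (x *+ n) = h x ^+ n.
  by elim: n => [|n IH]; rewrite ?mulr0n// mulrS exprS hD IH.
have hN x : `|h x| = 1.
  apply/eqP; rewrite -(@pexpr_eq1 _ _ #|G|) ?cardT_gt0// -normrX -hX.
  by rewrite mulrn_cardT h0 normr1.
by exists (CharGroup hN hD) => g; rewrite /= /h mulrC divfK.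
Qed.

Definition char1 : char_group R G.
Proof.
by refine (@CharGroup R G (fun=> 1) _ _) => *; rewrite ?normr1 ?mulr1.
Defined.

Lemma char_span F :
  exists (I : finType) (c : I -> R[i]) (h : I -> char_group R G),
    forall g, F g = \sum_i c i * h i g.
Proof.
have [I [Fs [eFs FE]]] := eigen_decomposition (enum G) F.
have /choice[h hE] : forall i, exists h, forall g, Fs i g = Fs i 0 * h g.
  move=> i; have [F0|F0] := eqVneq (Fs i 0) 0; last exact: eigen_char.
  (* An eigenfunction that vanishes at 0 vanishes everywhere, so any character will do with
     coefficient 0. *)
  exists char1 => g; rewrite F0 mul0r.
  have [|lam hl] := eFs i g; first by rewrite mem_enum.
  by rewrite -(add0r g) hl F0 mulr0.
exists I, (fun i => Fs i 0), h => g; rewrite FE.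
by apply: eq_bigr => i _; rewrite hE.
Qed.

(** The point mass at [g] is a combination of characters, so pairing [c] with it gives 0. *)
Lemma finite_fourier_inj (c : G -> R[i]) :
  (forall h, \sum_g c g * h g = 0) -> forall g, c g = 0.
Proof.
move=> ch g.
have [I [b [h hE]]] := char_span (fun x => (x == g)%:R).
transitivity (\sum_x c x * (x == g)%:R).
  rewrite (bigD1 g)//= eqxx mulr1 big1 ?addr0// => x /negbTE ->.
  by rewrite mulr0.
under eq_bigr do rewrite hE mulr_sumr.
rewrite exchange_big big1//= => i _.
under eq_bigr do rewrite mulrCA.
by rewrite -mulr_sumr ch mulr0.
Qed.

(** Otherwise the difference of the point masses at [x] and [y] would be a nonzero function
    annihilated by all characters. *)
Lemma char_separation (x y : G) : (forall h, h x = h y) -> x = y.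
Proof.
move=> hxy; apply/eqP; rewrite -[_ == _]negbK; apply/negP => xy.
have /(_ _ x) := @finite_fourier_inj (fun z => (z == x)%:R - (z == y)%:R).
rewrite eqxx (negbTE xy) subr0 => h1; suff /h1/eqP : forall h, \sum_g ((g == x)%:R - (g == y)%:R) * h g = 0.
  by rewrite oner_eq0.
move=> h; under eq_bigr do rewrite mulrBl.
rewrite sumrB (bigD1 x)//= [X in _ - X](bigD1 y)//= !eqxx !mul1r hxy.
rewrite big1 ?addr0; last by move=> z /negbTE ->; rewrite mul0r.
by rewrite big1 ?addr0 ?subrr// => z /negbTE ->; rewrite mul0r.
Qed.

End finite_fourier.

(** * Gaussian integrals *)

Section gaussian_integrals.
Context {R : realType}.
Notation leb := (@lebesgue_measure R).
Implicit Types (c t x : R).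

Definition gauss c x := expR (- (c * x ^+ 2)).

Lemma gauss_gt0 c x : 0 < gauss c x. Proof. exact: expR_gt0. Qed.

Lemma continuous_gauss c : continuous (gauss c).
Proof.
move=> x; apply: (@continuous_comp _ _ _ (fun x : R => - (c * x ^+ 2)) (@expR R) x);
  last exact: continuous_expR.
by apply: cvgN; apply: cvgM; [exact: cvg_cst|exact: exprn_continuous].
Qed.

Lemma measurable_gauss c : measurable_fun setT (gauss c).
Proof. apply: continuous_measurable_fun; exact: continuous_gauss. Qed.

(** Rewriting as the normal density of variance [1 / (2 c)] makes the known total mass of that
    density available. *)
Lemma gauss_normal_pdf c m x : 0 < c ->
  gauss c (x - m) = Num.sqrt (pi / c) * normal_pdf m (Num.sqrt (2 * c)^-1) x.
Proof.
move=> c0; have s0 : Num.sqrt (2 * c)^-1 != 0.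
  by rewrite gt_eqF// sqrtr_gt0 invr_gt0 mulr_gt0.
have ss : Num.sqrt (2 * c)^-1 ^+ 2 = (2 * c)^-1.
  by rewrite sqr_sqrtr// invr_ge0 mulr_ge0// ltW.
rewrite normal_pdfE// /normal_peak /normal_fun ss.
have -> : (2 * c)^-1 * pi *+ 2 = pi / c by field; rewrite gt_eqF.
rewrite mulVKf; last by rewrite gt_eqF// sqrtr_gt0 divr_gt0// pi_gt0.
by rewrite /gauss; congr expR; field; rewrite gt_eqF.
Qed.

Lemma integral_gauss_center c m : 0 < c ->
  (\int[leb]_x (gauss c (x - m))%:E)%E = (Num.sqrt (pi / c))%:E.
Proof.
move=> c0; under eq_integral do rewrite gauss_normal_pdf// EFinM.
rewrite integralZl//; last exact: integrable_normal_pdf.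
by rewrite integral_normal_pdf mule1.
Qed.

Lemma integral_gauss c : 0 < c ->
  (\int[leb]_x (gauss c x)%:E)%E = (Num.sqrt (pi / c))%:E.
Proof.
move=> c0; rewrite -(integral_gauss_center 0 c0).
by apply: eq_integral => x _; rewrite subr0.
Qed.

Lemma integrable_gauss c : 0 < c -> leb.-integrable setT (EFin \o gauss c).
Proof.
move=> c0; apply/integrableP; split.
  apply/measurable_EFinP; exact: measurable_gauss.
under eq_integral do rewrite /= ger0_norm ?(ltW (gauss_gt0 _ _))//.
by rewrite integral_gauss// ltry.
Qed.

Lemma integrable_le_gauss (f : R -> R) c (M : R) : 0 < c ->
  measurable_fun setT f -> (forall x, `|f x| <= M * gauss c x) ->
  leb.-integrable setT (EFin \o f).
Proof.
move=> c0 mf fM.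
have ig : leb.-integrable setT (fun x => M%:E * (EFin \o gauss c) x)%E.
  by apply: integrableZl => //; exact: integrable_gauss.
apply: (le_integrable measurableT _ _ ig); first exact/measurable_EFinP.
by move=> x _; rewrite /= lee_fin (le_trans (fM x))// ler_norm.
Qed.

(** Half of the exponent absorbs the linear factor, through [1 + x <= expR x]; the other half
    remains integrable and dominates derivatives in the frequency. *)
Lemma norm_mul_gauss_le c x : 0 < c -> `|x| * gauss c x <= (1 + c^-1) * gauss (c / 2) x.
Proof.
move=> c0; have -> : gauss c x = gauss (c / 2) x * gauss (c / 2) x.
  by rewrite /gauss -expRD; congr expR; field.
rewrite mulrA ler_pM2r ?gauss_gt0// -ler_pdivlMr ?gauss_gt0//.
have -> : (gauss (c / 2) x)^-1 = expR (c / 2 * x ^+ 2) by rewrite /gauss expRN invrK.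
apply: (@le_trans _ _ ((1 + c^-1) * (1 + c / 2 * x ^+ 2))); last first.
  by rewrite ler_pM2l ?expR_ge1Dx// ltr_pwDl// invr_ge0 ltW.
have -> : (1 + c^-1) * (1 + c / 2 * x ^+ 2) = 1 + x ^+ 2 / 2 + (c^-1 + c / 2 * x ^+ 2).
  by field; rewrite gt_eqF.
apply: (@le_trans _ _ (1 + x ^+ 2 / 2)); last first.
  by rewrite lerDl addr_ge0 ?invr_ge0 ?(ltW c0)// mulr_ge0 ?sqr_ge0// divr_ge0 ?(ltW c0).
rewrite -(real_normK (num_real x)); have := sqr_ge0 (`|x| - 1); nra.
Qed.

Lemma gauss_cvg0 c (e : R) : 0 < c -> e = 1 \/ e = -1 ->
  gauss c (e * n%:R) @[n --> \oo] --> (0 : R).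
Proof.
move=> c0 e1.
have -> : (fun n => gauss c (e * n%:R)) = (fun n => gauss c n%:R).
  by apply/funext => n; rewrite /gauss exprMn; case: e1 => ->; rewrite ?sqrrN expr1n mul1r.
have h : (fun n => (expR (- c)) ^+ n) @ \oo --> (0 : R).
  by apply: cvg_expr; rewrite ger0_norm ?expR_ge0// -expR0 ltr_expR; lra.
have sqn k : (k <= k ^ 2)%N by case: k => // k; rewrite expnS leq_pmulr.
apply: (squeeze_cvgr _ (@cvg_cst _ (0 : R) _ _ _) h).
near=> n; rewrite ltW ?gauss_gt0//= /gauss -expRM_natl ler_expR.
rewrite mulrN lerN2 mulrC ler_pM2l// -natrX ler_nat.
exact: sqn.
Unshelve. all: end_near. Qed.

(** The fundamental theorem of calculus on [[-n, n]], then dominated convergence. *)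
Lemma integral_derive_eq0 (F f : R -> R) : continuous f ->
  (forall x : R, is_derive x 1 F (f x)) ->
  F n%:R @[n --> \oo] --> (0 : R) -> F (- n%:R) @[n --> \oo] --> (0 : R) ->
  leb.-integrable setT (EFin \o f) -> (\int[leb]_x (f x)%:E = 0)%E.
Proof.
move=> cf dF F0 FN0 intf.
have mf : measurable_fun setT f by exact: continuous_measurable_fun.
have h : (fun n : nat => \int[leb]_x (f x * \1_(`[- n%:R, n%:R]) x)%:E)%E @ \oo -->
   (\int[leb]_x (EFin \o f) x)%E.
  apply: (@dominated_cvg _ _ _ leb setT measurableT
    (fun n x => (f x * \1_(`[- n%:R, n%:R]) x)%:E) (EFin \o f) (fun x => `|f x|%:E)).
  - move=> n; apply/measurable_EFinP/measurable_funM => //.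
  - move=> x _; apply: cvg_near_cst; exists (Num.truncn `|x|).+1 => // n /= xn.
    rewrite indicE mem_set ?mulr1//= in_itv/= -ler_norml.
    by rewrite (le_trans (ltW (truncnS_gt _)))// ler_nat.
  - by move=> x _.
  - exact: (integrable_norm intf).
  - move=> n x _; rewrite lee_fin normrM ler_piMr// indicE.
    by case: (_ \in _); rewrite ?normr1// normr0.
have h2 : (fun n : nat => \int[leb]_x (f x * \1_(`[- n%:R, n%:R]) x)%:E)%E @ \oo --> 0%E.
  have h3 : (fun n : nat => (F n%:R - F (- n%:R))%:E) @ \oo --> 0%E.
    apply: cvg_EFin; first exact: nearW.
    by rewrite -[X in _ --> X](subrr 0); apply: cvgB.
  apply: cvg_trans h3; apply: near_eq_cvg; near=> n.
  have n0 : (0 < n)%N by near: n; exists 1%N.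
  rewrite EFinB -(@continuous_FTC2 _ f F (- n%:R) n%:R)//.
  - rewrite integral_mkcond; apply: eq_integral => x _.
    by rewrite /= restrict_EFin /= patchE indicE; case: (_ \in _); rewrite ?mulr1 ?mulr0.
  - by rewrite -subr_gt0 opprK addr_gt0// ltr0n.
  - exact: continuous_subspaceT.
  - split.
    + by move=> x _; have := dF x => -[].
    + apply: cvg_at_right_filter; apply: differentiable_continuous.
      by apply/derivable1_diffP; have := dF (- n%:R) => -[].
    + apply: cvg_at_left_filter; apply: differentiable_continuous.
      by apply/derivable1_diffP; have := dF n%:R => -[].
  - by move=> x _; rewrite derive1E; apply: derive_val.
exact: (cvg_unique _ h h2).
Unshelve. all: end_near. Qed.

Lemma measurable_cosM t : measurable_fun setT (fun x : R => cos (t * x)).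
Proof.
apply: continuous_measurable_fun => x.
apply: (@continuous_comp _ _ _ (fun x : R => t * x) (@cos R) x);
  last exact: continuous_cos.
by apply: cvgM; [exact: cvg_cst|exact: cvg_id].
Qed.

Lemma measurable_sinM t : measurable_fun setT (fun x : R => sin (t * x)).
Proof.
apply: continuous_measurable_fun => x.
apply: (@continuous_comp _ _ _ (fun x : R => t * x) (@sin R) x);
  last exact: continuous_sin.
by apply: cvgM; [exact: cvg_cst|exact: cvg_id].
Qed.

Lemma cos_norm_le1 (x : R) : `|cos x| <= 1.
Proof. by rewrite ler_norml cos_geN1 cos_le1. Qed.

Lemma sin_norm_le1 (x : R) : `|sin x| <= 1.
Proof. by rewrite ler_norml sin_geN1 sin_le1. Qed.

Lemma integrable_gauss_cos c t : 0 < c ->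
  leb.-integrable setT (EFin \o (fun x => gauss c x * cos (t * x))).
Proof.
move=> c0; apply: (@integrable_le_gauss _ c 1) => //.
  by apply: measurable_funM; [exact: measurable_gauss|exact: measurable_cosM].
move=> x; rewrite mul1r normrM (ger0_norm (ltW (gauss_gt0 _ _))) ler_piMr//.
  exact/ltW/gauss_gt0.
exact: cos_norm_le1.
Qed.

Lemma integrable_gauss_sin c t : 0 < c ->
  leb.-integrable setT (EFin \o (fun x => x * gauss c x * sin (t * x))).
Proof.
move=> c0; apply: (@integrable_le_gauss _ (c / 2) (1 + c^-1)); first exact: divr_gt0.
  apply: measurable_funM; last exact: measurable_sinM.
  by apply: measurable_funM => //; exact: measurable_gauss.
move=> x; apply: le_trans (norm_mul_gauss_le x c0).
rewrite !normrM (ger0_norm (ltW (gauss_gt0 _ _))) ler_piMr//.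
  by rewrite mulr_ge0// ltW// gauss_gt0.
exact: sin_norm_le1.
Qed.

Lemma is_derive_gauss c (x : R) : is_derive x 1 (gauss c) (- (2 * c * x * gauss c x)).
Proof.
rewrite /gauss; apply: is_derive_eq.
by rewrite /GRing.scale /=; ring.
Qed.

(** Integration by parts: [h] is the derivative of [gauss c x * sin (t * x)], which vanishes at both
    ends. *)
Lemma integral_x_gauss_sin c t : 0 < c ->
  \int[leb]_x (x * gauss c x * sin (t * x)) =
  t / (2 * c) * \int[leb]_x (gauss c x * cos (t * x)).
Proof.
move=> c0.
pose h x := t * (gauss c x * cos (t * x)) - 2 * c * (x * gauss c x * sin (t * x)).
have i1 : leb.-integrable setT (EFin \o (fun x => t * (gauss c x * cos (t * x)))).
  by apply: (integrableZl measurableT _ (integrable_gauss_cos t c0)).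
have i2 : leb.-integrable setT (EFin \o (fun x => 2 * c * (x * gauss c x * sin (t * x)))).
  by apply: (integrableZl measurableT _ (integrable_gauss_sin t c0)).
have : \int[leb]_x h x = 0.
  have cvg0 (e : R) : e = 1 \/ e = -1 ->
      gauss c (e * n%:R) * sin (t * (e * n%:R)) @[n --> \oo] --> (0 : R).
    move=> e1; have g0 := gauss_cvg0 c0 e1.
    have gN0 : - gauss c (e * n%:R) @[n --> \oo] --> (0 : R).
      by rewrite -oppr0; exact: cvgN.
    apply: squeeze_cvgr gN0 g0; near=> n; rewrite -ler_norml normrM.
    rewrite (ger0_norm (ltW (gauss_gt0 _ _))) ler_piMr ?sin_norm_le1//.
    exact/ltW/gauss_gt0.
  rewrite /Rintegral; suff -> : (\int[leb]_x (h x)%:E = 0)%E by [].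
  apply: (@integral_derive_eq0 (fun x => gauss c x * sin (t * x)) h).
  - move=> x; apply: cvgB; apply: cvgM; [exact: cvg_cst| |exact: cvg_cst|].
    + apply: cvgM; first exact: continuous_gauss.
      apply: (@continuous_comp _ _ _ (fun x : R => t * x) (@cos R) x);
        last exact: continuous_cos.
      by apply: cvgM; [exact: cvg_cst|exact: cvg_id].
    + apply: cvgM; first by apply: cvgM; [exact: cvg_id|exact: continuous_gauss].
      apply: (@continuous_comp _ _ _ (fun x : R => t * x) (@sin R) x);
        last exact: continuous_sin.
      by apply: cvgM; [exact: cvg_cst|exact: cvg_id].
  - move=> x; have dg := is_derive_gauss c x.
    by apply: is_derive_eq; rewrite /h /GRing.scale /=; ring.
  - by under eq_fun do rewrite -[_%:R]mul1r; apply: cvg0; left.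
  - by under eq_fun do rewrite -mulN1r; apply: cvg0; right.
  - exact: (integrableB measurableT i1 i2).
rewrite RintegralB// !RintegralZl//; [|exact: integrable_gauss_sin|exact: integrable_gauss_cos].
move/eqP; rewrite subr_eq0 => /eqP h1.
apply: (@mulfI _ (2 * c)); first by rewrite mulf_neq0// gt_eqF.
by rewrite -h1 mulrA; congr (_ * _); field; rewrite gt_eqF.
Unshelve. all: end_near. Qed.

(** As a function of [t] the integral solves the linear equation [F' = - t / (2 c) F], so
    multiplying by [expR (t ^+ 2 / (4 * c))] gives a constant, known at [t = 0]. *)
Lemma integral_gauss_cos c t : 0 < c ->
  \int[leb]_x (gauss c x * cos (t * x)) =
  Num.sqrt (pi / c) * expR (- (t ^+ 2 / (4 * c))).
Proof.
move=> c0.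
pose F t := \int[leb]_x (gauss c x * cos (t * x)).
have dF (t' : R) : is_derive t' 1 F (- (t' / (2 * c)) * F t').
  pose f t x := gauss c x * cos (t * x).
  have d1f (u x : R) : is_derive u 1 (f ^~ x) (- (x * gauss c x * sin (u * x))).
    by rewrite /f; apply: is_derive_eq; rewrite /GRing.scale /=; ring.
  have d1fE (u x : R) : derive1 (f ^~ x) u = - (x * gauss c x * sin (u * x)).
    by rewrite derive1E; apply: derive_val.
  have It : (`]t' - 1, t' + 1[%classic : set R) t'.
    by rewrite /= in_itv /= ltrBlDr !ltrDl ltr01.
  pose Gd x := (1 + c^-1) * gauss (c / 2) x.
  have Gub (u x : R) : `|derive1 (f ^~ x) u| <= Gd x.
    rewrite d1fE normrN; apply: le_trans (norm_mul_gauss_le x c0).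
    rewrite !normrM (ger0_norm (ltW (gauss_gt0 _ _))) ler_piMr//.
      by rewrite mulr_ge0// ltW// gauss_gt0.
    exact: sin_norm_le1.
  have iG : leb.-integrable setT (EFin \o Gd).
    apply: (@integrable_le_gauss _ (c / 2) (1 + c^-1)); first exact: divr_gt0.
      by apply: measurable_funM => //; exact: measurable_gauss.
    move=> x; rewrite ger0_norm// mulr_ge0// ?addr_ge0// ?invr_ge0 ?ltW//.
    exact: gauss_gt0.
  have Gd0 x : 0 <= Gd x.
    by rewrite mulr_ge0// ?addr_ge0// ?invr_ge0 ?ltW//; exact: gauss_gt0.
  have der := @derivable_under_integral R _ _ leb f setT measurableT t' _ _ It
    (fun u _ => integrable_gauss_cos u c0) (fun u x _ _ => @ex_derive _ _ _ _ _ _ _ (d1f u x)) Gd Gd0 iG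
    (fun u x _ _ => Gub u x).
  have val := @differentiation_under_integral R _ _ leb f setT measurableT t' _ _ It
    (fun u _ => integrable_gauss_cos u c0) (fun u x _ _ => @ex_derive _ _ _ _ _ _ _ (d1f u x)) Gd Gd0 iG
    (fun u x _ _ => Gub u x).
  split; first exact: der.
  rewrite -derive1E val /partial1of2.
  under eq_Rintegral do rewrite d1fE -mulN1r.
  rewrite RintegralZl//; last exact: integrable_gauss_sin.
  by rewrite integral_x_gauss_sin// mulN1r mulNr.
pose K t := F t * expR (t ^+ 2 / (4 * c)).
have KE t' : K t' = K 0.
  apply: is_derive_0_is_cst => s; rewrite /K; have dFs := dF s.
  apply: is_derive_eq; rewrite /GRing.scale /=; field; rewrite gt_eqF//.
have : K t = Num.sqrt (pi / c).
  rewrite KE /K expr0n mul0r expR0 mulr1 /F.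
  under eq_Rintegral do rewrite mul0r cos0 mulr1.
  by rewrite /Rintegral integral_gauss.
by rewrite /K => <-; rewrite -mulrA -expRD subrr expR0 mulr1.
Qed.

End gaussian_integrals.

(** * Integrals of bounded complex functions *)

Section bounded_measurable.
Context {d} {T : measurableType d} {R : realType}.
Implicit Types f g : T -> R.

(** Bounded measurable functions form an algebra whose members are integrable for every probability,
    so integrability conditions below reduce to closure rules. *)
Definition bmf f := measurable_fun setT f /\ exists M : R, forall x, `|f x| <= M.

Lemma bmf_cst (c : R) : bmf (fun=> c).
Proof. by split=> //; exists `|c|. Qed.

Lemma bmfD f g : bmf f -> bmf g -> bmf (fun x => f x + g x).
Proof.
move=> [mf [M fM]] [mg [N gN]]; split; first exact: measurable_funD.
by exists (M + N) => x; rewrite (le_trans (ler_normD _ _))// lerD.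
Qed.

Lemma bmfM f g : bmf f -> bmf g -> bmf (fun x => f x * g x).
Proof.
move=> [mf [M fM]] [mg [N gN]]; split; first exact: measurable_funM.
by exists (M * N) => x; rewrite normrM ler_pM.
Qed.

Lemma bmfN f : bmf f -> bmf (fun x => - f x).
Proof.
move=> hf; have := bmfM (bmf_cst (-1)) hf.
by under eq_fun do rewrite mulN1r.
Qed.

Lemma bmfB f g : bmf f -> bmf g -> bmf (fun x => f x - g x).
Proof. by move=> hf hg; apply: bmfD => //; exact: bmfN. Qed.

Lemma bmf_integrable (mu : {finite_measure set T -> \bar R}) (D : set T) f :
  measurable D -> bmf f -> mu.-integrable D (EFin \o f).
Proof.
move=> mD [mf [M fM]]; apply: measurable_bounded_integrable => //.
- by rewrite ltey_eq fin_num_measure.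
- exact: measurable_funTS.
- by exists M; split; [exact: num_real|] => y My x _ /=; rewrite (le_trans (fM x))// ltW.
Qed.

End bounded_measurable.

Lemma bmf_comp {d d'} {T : measurableType d} {U : measurableType d'} {R : realType}
    (f : U -> R) (X : T -> U) :
  measurable_fun setT X -> bmf f -> bmf (fun x => f (X x)).
Proof.
move=> mX [mf [M fM]]; split; first exact: measurableT_comp mf mX.
by exists M => x; exact: fM.
Qed.

Section complex_integral.
Context {d} {T : measurableType d} {R : realType}.
Implicit Types (f g : T -> R[i]) (mu : probability T R).

Definition cbm f := bmf (fun x => complex.Re (f x)) /\ bmf (fun x => complex.Im (f x)).

Lemma cbm_cst (c : R[i]) : cbm (fun=> c).
Proof. by split; exact: bmf_cst. Qed.

Lemma cbmD f g : cbm f -> cbm g -> cbm (fun x => f x + g x).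
Proof.
move=> [rf If] [rg Ig]; split.
  rewrite [X in bmf X](_ : _ = fun x => complex.Re (f x) + complex.Re (g x)); first exact: bmfD.
  by apply/funext => x; case: (f x) => ? ?; case: (g x).
rewrite [X in bmf X](_ : _ = fun x => complex.Im (f x) + complex.Im (g x)); first exact: bmfD.
by apply/funext => x; case: (f x) => ? ?; case: (g x).
Qed.

Lemma cbmM f g : cbm f -> cbm g -> cbm (fun x => f x * g x).
Proof.
move=> [rf If] [rg Ig]; split.
  by under eq_fun do rewrite ReM; apply: bmfB; exact: bmfM.
by under eq_fun do rewrite ImM; apply: bmfD; exact: bmfM.
Qed.

Lemma cbm_sum (I : Type) (r : seq I) (F : I -> T -> R[i]) :
  (forall i, cbm (F i)) -> cbm (fun x => \sum_(i <- r) F i x).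
Proof.
move=> cF; elim: r => [|i r IH].
  by under eq_fun do rewrite big_nil; exact: cbm_cst.
by under eq_fun do rewrite big_cons; exact: cbmD.
Qed.

Lemma cintegralD mu f g : cbm f -> cbm g ->
  cintegral mu (fun x => f x + g x) = cintegral mu f + cintegral mu g.
Proof.
move=> [rf If] [rg Ig]; apply: eqC.
  rewrite /= -RintegralD//; try exact: (bmf_integrable mu measurableT).
  by apply: eq_Rintegral => x _; case: (f x) => ? ?; case: (g x).
rewrite /= -RintegralD//; try exact: (bmf_integrable mu measurableT).
by apply: eq_Rintegral => x _; case: (f x) => ? ?; case: (g x).
Qed.

Lemma cintegralZ mu (c : R[i]) f : cbm f ->
  cintegral mu (fun x => c * f x) = c * cintegral mu f.
Proof.
move=> [rf If]; apply: eqC.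
  rewrite ReM /= -!RintegralZl -?RintegralB//; try exact: (bmf_integrable mu measurableT).
  - by apply: eq_Rintegral => x _; rewrite ReM.
  - by apply: (bmf_integrable mu measurableT); apply: bmfM => //; exact: bmf_cst.
  - by apply: (bmf_integrable mu measurableT); apply: bmfM => //; exact: bmf_cst.
rewrite ImM /= -!RintegralZl -?RintegralD//; try exact: (bmf_integrable mu measurableT).
- by apply: eq_Rintegral => x _; rewrite ImM.
- by apply: (bmf_integrable mu measurableT); apply: bmfM => //; exact: bmf_cst.
- by apply: (bmf_integrable mu measurableT); apply: bmfM => //; exact: bmf_cst.
Qed.

Lemma eq_cintegral mu f g : f =1 g -> cintegral mu f = cintegral mu g.
Proof. by move=> /funext ->. Qed.

Lemma integral_probability_cst mu (c : R) : (\int[mu]_x c%:E)%E = c%:E.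
Proof.
rewrite integral_cst// (_ : (mu : measure _ _) setT = 1%E) ?mule1//.
exact: probability_setT.
Qed.

Lemma Rintegral_probability_cst mu (c : R) : \int[mu]_x c = c.
Proof. by rewrite /Rintegral integral_probability_cst. Qed.

Lemma cintegral_cst mu (c : R[i]) : cintegral mu (fun=> c) = c.
Proof.
by apply: eqC; exact: Rintegral_probability_cst.
Qed.

Lemma cintegral_sum mu (I : Type) (r : seq I) (F : I -> T -> R[i]) :
  (forall i, cbm (F i)) ->
  cintegral mu (fun x => \sum_(i <- r) F i x) = \sum_(i <- r) cintegral mu (F i).
Proof.
move=> cF; elim: r => [|i r IH].
  by under eq_cintegral do rewrite big_nil; rewrite cintegral_cst big_nil.
under eq_cintegral do rewrite big_cons.
by rewrite cintegralD ?IH ?big_cons//; exact: cbm_sum.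
Qed.

Lemma cintegral_conj mu f : cbm f ->
  cintegral mu (fun x => (f x)^*%C) = (cintegral mu f)^*%C.
Proof.
move=> [rf If]; apply: eqC => /=.
  by apply: eq_Rintegral => x _; case: (f x).
rewrite -mulN1r -RintegralZl//; last exact: (bmf_integrable mu measurableT).
by apply: eq_Rintegral => x _; case: (f x) => ? ?; rewrite mulN1r.
Qed.

Lemma Re_le_norm (z : R[i]) : (complex.Re z)%:C%C <= `|z|.
Proof. by apply: le_trans (normc_ge_Re z); rewrite lecR ler_norm. Qed.

(* Rotating [f] so that its integral becomes a nonnegative real reduces
   statements on [`|cintegral mu f|] to real ones. *)
Lemma cintegral_rotate mu f : cbm f -> exists u : R[i], `|u| = 1 /\
  `|cintegral mu f| = (\int[mu]_x complex.Re (u * f x))%:C%C.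
Proof.
move=> cf; pose z := cintegral mu f.
have key (u : R[i]) : u * z = `|z| -> `|z| = (\int[mu]_x complex.Re (u * f x))%:C%C.
  move=> uz; rewrite -[RHS]/((complex.Re (cintegral mu (fun x => u * f x)))%:C%C).
  by rewrite cintegralZ// -/z uz normc_def.
have [z0|z0] := eqVneq z 0.
  exists 1; split; first by rewrite normr1.
  by apply: key; rewrite z0 mulr0 normr0.
exists (`|z| / z); split; first by rewrite normrM normfV normr_id divff// normr_eq0.
by apply: key; rewrite divfK.
Qed.

Lemma cintegral_norm_le1 mu f : cbm f -> (forall x, `|f x| <= 1) ->
  `|cintegral mu f| <= 1.
Proof.
move=> cf f1; have [u [u1 ->]] := cintegral_rotate mu cf.
have [rf _] := cbmM (cbm_cst u) cf.
rewrite -[1]/(1%:C%C) lecR.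
have -> : 1 = \int[mu]_x (1 : R) by rewrite Rintegral_probability_cst.
apply: le_Rintegral => //; try apply: (bmf_integrable mu measurableT) => //; first exact: bmf_cst.
move=> x _; rewrite -lecR (le_trans (Re_le_norm _))//.
by rewrite normrM u1 mul1r.
Qed.

(** Equality case of the triangle inequality: after rotation, [Re (u * f x) <= 1] has mean 1, so it
    is 1 almost everywhere, and [|u * f x| <= 1] then kills the imaginary part. *)
Lemma cintegral_norm_eq1 mu f : cbm f -> (forall x, `|f x| <= 1) ->
  `|cintegral mu f| = 1 -> {ae mu, forall x, f x = cintegral mu f}.
Proof.
move=> cf f1 z1; have [u [u1 uE]] := cintegral_rotate mu cf.
have [rf If] := cbmM (cbm_cst u) cf.
have Ru1 x : complex.Re (u * f x) <= 1.
  by rewrite -lecR (le_trans (Re_le_norm _))// normrM u1 mul1r.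
have bg : bmf (fun x => 1 - complex.Re (u * f x)) by apply: bmfB => //; exact: bmf_cst.
have int0 : (\int[mu]_x `|(1 - complex.Re (u * f x))%:E| = 0)%E.
  have : \int[mu]_x (1 - complex.Re (u * f x)) = 0.
    rewrite RintegralB//; try apply: (bmf_integrable mu measurableT) => //; last exact: bmf_cst.
    rewrite Rintegral_probability_cst.
    by move: uE; rewrite z1 => -[<-]; rewrite subrr.
  rewrite /Rintegral => h.
  under eq_integral do rewrite gee0_abs ?lee_fin ?subr_ge0//.
  rewrite -[LHS]fineK ?h//.
  exact: (integrable_fin_num measurableT (bmf_integrable mu measurableT bg)).
have ufx : {ae mu, forall x, u * f x = 1}.
  have [/(_ int0) h _] := ae_eq_integral_abs mu measurableT
    (f := fun x => (1 - complex.Re (u * f x))%:E) (measurable_int _ (bmf_integrable mu measurableT bg)).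
  apply: filterS h => x /(_ I) /= [] /eqP; rewrite subr_eq0 => /eqP R1.
  have : `|u * f x| <= 1 by rewrite normrM u1 mul1r.
  rewrite normc_def (_ : 1 = (1 : R)%:C%C)// lecR -R1 expr1n => h1.
  apply: eqC; first by rewrite -R1.
  apply/eqP; rewrite -sqrf_eq0 eq_le sqr_ge0 andbT -(lerD2l 1) addr0.
  rewrite leNgt; apply/negP => h2; move: h1; rewrite leNgt => /negP; apply.
  by rewrite -[ltLHS](@sqrtr1 R) ltr_sqrt// (lt_trans ltr01).
have u0 : u != 0 by rewrite -normr_eq0 u1 oner_eq0.
have fE : {ae mu, forall x, f x = u^-1}.
  by apply: filterS ufx => x h; rewrite -[f x](mulKf u0) h mulr1.
suff -> : cintegral mu f = u^-1 by [].
have [[mrf _] [mIf _]] := cf.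
rewrite -(cintegral_cst mu u^-1); apply: eqC; rewrite /= /Rintegral; congr fine.
  apply: ae_eq_integral => //; first exact/measurable_EFinP.
  by apply: filterS fE => x -> _.
apply: ae_eq_integral => //; first exact/measurable_EFinP.
by apply: filterS fE => x -> _.
Qed.

Lemma ae_eq_cintegral mu f g : cbm f -> cbm g ->
  {ae mu, forall x, f x = g x} -> cintegral mu f = cintegral mu g.
Proof.
move=> [[rf _] [If _]] [[rg _] [Ig _]] fg; apply: eqC; rewrite /= /Rintegral; congr fine.
  apply: ae_eq_integral => //; try exact/measurable_EFinP.
  by apply: filterS fg => x -> _.
apply: ae_eq_integral => //; try exact/measurable_EFinP.
by apply: filterS fg => x -> _.
Qed.

Lemma eq_dist_cintegral mu nu f : eq_dist mu nu -> cintegral mu f = cintegral nu f.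
Proof.
move=> e; apply: eqC; rewrite /= /Rintegral; congr fine;
  by apply: eq_measure_integral => A mA _; exact: e.
Qed.

End complex_integral.

Lemma cbm_comp {d d'} {T : measurableType d} {U : measurableType d'} {R : realType}
    (f : U -> R[i]) (X : T -> U) :
  measurable_fun setT X -> cbm f -> cbm (fun x => f (X x)).
Proof. by move=> mX [rf If]; split; [exact: (bmf_comp mX rf)|exact: (bmf_comp mX If)]. Qed.

Lemma cintegral_distribution {d d'} {T : measurableType d} {U : measurableType d'}
    {R : realType} (P : probability T R) (X : {mfun T >-> U}) (f : U -> R[i]) :
  cbm f -> cintegral (distribution P X) f = cintegral P (fun x => f (X x)).
Proof.
move=> [rf If]; have mX : measurable_fun setT X by [].
apply: eqC; rewrite /= /Rintegral; congr fine; rewrite integral_distribution//.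
- by case: rf => ? _; exact/measurable_EFinP.
- by apply: (bmf_integrable P measurableT); exact: (bmf_comp mX rf).
- by case: If => ? _; exact/measurable_EFinP.
- by apply: (bmf_integrable P measurableT); exact: (bmf_comp mX If).
Qed.

Section product_integral.
Context {d1 d2} {T1 : measurableType d1} {T2 : measurableType d2} {R : realType}.
Variables (mu : probability T1 R) (nu : probability T2 R).
Variable pi : probability (T1 * T2)%type R.
Hypothesis piE : forall A B, measurable A -> measurable B ->
  pi (A `*` B) = (mu A * nu B)%E.

(** The measure [pi] is only assumed to factor on rectangles, so that the statement serves both the
    product measure behind a convolution and the joint law of independent variables. *)
Lemma Rintegral_prod (f : T1 -> R) (g : T2 -> R) : bmf f -> bmf g ->
  \int[pi]_x (f x.1 * g x.2) = \int[mu]_x f x * \int[nu]_x g x.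
Proof.
move=> hf hg; have [mf [M fM]] := hf; have [mg [N gN]] := hg.
have bfg : bmf (fun x : T1 * T2 => f x.1 * g x.2).
  by apply: bmfM; [exact: (bmf_comp measurable_fst hf)|exact: (bmf_comp measurable_snd hg)].
have intpi := bmf_integrable pi measurableT bfg.
rewrite /Rintegral.
have piE' : forall X, measurable X -> pi X = (mu \x nu)%E X.
  by move=> X mX; apply/esym/product_measure_unique.
have intmn : (mu \x nu)%E.-integrable setT (EFin \o (fun x : T1 * T2 => f x.1 * g x.2)).
  apply/integrableP; split; first exact: measurable_int intpi.
  have /integrableP[_] := intpi; rewrite (@eq_measure_integral _ _ _ _ (mu \x nu)%E)//.
  by move=> A mA _; exact: piE'.
rewrite (@eq_measure_integral _ _ _ _ (mu \x nu)%E); last by move=> A mA _; exact: piE'.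
rewrite -integral12_prod_meas1//= /fubini_F /=.
under eq_integral.
  move=> x _; under eq_integral do rewrite EFinM.
  rewrite integralZl//; last exact: (bmf_integrable nu measurableT hg).
  rewrite -[X in (_ * X)%E]fineK; last first.
    exact: (integrable_fin_num measurableT (bmf_integrable nu measurableT hg)).
  rewrite muleC; over.
rewrite integralZl//; last exact: (bmf_integrable mu measurableT hf).
rewrite fineM; [by rewrite [RHS]mulrC|by rewrite fin_numE|].
exact: (integrable_fin_num measurableT (bmf_integrable mu measurableT hf)).
Qed.

Lemma cintegral_prod (f : T1 -> R[i]) (g : T2 -> R[i]) : cbm f -> cbm g ->
  cintegral pi (fun x => f x.1 * g x.2) = cintegral mu f * cintegral nu g.
Proof.
move=> [rf If] [rg Ig].
have b (u : T1 -> R) (v : T2 -> R) : bmf u -> bmf v ->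
    pi.-integrable setT (EFin \o (fun x : T1 * T2 => u x.1 * v x.2)).
  move=> hu hv; apply: (bmf_integrable pi measurableT); apply: bmfM.
    exact: (bmf_comp measurable_fst hu).
  exact: (bmf_comp measurable_snd hv).
apply: eqC.
  rewrite ReM /= -!Rintegral_prod// -RintegralB//; [|exact: (b _ _ rf rg)|exact: (b _ _ If Ig)].
  by apply: eq_Rintegral => x _; rewrite ReM.
rewrite ImM /= -!Rintegral_prod// -RintegralD//; [|exact: (b _ _ rf Ig)|exact: (b _ _ If rg)].
by apply: eq_Rintegral => x _; rewrite ImM.
Qed.

End product_integral.

Lemma rectangle_unique {d1 d2} {T1 : measurableType d1} {T2 : measurableType d2}
    {R : realType} (m m' : probability (T1 * T2)%type R) :
  (forall A B, measurable A -> measurable B -> m (A `*` B) = m' (A `*` B)) ->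
  eq_dist m m'.
Proof.
move=> mm'; apply: (measure_unique
  [set A `*` B | A in @measurable _ T1 & B in @measurable _ T2] (fun=> setT)).
- by rewrite measurable_prod_measurableType.
- move=> _ _ [A mA [B mB <-]] [A' mA' [B' mB' <-]]; rewrite -setXI.
  by exists (A `&` A'); [exact: measurableI|exists (B `&` B') => //; exact: measurableI].
- by move=> _; exists setT => //; exists setT => //; rewrite setXTT.
- by apply/seteqP; split => // x _; exists 0%N.
- by move=> _ [A mA [B mB <-]]; exact: mm'.
- by move=> _; rewrite (@le_lt_trans _ _ 1%E) ?probability_le1// ltry.
Qed.

Definition mfun_of {d d'} {T : measurableType d} {U : measurableType d'} (f : T -> U)
    (mf : measurable_fun setT f) : {mfun T >-> U} :=
  HB.pack f (@isMeasurableFun.Build d d' T U f mf).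

Section discrete.
Context {R : realType} {V : finZmodType}.

Lemma measurable_fun_discr d (U : measurableType d) (f : discr V -> U) :
  measurable_fun setT f.
Proof. by move=> _ Y mY. Qed.

Lemma bmf_discr (f : discr V -> R) : bmf f.
Proof.
split; first exact: measurable_fun_discr.
by exists (\sum_v `|f v|) => v; rewrite (bigD1 v)//= lerDl sumr_ge0.
Qed.

Lemma cbm_discr (f : discr V -> R[i]) : cbm f.
Proof. by split; exact: bmf_discr. Qed.

End discrete.

(** * Characteristic functions *)

Section characters.
Context {R : realType} {G : finZmodType}.
Implicit Types (h k : char_group R G).

Lemma char_neq0 h g : h g != 0.
Proof. by rewrite -normr_eq0 char_norm1 oner_eq0. Qed.

Lemma char0 h : h 0 = 1.
Proof.
by apply: (@mulfI _ (h 0)); rewrite ?char_neq0// -char_add addr0 mulr1.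
Qed.

Lemma charN h g : h (- g) = (h g)^-1.
Proof.
by apply: (@mulfI _ (h g)); rewrite ?char_neq0// -char_add subrr char0 divff// char_neq0.
Qed.

Lemma charB h g g' : h (g - g') = h g / h g'.
Proof. by rewrite char_add charN. Qed.

Lemma norm1_conj (z : R[i]) : `|z| = 1 -> z^*%C = z^-1.
Proof.
move=> z1; have z0 : z != 0 by rewrite -normr_eq0 z1 oner_eq0.
by apply: (@mulfI _ z) => //; rewrite -sqr_normc z1 expr1n divff.
Qed.

Definition charM h k : char_group R G.
Proof.
refine (@CharGroup R G (fun g => h g * k g) _ _) => [g|g g'].
  by rewrite normrM !char_norm1 mulr1.
by rewrite !char_add mulrACA.
Defined.

Definition charV h : char_group R G.
Proof.
refine (@CharGroup R G (fun g => (h g)^-1) _ _) => [g|g g'].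
  by rewrite normfV char_norm1 invr1.
by rewrite char_add invfM.
Defined.

Definition char_comp h (e : G -> G) (eD : {morph e : x y / x + y}) : char_group R G.
Proof.
refine (@CharGroup R G (fun g => h (e g)) _ _) => [g|g g'].
  by rewrite char_norm1.
by rewrite eD char_add.
Defined.

End characters.

Section pairing.
Context {R : realType}.

Lemma cexpD (z w : R[i]) : cexp (z + w) = cexp z * cexp w.
Proof.
case: z w => [a b] [c d]; rewrite /cexp /=; apply: eqC; rewrite ?ReM ?ImM /=.
  by rewrite expRD cosD; ring.
by rewrite expRD sinD; ring.
Qed.

Lemma cexp0 : cexp 0 = 1 :> R[i].
Proof. by rewrite /cexp /= expR0 cos0 sin0 mulr1 mulr0. Qed.

Lemma cexp_im0 : cexp (0 +i* 0)%C = 1 :> R[i].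
Proof. exact: cexp0. Qed.

Lemma cexp_imD (x y : R) :
  cexp (0 +i* (x + y))%C = cexp (0 +i* x)%C * cexp (0 +i* y)%C.
Proof. by rewrite -cexpD; congr cexp; apply: eqC; rewrite //= addr0. Qed.

Lemma cexp_im_norm (x : R) : `|cexp (0 +i* x)%C| = 1.
Proof. by rewrite normc_def /cexp /= expR0 !mul1r cos2Dsin2 sqrtr1. Qed.

Lemma conj_cexp (z : R[i]) : (cexp z)^*%C = cexp z^*%C.
Proof. by case: z => a b; rewrite /cexp /= cosN sinN mulrN. Qed.

Definition sgZ2 (m n : 'Z_2) : R[i] := (-1) ^+ (m * n)%N.

Lemma sgZ2D m m' n : sgZ2 (m + m') n = sgZ2 m n * sgZ2 m' n.
Proof.
rewrite /sgZ2 -exprD -[LHS]signr_odd -[RHS]signr_odd; congr (_ ^+ _).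
by rewrite oddM /= oddD !oddM odd_mod// oddD; case: (odd m) (odd m') (odd n) => [] [] [].
Qed.

Lemma sgZ2_r0 m : sgZ2 m 0 = 1. Proof. by rewrite /sgZ2 muln0 expr0. Qed.

Lemma sgZ2_norm m n : `|sgZ2 m n| = 1.
Proof. by rewrite /sgZ2 normrX normrN1 expr1n. Qed.

Context {G : finZmodType}.
Implicit Types (h k : char_group R G) (x y : XG R G) (mu nu : probability (XG R G) R).

Lemma pairXE x s n h :
  pairX x s n h = cexp (0 +i* (x.1.1 * s))%C * sgZ2 x.1.2 n * h x.2.
Proof. by []. Qed.

Lemma pairXD x y s n h : pairX (x + y) s n h = pairX x s n h * pairX y s n h.
Proof. by rewrite !pairXE /= mulrDl cexp_imD sgZ2D char_add; ring. Qed.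

Lemma pairX_norm x s n h : `|pairX x s n h| = 1.
Proof. by rewrite pairXE !normrM cexp_im_norm sgZ2_norm char_norm1 !mulr1. Qed.

Lemma pairXM x s s' n h k :
  pairX x s n h * pairX x s' 0 k = pairX x (s + s') n (charM h k).
Proof. by rewrite !pairXE /= sgZ2_r0 mulrDr cexp_imD; ring. Qed.

Lemma pairXN x s h : pairX (- x) s 0 h = pairX x (- s) 0 (charV h).
Proof. by rewrite !pairXE /= !sgZ2_r0 charN mulNr mulrN. Qed.

Lemma pairX_aut (a : R) (alpha : {additive G -> G}) x s h
    (aD : {morph alpha : x y / x + y}) :
  pairX (autX a alpha x) s 0 h = pairX x (a * s) 0 (char_comp h aD).
Proof. by rewrite !pairXE /= !sgZ2_r0 mulrCA mulrA. Qed.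

Lemma cbm_cexp_im s : cbm (fun t : R => cexp (0 +i* (t * s))%C).
Proof.
rewrite /cexp /=; split => /=; under eq_fun do rewrite expR0 mul1r mulrC.
  by split; [exact: measurable_cosM|exists 1 => t; exact: cos_norm_le1].
by split; [exact: measurable_sinM|exists 1 => t; exact: sin_norm_le1].
Qed.

Lemma measurable_X11 : measurable_fun setT (fun x : XG R G => x.1.1).
Proof. by apply: (measurableT_comp measurable_fst); exact: measurable_fst. Qed.

Lemma measurable_X12 : measurable_fun setT (fun x : XG R G => x.1.2 : Z2).
Proof. by apply: (measurableT_comp measurable_snd); exact: measurable_fst. Qed.

Lemma measurable_X2 : measurable_fun setT (fun x : XG R G => x.2 : discr G).
Proof. exact: measurable_snd. Qed.

Lemma cbm_pairX s n h : cbm (fun x : XG R G => pairX x s n h).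
Proof.
apply: (cbmM (cbmM _ _) _).
- exact: (cbm_comp measurable_X11 (cbm_cexp_im s)).
- exact: (cbm_comp measurable_X12 (cbm_discr (fun m => sgZ2 m n))).
- exact: (cbm_comp measurable_X2 (cbm_discr h)).
Qed.

Lemma cbm_pairRZ2 s n : cbm (fun x : RZ2 R => pairRZ2 x s n).
Proof.
apply: cbmM.
- exact: (cbm_comp measurable_fst (cbm_cexp_im s)).
- exact: (cbm_comp measurable_snd (cbm_discr (fun m : Z2 => sgZ2 m n))).
Qed.

Lemma charfunX_ext mu s n h k : (forall g, h g = k g) ->
  charfunX mu s n h = charfunX mu s n k.
Proof. by move=> hk; apply: eq_cintegral => x; rewrite !pairXE hk. Qed.

Lemma charfunX_norm_le1 mu s n h : `|charfunX mu s n h| <= 1.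
Proof.
apply: cintegral_norm_le1; first exact: cbm_pairX.
by move=> x; rewrite pairX_norm.
Qed.

Lemma charfunX0 mu : charfunX mu 0 0 char1 = 1.
Proof.
rewrite -(cintegral_cst mu 1); apply: eq_cintegral => x.
by rewrite pairXE sgZ2_r0 mulr0 cexp_im0 !mulr1.
Qed.

Lemma charfunX_conj mu s n h :
  charfunX mu (- s) n (charV h) = (charfunX mu s n h)^*%C.
Proof.
rewrite -cintegral_conj; last exact: cbm_pairX.
apply: eq_cintegral => x; rewrite !pairXE /= !conjcM (norm1_conj (char_norm1 _ _)).
rewrite conj_cexp; congr (_ * _ * _); first by rewrite mulrN.
by rewrite /sgZ2 -signr_odd; case: odd; rewrite ?expr1 ?expr0; apply: eqC; rewrite //= !oppr0.
Qed.

Lemma charfunX_convol mu nu s n h :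
  charfunX (convol mu nu) s n h = charfunX mu s n h * charfunX nu s n h.
Proof.
rewrite /charfunX (@eq_dist_cintegral _ _ _ _ (distribution (mu \x^ nu)%E (@addX R G))); last first.
  by move=> E mE; exact: convolE.
rewrite cintegral_distribution; last exact: cbm_pairX.
rewrite -(@cintegral_prod _ _ _ _ _ mu nu (mu \x^ nu)%E) ?pairXD.
- by apply: eq_cintegral => p; rewrite pairXD.
- by move=> A B mA mB; rewrite /= product_measure2E.
- exact: cbm_pairX.
- exact: cbm_pairX.
Qed.

Lemma cintegral_dirac d (T : measurableType d) (x : T) (f : T -> R[i]) : cbm f ->
  cintegral (dirac x : probability T R) f = f x.
Proof.
move=> [[mr _] [mi _]].
apply: eqC; rewrite /= /Rintegral integral_dirac//; try exact/measurable_EFinP.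
  by rewrite diracT mul1e.
by rewrite diracT mul1e.
Qed.

Lemma charfunX_Edeg g s n h : charfunX (Edeg R g) s n h = h g.
Proof.
rewrite /charfunX cintegral_dirac; last exact: cbm_pairX.
by rewrite pairXE /= mul0r cexp_im0 /sgZ2 mul0n expr0 !mul1r.
Qed.

Lemma charfunX_embRZ2 (gamma : probability (RZ2 R) R) s n h :
  charfunX (embRZ2 G gamma) s n h = charfunRZ2 gamma s n.
Proof.
rewrite /charfunX cintegral_distribution; last exact: cbm_pairX.
by apply: eq_cintegral => x; rewrite /pairX /= char0 mulr1.
Qed.

Lemma charfunX_embZ2 (theta : probability Z2 R) s n h :
  charfunX (embZ2 G theta) s n h = cintegral theta (fun m => sgZ2 m n).
Proof.
rewrite /charfunX cintegral_distribution; last exact: cbm_pairX.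
apply: eq_cintegral => x.
by rewrite pairXE /= char0 mul0r cexp_im0 mulr1 mul1r.
Qed.

End pairing.

(** * Heyde's equation for the characteristic functions *)

Section heyde_equation.
Context {R : realType} {G : finZmodType}.
Variables (a : R) (alpha : {additive G -> G}).
Hypothesis aD : {morph alpha : x y / x + y}.
Context {d} {Omega : measurableType d} (P : probability Omega R).
Variables xi1 xi2 : {mfun Omega >-> XG R G}.
Hypothesis xi_indep : independent_RV P xi1 xi2.
Variables mu1 mu2 : probability (XG R G) R.
Hypothesis mu1E : eq_dist mu1 (distribution P xi1).
Hypothesis mu2E : eq_dist mu2 (distribution P xi2).
Let L1 w := xi1 w + xi2 w.
Let L2 w := xi1 w + autX a alpha (xi2 w).
Hypothesis L2_sym : cond_symmetric P L2 L1.

Let mxi1 : measurable_fun setT xi1. Proof. by []. Qed.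
Let mxi2 : measurable_fun setT xi2. Proof. by []. Qed.

Lemma measurable_autX : measurable_fun setT (autX a alpha : XG R G -> XG R G).
Proof.
apply: measurable_fun_pair; first apply: measurable_fun_pair.
- by apply: measurable_funM => //; exact: measurable_X11.
- exact: measurable_X12.
- exact: (measurableT_comp (@measurable_fun_discr G _ (discr G) alpha) measurable_X2).
Qed.

Lemma measurable_oppX : measurable_fun setT (fun x : XG R G => - x).
Proof.
apply: measurable_fun_pair; first apply: measurable_fun_pair.
- by apply: measurableT_comp => //; exact: measurable_X11.
- exact: (measurableT_comp (@measurable_fun_discr _ _ Z2 (fun m : Z2 => - m)) measurable_X12).
- exact: (measurableT_comp (@measurable_fun_discr G _ (discr G) (fun m => - m)) measurable_X2).
Qed.

Lemma measurable_addfX (f g : Omega -> XG R G) :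
  measurable_fun setT f -> measurable_fun setT g -> measurable_fun setT (fun w => f w + g w).
Proof.
by move=> mf mg; exact: (measurableT_comp (@measurable_addX R G) (measurable_fun_pair mf mg)).
Qed.

Let mL1 : measurable_fun setT L1. Proof. exact: measurable_addfX. Qed.
Let mL2 : measurable_fun setT L2.
Proof. by apply: measurable_addfX => //; exact: (measurableT_comp measurable_autX). Qed.
Let mNL2 : measurable_fun setT (fun w => - L2 w).
Proof. exact: (measurableT_comp measurable_oppX). Qed.

Lemma independent_cintegral (f g : XG R G -> R[i]) : cbm f -> cbm g ->
  cintegral mu1 f * cintegral mu2 g = cintegral P (fun w => f (xi1 w) * g (xi2 w)).
Proof.
move=> cf cg; pose W := mfun_of (measurable_fun_pair mxi1 mxi2).
rewrite -(@cintegral_prod _ _ _ _ _ mu1 mu2 (distribution P W))//.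
  rewrite cintegral_distribution//; apply: cbmM.
    exact: (cbm_comp measurable_fst cf).
  exact: (cbm_comp measurable_snd cg).
move=> A B mA mB; rewrite mu1E// mu2E//.
rewrite /distribution /pushforward /= -xi_indep//.
Qed.

(** A common conditional kernel makes the joint laws of [(L1, L2)] and [(L1, - L2)] agree on
    rectangles, hence everywhere. *)
Lemma symmetric_cintegral (f g : XG R G -> R[i]) : cbm f -> cbm g ->
  cintegral P (fun w => f (L1 w) * g (L2 w)) =
  cintegral P (fun w => f (L1 w) * g (- L2 w)).
Proof.
move=> cf cg; pose W := mfun_of (measurable_fun_pair mL1 mL2).
pose W' := mfun_of (measurable_fun_pair mL1 mNL2).
have cfg : cbm (fun x : XG R G * XG R G => f x.1 * g x.2).
  apply: cbmM; first exact: (cbm_comp measurable_fst cf).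
  exact: (cbm_comp measurable_snd cg).
have := @eq_dist_cintegral _ _ R (distribution P W) (distribution P W') (fun x => f x.1 * g x.2).
rewrite !cintegral_distribution//; apply; apply: rectangle_unique => A B mA mB.
have [k [k1 k2]] := L2_sym.
rewrite /distribution /pushforward /=.
transitivity (P (L1 @^-1` A `&` L2 @^-1` B)) => //.
by rewrite k1// -k2.
Qed.

(** Characters are evaluated at [(L1, L2)] and at [(L1, - L2)], then regrouped by [xi1] and [xi2].
    The character paired with [L2] is taken trivial on Z(2): there [L2] and [- L2] agree, and a
    nontrivial one would give no further information. *)
Lemma heyde_equation s s' n (h k : char_group R G) :
  charfunX mu1 (s + s') n (charM h k) *
  charfunX mu2 (s + a * s') n (charM h (char_comp k aD)) =
  charfunX mu1 (s - s') n (charM h (charV k)) *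
  charfunX mu2 (s - a * s') n (charM h (charV (char_comp k aD))).
Proof.
rewrite !independent_cintegral; try exact: cbm_pairX.
have := symmetric_cintegral (cbm_pairX s n h) (cbm_pairX s' 0 k).
rewrite (@eq_cintegral _ _ _ _ _ (fun w => pairX (xi1 w) (s + s') n (charM h k) *
  pairX (xi2 w) (s + a * s') n (charM h (char_comp k aD)))); last first.
  by move=> w; rewrite !pairXD -!pairXM (pairX_aut _ _ _ _ aD); ring.
move=> ->; apply: eq_cintegral => w.
rewrite pairXN !pairXD -!pairXM (pairX_aut _ _ _ _ aD) mulrN.
by rewrite mulrACA.
Qed.

End heyde_equation.

(** * Uniqueness and positivity on the real line *)

Section gauss_kernel.
Context {R : realType}.
Notation leb := (@lebesgue_measure R).

Definition gkernel (c u : R) := gauss c u / Num.sqrt (pi / c).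

Lemma gkernel_ge0 c u : 0 <= gkernel c u.
Proof. by rewrite divr_ge0 ?sqrtr_ge0// ltW// gauss_gt0. Qed.

Lemma gkernelN c u : gkernel c (- u) = gkernel c u.
Proof. by rewrite /gkernel /gauss sqrrN. Qed.

Lemma measurable_gkernel c y : measurable_fun setT (fun t : R => gkernel c (t - y)).
Proof.
apply: measurable_funM => //; apply: (measurableT_comp (@measurable_gauss R c)).
exact: measurable_funB.
Qed.

Lemma integral_gkernel c y : 0 < c -> (\int[leb]_t (gkernel c (t - y))%:E = 1)%E.
Proof.
move=> c0; have Z0 : 0 < Num.sqrt (pi / c) :> R by rewrite sqrtr_gt0 divr_gt0// pi_gt0.
rewrite /gkernel; under eq_integral do rewrite mulrC EFinM.
rewrite ge0_integralZl//.
- by rewrite integral_gauss_center// -EFinM mulVf// gt_eqF.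
- apply/measurable_EFinP; apply: (measurableT_comp (@measurable_gauss R c)).
  exact: measurable_funB.
- by move=> t _; rewrite lee_fin ltW// gauss_gt0.
Qed.

(** At distance [delta] or more, half of the exponent is at most the stated exponential and the
    other half integrates to a kernel with parameter [c / 2]; the factor [Num.sqrt 2] is the ratio
    of the two normalisations. *)
Lemma gkernel_tail (c y delta : R) (A : set R) : 0 < c -> 0 < delta -> measurable A ->
  (forall t, A t -> delta <= `|t - y|) ->
  (\int[leb]_t (\1_A t * gkernel c (t - y))%:E <=
    (Num.sqrt 2 * expR (- (c / 2 * delta ^+ 2)))%:E)%E.
Proof.
move=> c0 d0 mA hA; have c20 : 0 < c / 2 by rewrite divr_gt0.
have Z0 : 0 < Num.sqrt (pi / c) :> R by rewrite sqrtr_gt0 divr_gt0// pi_gt0.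
have E0 : 0 <= Num.sqrt 2 * expR (- (c / 2 * delta ^+ 2)) by rewrite mulr_ge0// expR_ge0.
have -> : ((Num.sqrt 2 * expR (- (c / 2 * delta ^+ 2)))%:E =
    \int[leb]_t (Num.sqrt 2 * expR (- (c / 2 * delta ^+ 2)) * gkernel (c / 2) (t - y))%:E)%E.
  under eq_integral do rewrite EFinM.
  rewrite ge0_integralZl// ?integral_gkernel ?mule1//.
  - by apply/measurable_EFinP; exact: measurable_gkernel.
  - by move=> t _; rewrite lee_fin gkernel_ge0.
apply: ge0_le_integral => //.
- by move=> t _; rewrite lee_fin mulr_ge0 ?gkernel_ge0.
- by apply/measurable_EFinP; apply: measurable_funM; [exact: measurable_indic|exact: measurable_gkernel].
- by apply/measurable_EFinP; apply: measurable_funM => //; exact: measurable_gkernel.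
- move=> t _; rewrite lee_fin indicE; have [/set_mem At|_] := boolP (t \in A); last first.
    by rewrite mul0r mulr_ge0// gkernel_ge0.
  rewrite mul1r /gkernel.
  have -> : Num.sqrt (pi / (c / 2)) = Num.sqrt 2 * Num.sqrt (pi / c) :> R.
    by rewrite -sqrtrM//; congr Num.sqrt; field; rewrite gt_eqF.
  have -> : Num.sqrt 2 * expR (- (c / 2 * delta ^+ 2)) *
      (gauss (c / 2) (t - y) / (Num.sqrt 2 * Num.sqrt (pi / c))) =
      (expR (- (c / 2 * delta ^+ 2)) * gauss (c / 2) (t - y)) / Num.sqrt (pi / c).
    by field; rewrite !gt_eqF//= sqrtr_gt0.
  rewrite ler_pM2r ?invr_gt0// /gauss -expRD ler_expR.
  have : delta ^+ 2 <= (t - y) ^+ 2.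
    by rewrite -(real_normK (num_real (t - y))) lerXn2r ?nnegrE ?(ltW d0)//; exact: hA.
  by nra.
Qed.

End gauss_kernel.

Section real_fourier_uniqueness.
Context {d} {T : measurableType d} {R : realType}.
Notation leb := (@lebesgue_measure R).
Variables (tau : T -> R) (D : set T).
Hypotheses (mtau : measurable_fun setT tau) (mD : measurable D).
Implicit Types mu nu : probability T R.

Lemma bmf_cos_tau (t0 s : R) : bmf (fun x => cos ((tau x - t0) * s)).
Proof.
split; last by exists 1 => x; exact: cos_norm_le1.
under eq_fun do rewrite mulrC.
apply: (measurableT_comp (measurable_cosM s)); exact: measurable_funB.
Qed.

(** Fubini and the transform of the Gaussian turn cosine transforms into Gaussian averages of [tau].
    A small [p], wide in frequency, gives a narrow average around [t0]. *)
Lemma gauss_parseval mu (w : T -> R) (p t0 : R) : 0 < p -> bmf w ->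
  \int[leb]_s (gauss p s * \int[mu]_x (w x * cos ((tau x - t0) * s))) =
  Num.sqrt (pi / p) * \int[mu]_x (w x * gauss (4 * p)^-1 (tau x - t0)).
Proof.
move=> p0 bw; have [mw [M wM]] := bw.
have mtau0 : measurable_fun setT (fun x => tau x - t0) by exact: measurable_funB.
have bg : bmf (fun x => gauss (4 * p)^-1 (tau x - t0)).
  split; first exact: (measurableT_comp (@measurable_gauss R _)).
  exists 1 => x; rewrite ger0_norm ?(ltW (gauss_gt0 _ _))// /gauss -[leRHS]expR0 ler_expR.
  by rewrite oppr_le0 mulr_ge0 ?sqr_ge0// invr_ge0 mulr_ge0// ltW.
pose F (z : T * R) := w z.1 * (gauss p z.2 * cos ((tau z.1 - t0) * z.2)).
have mF : measurable_fun setT F.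
  apply: measurable_funM; first exact: (measurableT_comp mw measurable_fst).
  apply: measurable_funM; first exact: (measurableT_comp (@measurable_gauss R p) measurable_snd).
  have mcos : measurable_fun setT (@cos R).
    by apply: continuous_measurable_fun; exact: continuous_cos.
  apply: (measurableT_comp mcos); apply: measurable_funM => //.
  exact: (measurableT_comp mtau0 measurable_fst).
have iG : (mu \x leb)%E.-integrable setT (EFin \o (fun z : T * R => M * gauss p z.2)).
  apply/integrable12ltyP.
    apply/measurable_EFinP; apply: measurable_funM => //.
    exact: (measurableT_comp (@measurable_gauss R p) measurable_snd).
  have inner : (\int[leb]_s `|(M * gauss p s)%:E| = (`|M| * Num.sqrt (pi / p))%:E)%E.
    under eq_integral do rewrite abse_EFin normrM (ger0_norm (ltW (gauss_gt0 _ _))) EFinM.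
    rewrite ge0_integralZl// ?integral_gauss//.
      by apply/measurable_EFinP; exact: measurable_gauss.
    by move=> s _; rewrite lee_fin ltW// gauss_gt0.
  by under eq_integral do rewrite /= inner; rewrite integral_probability_cst ltry.
have iF : (mu \x leb)%E.-integrable setT (EFin \o F).
  apply: (le_integrable measurableT _ _ iG); first exact/measurable_EFinP.
  move=> [x s] _; rewrite /F /= lee_fin !normrM (ger0_norm (ltW (gauss_gt0 _ _))).
  rewrite ler_pM ?mulr_ge0 ?(ltW (gauss_gt0 _ _))//.
    by rewrite (le_trans (wM x))// ler_norm.
  by rewrite ler_piMr ?cos_norm_le1// ltW// gauss_gt0.
have := Fubini iF; rewrite /fubini_F /fubini_G /= => h.
have inner s : \int[mu]_x F (x, s) = gauss p s * \int[mu]_x (w x * cos ((tau x - t0) * s)).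
  rewrite -RintegralZl//; last first.
    by apply: (bmf_integrable mu measurableT); apply: bmfM => //; exact: bmf_cos_tau.
  by apply: eq_Rintegral => x _; rewrite /F /= mulrCA.
have innerx x : \int[leb]_s F (x, s) = Num.sqrt (pi / p) * (w x * gauss (4 * p)^-1 (tau x - t0)).
  rewrite /F /= RintegralZl//; last exact: integrable_gauss_cos.
  rewrite integral_gauss_cos// mulrCA; congr (_ * (_ * _)).
  by rewrite /gauss mulrC.
rewrite -RintegralZl//; last by apply: (bmf_integrable mu measurableT); exact: bmfM.
transitivity (\int[leb]_s \int[mu]_x F (x, s)).
  by apply: eq_Rintegral => s _; rewrite inner.
transitivity (\int[mu]_x \int[leb]_s F (x, s)); last first.
  by apply: eq_Rintegral => x _; rewrite innerx.
have e1 x : (\int[leb]_s (F (x, s))%:E)%E = (\int[leb]_s F (x, s))%:E.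
  rewrite fineK//; apply: integrable_fin_num => //.
  exact: (integrableZl measurableT (w x) (integrable_gauss_cos (tau x - t0) p0)).
have e2 s : (\int[mu]_x (F (x, s))%:E)%E = (\int[mu]_x F (x, s))%:E.
  rewrite fineK//; apply: integrable_fin_num => //.
  exact: (bmf_integrable mu measurableT (bmfM bw (bmfM (bmf_cst (gauss p s)) (bmf_cos_tau t0 s)))).
rewrite /Rintegral; congr fine.
transitivity (\int[leb]_s \int[mu]_x (F (x, s))%:E)%E.
  by apply: eq_integral => s _; exact/esym/e2.
by rewrite -h; apply: eq_integral => x _; exact: e1.
Qed.

Definition tail_prob mu (b : R) := mu (D `&` [set x | b < tau x]).

Lemma measurable_tail (b : R) : measurable (D `&` [set x | b < tau x]).
Proof.
apply: measurableI => //.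
have -> : [set x | b < tau x] = setT `&` tau @^-1` `]b, +oo[.
  by rewrite setTI; apply/seteqP; split => x /=; rewrite in_itv /= andbT.
exact: mtau.
Qed.

Lemma bmf_indic (A : set T) : measurable A -> bmf (\1_A : T -> R).
Proof.
move=> mA; split; first exact: measurable_indic.
by exists 1 => x; rewrite indicE; case: (_ \in _); rewrite ?normr1 ?normr0.
Qed.

Section comparison.
Variables mu nu : probability T R.
Hypothesis cos_eq : forall t0 s,
  \int[mu]_x (\1_D x * cos ((tau x - t0) * s)) =
  \int[nu]_x (\1_D x * cos ((tau x - t0) * s)).

Lemma gauss_eq (c t0 : R) : 0 < c ->
  \int[mu]_x (\1_D x * gauss c (tau x - t0)) =
  \int[nu]_x (\1_D x * gauss c (tau x - t0)).
Proof.
move=> c0; have p0 : 0 < (4 * c)^-1 by rewrite invr_gt0 mulr_gt0.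
have pc : (4 * (4 * c)^-1)^-1 = c by field; rewrite gt_eqF.
apply: (@mulfI _ (Num.sqrt (pi / (4 * c)^-1))).
  by rewrite gt_eqF// sqrtr_gt0 divr_gt0// pi_gt0.
have := gauss_parseval mu t0 p0 (bmf_indic mD).
have := gauss_parseval nu t0 p0 (bmf_indic mD).
rewrite pc => <- <-; apply: eq_Rintegral => s _.
by rewrite cos_eq.
Qed.

(** Its integral over [t] is the indicator of the half-line, mollified by [gkernel c] and evaluated
    at [tau x], cut off outside [D]. *)
Let f b c (z : T * R) := (\1_D z.1 * (\1_(`]b, +oo[) z.2 * gkernel c (z.2 - tau z.1)))%:E.

Let f_ge0 b c z : (0 <= f b c z)%E.
Proof. by rewrite /f lee_fin mulr_ge0// mulr_ge0// gkernel_ge0. Qed.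

Let mf b c : measurable_fun setT (f b c).
Proof.
apply/measurable_EFinP; apply: measurable_funM.
  exact: (measurableT_comp (measurable_indic mD) measurable_fst).
apply: measurable_funM.
  have mI : measurable_fun setT (\1_(`]b, +oo[) : R -> R) by exact: measurable_indic.
  exact: (measurableT_comp mI measurable_snd).
apply: measurable_funM => //; apply: (measurableT_comp (@measurable_gauss R c)).
apply: measurable_funB; first exact: measurable_snd.
exact: (measurableT_comp mtau measurable_fst).
Qed.

Let smooth (m : probability T R) b c := (\int[m]_x \int[leb]_t f b c (x, t))%E.

(** After Tonelli, the inner integral at each [t] is a Gaussian average centred at [t], to which
    [gauss_eq] applies. *)
Let smooth_eq b c : 0 < c -> smooth mu b c = smooth nu b c.
Proof.
move=> c0.
rewrite /smooth (@fubini_tonelli _ _ _ _ _ mu leb (f b c) (mf b c) (f_ge0 b c)).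
rewrite (@fubini_tonelli _ _ _ _ _ nu leb (f b c) (mf b c) (f_ge0 b c)).
apply: eq_integral => t _.
have inner (m : probability T R) : (\int[m]_x f b c (x, t) =
    (\1_(`]b, +oo[) t / Num.sqrt (pi / c) * \int[m]_x (\1_D x * gauss c (tau x - t)))%:E)%E.
  have bg : bmf (fun x => \1_D x * gauss c (tau x - t)).
    apply: bmfM; first exact: bmf_indic.
    split; first by apply: (measurableT_comp (@measurable_gauss R _)); exact: measurable_funB.
    exists 1 => x; rewrite ger0_norm ?(ltW (gauss_gt0 _ _))// /gauss -[leRHS]expR0 ler_expR.
    by rewrite oppr_le0 mulr_ge0 ?sqr_ge0// ltW.
  have bg' := bmfM (bmf_cst (\1_(`]b, +oo[) t / Num.sqrt (pi / c))) bg.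
  rewrite -RintegralZl//; last exact: (bmf_integrable m measurableT).
  rewrite /Rintegral fineK; last first.
    exact: (integrable_fin_num measurableT (bmf_integrable m measurableT bg')).
  apply: eq_integral => x _; rewrite /f /=; congr EFin.
  by rewrite -gkernelN opprB /gkernel; ring.
by rewrite !inner gauss_eq.
Qed.

Let measurable_inner (b c : R) : measurable_fun setT (fun x => (\int[leb]_t f b c (x, t))%E).
Proof. exact: (@measurable_fun_fubini_tonelli_F _ _ _ _ _ leb (f b c) (mf b c) (f_ge0 b c)). Qed.

(** Off [D] the integral is 0. On [D] the kernel is centred at [tau x] and places mass at most [e]
    at distance [delta] or more, so the mollified value differs by at most [e] from 1 or from 0 once
    [tau x] is that far from [b]. *)
Let inner_bounds (b c delta : R) x : 0 < c -> 0 < delta ->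
  let e : R := Num.sqrt 2 * expR (- (c / 2 * delta ^+ 2)) in e <= 1 ->
  ((\1_(D `&` [set x | b + delta < tau x]) x * (1 - e))%:E <= \int[leb]_t f b c (x, t))%E /\
  (\int[leb]_t f b c (x, t) <= (\1_(D `&` [set x | b - delta < tau x]) x + e)%:E)%E.
Proof.
move=> c0 d0 e e1.
have e0 : 0 <= e by rewrite mulr_ge0// expR_ge0.
have int0 : (0 <= \int[leb]_t f b c (x, t))%E by apply: integral_ge0.
have [Dx|nDx] := pselect (D x); last first.
  have -> : (\int[leb]_t f b c (x, t) = 0)%E.
    by apply: integral0_eq => t _; rewrite /f /= indicE memNset// mul0r.
  rewrite !indicE !memNset; [|by case|by case].
  by rewrite mul0r add0r !lee_fin; split.
have fE : (\int[leb]_t f b c (x, t) =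
    \int[leb]_t (\1_(`]b, +oo[) t * gkernel c (t - tau x))%:E)%E.
  by apply: eq_integral => t _; rewrite /f /= indicE mem_set// mul1r.
have mi (A : set R) : measurable A ->
    measurable_fun setT (fun t : R => (\1_A t * gkernel c (t - tau x))%:E).
  by move=> mA; apply/measurable_EFinP; apply: measurable_funM;
    [exact: measurable_indic|exact: measurable_gkernel].
have split1 : (\int[leb]_t (\1_(`]b, +oo[) t * gkernel c (t - tau x))%:E +
    \int[leb]_t (\1_(`]-oo, b]) t * gkernel c (t - tau x))%:E = 1)%E.
  rewrite -(integral_gkernel (tau x) c0) -ge0_integralD//.
  - apply: eq_integral => t _; rewrite -EFinD -mulrDl.
    rewrite (_ : \1_(`]b, +oo[) t + \1_(`]-oo, b]) t = 1) ?mul1r// !indicE.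
    have [bt|tb] := ltP b t.
      rewrite mem_set/= ?in_itv/= ?bt// memNset ?addr0//= in_itv/=.
      by rewrite leNgt bt.
    rewrite memNset/= ?mem_set ?add0r//= in_itv/= ?andbT//.
    by rewrite ltNge tb.
  - by move=> t _; rewrite lee_fin mulr_ge0 ?gkernel_ge0.
  - exact: mi.
  - by move=> t _; rewrite lee_fin mulr_ge0 ?gkernel_ge0.
  - exact: mi.
have ge0 (A : set R) : (0 <= \int[leb]_t (\1_A t * gkernel c (t - tau x))%:E)%E.
  by apply: integral_ge0 => t _; rewrite lee_fin mulr_ge0 ?gkernel_ge0.
split.
- have [h|h] := ltP (b + delta) (tau x); last first.
    rewrite indicE memNset; first by rewrite mul0r.
    by move=> [_ /=]; rewrite ltNge h.
  rewrite indicE mem_set//= mul1r fE EFinB -split1.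
  have tl : (\int[leb]_t (\1_(`]-oo, b]) t * gkernel c (t - tau x))%:E <= e%:E)%E.
    apply: gkernel_tail => // t /=; rewrite in_itv/= => tb.
    by rewrite ler_normr; apply/orP; right; lra.
  rewrite leeBlDr//; exact: leeD2l.
- rewrite fE; have [h|h] := ltP (b - delta) (tau x).
    rewrite indicE mem_set//= EFinD -[X in (X <= _)%E]adde0 leeD ?lee_fin//.
    by rewrite -split1 leeDl.
  rewrite indicE memNset ?add0r; last by move=> [_ /=]; rewrite ltNge h.
  apply: gkernel_tail => // t /=; rewrite in_itv/= andbT => tb.
  by rewrite ler_normr; apply/orP; left; lra.
Qed.

(* The indicator of the half-line ]b, +oo[, mollified by a narrow enough Gaussian, lies up to
   a small error between the indicators of the two half-lines shifted by [delta]. *)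
Lemma tail_prob_compare (b delta : R) : 0 < delta ->
  (tail_prob mu (b + delta)%R <= tail_prob nu (b - delta)%R)%E.
Proof.
move=> d0.
have fn (m : probability T R) A : measurable A -> m A = (fine (m A))%:E.
  by move=> mA; rewrite fineK// fin_num_measure.
have int_ind (m : probability T R) A : measurable A -> m A = (\int[m]_x (\1_A x)%:E)%E.
  by move=> mA; rewrite integral_indic// setIT.
rewrite /tail_prob fn ?[X in (_ <= X)%E]fn; [|exact: measurable_tail|exact: measurable_tail].
rewrite lee_fin; apply/ler_addgt0Pr => eta eta0.
(* The choice of [c] makes [c / 2 * delta ^+ 2 = 2 / y], and [expR (- (2 / y)) <= y / 2] gives
   [e <= y]. The two errors [e] then add up to at most [eta]. *)
pose y := Num.min 1 (eta / 2).
have y0 : 0 < y by rewrite lt_min ltr01 divr_gt0.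
have y1 : y <= 1 by rewrite ge_min lexx.
have y2 : y <= eta / 2 by rewrite ge_min lexx orbT.
pose c := 4 / (y * delta ^+ 2).
have c0 : 0 < c by rewrite divr_gt0// mulr_gt0// exprn_gt0.
pose e : R := Num.sqrt 2 * expR (- (c / 2 * delta ^+ 2)).
have e0 : 0 <= e by rewrite mulr_ge0// expR_ge0.
have ey : e <= y.
  rewrite /e (_ : c / 2 * delta ^+ 2 = 2 / y); last first.
    by rewrite /c; field; rewrite !gt_eqF.
  have h1 : expR (- (2 / y)) <= y / 2.
    rewrite expRN -[leRHS]invrK lef_pV2 ?posrE ?expR_gt0 ?invr_gt0 ?divr_gt0//.
    by rewrite invf_div (le_trans _ (expR_ge1Dx _))// lerDr.
  have h2 : Num.sqrt 2 <= 2 :> R.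
    by rewrite -[leRHS]ger0_norm// -sqrtr_sqr ler_sqrt// expr2; lra.
  apply: (@le_trans _ _ (2 * (y / 2))); last by lra.
  by rewrite ler_pM// expR_ge0.
have e1 : e <= 1 by exact: le_trans ey y1.
have lower : (((1 - e)%R * fine (mu (D `&` [set x | b + delta < tau x])))%:E <= smooth mu b c)%E.
  rewrite EFinM -fn; last exact: measurable_tail.
  rewrite (int_ind mu _ (measurable_tail (b + delta))).
  rewrite -ge0_integralZl//; last 2 first.
    by apply/measurable_EFinP; apply: measurable_indic; exact: measurable_tail.
    by rewrite lee_fin subr_ge0.
  apply: ge0_le_integral => //.
  - by move=> x _; rewrite -EFinM lee_fin mulr_ge0// subr_ge0.
  - apply: measurable_funeM; apply/measurable_EFinP.
    by apply: measurable_indic; exact: measurable_tail.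
  - move=> x _; rewrite -EFinM mulrC.
    by have [] := inner_bounds b x c0 d0 e1.
have upper : (smooth nu b c <= (fine (nu (D `&` [set x | b - delta < tau x])) + e)%:E)%E.
  rewrite EFinD -fn; last exact: measurable_tail.
  rewrite (int_ind nu _ (measurable_tail (b - delta))).
  rewrite -(integral_probability_cst nu e) -ge0_integralD//; last first.
    by apply/measurable_EFinP; apply: measurable_indic; exact: measurable_tail.
  apply: ge0_le_integral => //.
  - by move=> x _; exact: integral_ge0.
  - apply: emeasurable_funD => //; apply/measurable_EFinP.
    by apply: measurable_indic; exact: measurable_tail.
  - move=> x _; rewrite -EFinD.
    by have [] := inner_bounds b x c0 d0 e1.
rewrite -(smooth_eq b c0) in upper.
have := le_trans lower upper; rewrite lee_fin.
have : 0 <= fine (mu (D `&` [set x | b + delta < tau x])) <= 1.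
  by rewrite fine_ge0// -lee_fin -fn ?probability_le1//; exact: measurable_tail.
by move=> /andP[p0 p1]; nra.
Qed.

Lemma tail_prob_le (b : R) : (tail_prob mu b <= tail_prob nu b)%E.
Proof.
pose F n := D `&` [set x | b + n.+1%:R^-1 < tau x].
have cvgF : mu \o F @ \oo --> tail_prob mu b.
  have -> : tail_prob mu b = mu (\bigcup_n F n).
    rewrite /tail_prob; congr (mu _); apply/seteqP; split => [x [Dx /= bx]|x [n _ [Dx /= bx]]].
      have bx0 : 0 < tau x - b by rewrite subr_gt0.
      exists (Num.truncn (tau x - b)^-1) => //; split => //=.
      rewrite -ltrBrDl invf_plt ?posrE//; exact: truncnS_gt.
    by split => //=; rewrite (lt_trans _ bx)// ltrDl invr_gt0.
  apply: nondecreasing_cvg_mu.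
  - by move=> n; exact: measurable_tail.
  - by apply: bigcup_measurable => n _; exact: measurable_tail.
  - move=> n m nm; apply/subsetPset => x [Dx /= h]; split => //=.
    by rewrite (le_lt_trans _ h)// lerD2l lef_pV2 ?posrE// ler_nat ltnS.
rewrite -(cvg_lim _ cvgF)//; apply: lime_le; first by apply/cvg_ex; eexists; exact: cvgF.
apply: nearW => n /=.
(* Comparing around the midpoint of [b] and [b + n.+1%:R^-1] brings the lower threshold exactly to
   [b]. *)
have n0 : 0 < n.+1%:R^-1 / 2 :> R by rewrite divr_gt0 ?invr_gt0.
have := tail_prob_compare (b + n.+1%:R^-1 / 2) n0.
by rewrite addrK -addrA -splitr.
Qed.

End comparison.

Definition slice_transform mu (s : R) : R[i] :=
  cintegral mu (fun x => (\1_D x : R)%:C%C * cexp (0 +i* (tau x * s))%C).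

Lemma cbm_slice (s : R) :
  cbm (fun x => (\1_D x : R)%:C%C * cexp (0 +i* (tau x * s))%C).
Proof.
apply: cbmM; last exact: (cbm_comp mtau (cbm_cexp_im s)).
by split; [exact: bmf_indic|exact: bmf_cst].
Qed.

Lemma cos_transform mu (t0 s : R) :
  \int[mu]_x (\1_D x * cos ((tau x - t0) * s)) =
  cos (t0 * s) * complex.Re (slice_transform mu s) +
  sin (t0 * s) * complex.Im (slice_transform mu s).
Proof.
have [rb ib] := cbm_slice s.
rewrite /slice_transform /= -!RintegralZl//; last 2 first.
  exact: (bmf_integrable mu measurableT ib).
  exact: (bmf_integrable mu measurableT rb).
rewrite -RintegralD//; last 2 first.
  exact: (bmf_integrable mu measurableT (bmfM (bmf_cst _) rb)).
  exact: (bmf_integrable mu measurableT (bmfM (bmf_cst _) ib)).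
apply: eq_Rintegral => x _.
by rewrite /= expR0 mulrBl cosB; ring.
Qed.

(** Equal transforms give equal cosine transforms around every centre, hence equal tails in both
    directions of [tail_prob_le]; open half-lines generate the Borel sets. *)
Lemma real_fourier_unique mu nu :
  (forall s, slice_transform mu s = slice_transform nu s) ->
  forall A : set R, measurable A -> mu (D `&` tau @^-1` A) = nu (D `&` tau @^-1` A).
Proof.
move=> mn A mA.
have cos_eq t0 s : \int[mu]_x (\1_D x * cos ((tau x - t0) * s)) =
  \int[nu]_x (\1_D x * cos ((tau x - t0) * s)) by rewrite !cos_transform mn.
have teq b : tail_prob mu b = tail_prob nu b.
  apply/eqP; rewrite eq_le; apply/andP; split; first exact: tail_prob_le.
  by apply: tail_prob_le => t0 s; rewrite cos_eq.
have push (m : probability T R) : exists m' : {measure set R -> \bar R},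
    forall B, m' B = m (D `&` tau @^-1` B).
  unshelve eexists (pushforward (mrestr m mD) tau : {measure set R -> \bar R}) => //.
  by move=> B; rewrite /= /pushforward /mrestr setIC.
have [mu' mu'E] := push mu; have [nu' nu'E] := push nu.
rewrite -mu'E -nu'E.
apply: (measure_unique (@RGenOInfty.G R) (fun n => `]- n%:R, +oo[%classic)) => //.
- exact: RGenOInfty.measurableE.
- move=> _ _ [x ->] [y ->]; exists (Num.max x y).
  by apply/seteqP; split => z /=; rewrite !in_itv/= !andbT gt_max; [move=> [-> ->]|move=> /andP].
- by move=> n; exists (- n%:R).
- apply/seteqP; split => // x _; exists (Num.truncn `|x|).+1 => //=.
  rewrite in_itv/= andbT ltrNl (le_lt_trans _ (truncnS_gt _))//.
  by rewrite -normrN ler_norm.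
- move=> _ [x ->]; rewrite mu'E nu'E.
  have -> : D `&` tau @^-1` `]x, +oo[ = D `&` [set y | x < tau y].
    by congr (_ `&` _); apply/seteqP; split => y /=; rewrite in_itv/= andbT.
  exact: teq.
- move=> n; rewrite mu'E (le_lt_trans (probability_le1 _ _))// ?ltry//.
  by apply: measurableI => //; rewrite -[X in measurable X]setTI; exact: mtau.
Qed.

End real_fourier_uniqueness.

(** * Positivity against Gaussians and the inequality of the class Theta *)

Section gauss_domination.
Context {d} {T : measurableType d} {R : realType}.

(** The integral over [s] of [gauss p s] times the real part of the exponential with parameters
    [sigma], [m], after its phase is turned by [- t s]. *)
Definition gauss_peak (p sigma m t : R) :=
  Num.sqrt (pi / (p + sigma)) * expR (- ((m - t) ^+ 2 / (4 * (p + sigma)))).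

(** Computed on the frequency side, the expression is a sum of two peaks; by [gauss_parseval] it is
    also a multiple of the average of a positive Gaussian over [D]. *)
Lemma gauss_transform_positivity (mu : probability T R) (tau : T -> R) (D : set T)
    (A B sigma sigma' m m' : R) :
  measurable_fun setT tau -> measurable D -> 0 <= sigma -> 0 <= sigma' ->
  (forall s, slice_transform tau D mu s =
     A%:C%C * cexp ((- (sigma * s ^+ 2)) +i* (m * s))%C +
     B%:C%C * cexp ((- (sigma' * s ^+ 2)) +i* (m' * s))%C) ->
  forall p t, 0 < p ->
  0 <= A * gauss_peak p sigma m t + B * gauss_peak p sigma' m' t.
Proof.
move=> mtau mD s0 s0' ZE p t p0.
have ps : 0 < p + sigma by rewrite ltr_pwDl.
have ps' : 0 < p + sigma' by rewrite ltr_pwDl.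
have ci (a c : R) k : 0 < a -> (@lebesgue_measure R).-integrable setT
   (EFin \o (fun s => k * (gauss a s * cos (c * s)))).
  by move=> a0; exact: (integrableZl measurableT k (integrable_gauss_cos c a0)).
have -> : A * gauss_peak p sigma m t + B * gauss_peak p sigma' m' t =
  \int[lebesgue_measure]_s (gauss p s * \int[mu]_x (\1_D x * cos ((tau x - t) * s))).
  rewrite /gauss_peak -!integral_gauss_cos// -!RintegralZl//; last 2 first.
    exact: integrable_gauss_cos.
    exact: integrable_gauss_cos.
  rewrite -RintegralD//; [|exact: ci|exact: ci].
  apply: eq_Rintegral => s _; rewrite (cos_transform mtau mD) ZE /cexp.
  have -> : gauss (p + sigma) s = gauss p s * expR (- (sigma * s ^+ 2)).
    by rewrite /gauss -expRD; congr expR; ring.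
  have -> : gauss (p + sigma') s = gauss p s * expR (- (sigma' * s ^+ 2)).
    by rewrite /gauss -expRD; congr expR; ring.
  by rewrite !mulrBl !cosB /= !mul0r !subr0 !addr0; ring.
rewrite (gauss_parseval mtau)//; last exact: bmf_indic.
rewrite mulr_ge0// Rintegral_ge0// => x _; rewrite mulr_ge0// ltW//.
exact: gauss_gt0.
Qed.

Lemma quadratic_ub (al be ga C : R) : (forall t, al * t ^+ 2 + be * t + ga <= C) ->
  al <= 0 /\ (al = 0 -> be = 0).
Proof.
move=> h.
have al0 : al <= 0.
  rewrite leNgt; apply/negP => al0.
  have C0 : 0 <= C - ga by have := h 0; rewrite expr0n !mulr0 !add0r; lra.
  (* Averaging the bounds at [t] and [- t] removes the linear term, and this [t] is large enough for
     [al * t ^+ 2] to exceed [C - ga]. *)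
  pose t := (C - ga + 1) / al + 1.
  have t1 : 1 <= t by rewrite lerDr divr_ge0// ?(ltW al0)//; lra.
  have h1 := h t; have h2 := h (- t).
  have h3 : al * t ^+ 2 + ga <= C by move: h1 h2; rewrite sqrrN mulrN; lra.
  have h4 : al * t = C - ga + 1 + al by rewrite /t mulrDr mulr1 mulrC divfK// gt_eqF.
  have : al * t <= al * t ^+ 2 by rewrite ler_pM2l// expr2 ler_peMl//; lra.
  by lra.
split => // al0'; apply/eqP; rewrite -[_ == _]negbK; apply/negP => be0.
have := h ((C - ga + 1) / be); rewrite al0' mul0r add0r [be * _]mulrC divfK//.
by lra.
Qed.

(** The quotient of the peaks is the exponential of a quadratic [q p] in [t], bounded above by the
    domination. A nonpositive leading coefficient means [sigma' <= sigma]; in the case of equality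
    the linear coefficient vanishes, so [m = m']. Otherwise the maximum of [q p] does not depend on
    [p], and letting [p] tend to 0 gives the sharp constant and excludes [sigma' = 0]. *)
Lemma gauss_peak_domination (A B sigma sigma' m m' : R) :
  0 <= sigma -> 0 <= sigma' -> 0 < B ->
  (forall p t, 0 < p -> B * gauss_peak p sigma' m' t <= A * gauss_peak p sigma m t) ->
  [/\ 0 < sigma', sigma' < sigma
    & B <= A * (Num.sqrt (sigma' / sigma) * expR (- ((m - m') ^+ 2 / (4 * (sigma - sigma')))))]
  \/ [/\ sigma = sigma', m = m' & B <= A].
Proof.
move=> s0 s0' B0 dom.
have gp0 p s1 m1 t : 0 < p -> 0 <= s1 -> 0 < gauss_peak p s1 m1 t.
  by move=> p0 s10; rewrite mulr_gt0 ?expR_gt0// sqrtr_gt0 divr_gt0 ?pi_gt0// ltr_pwDl.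
have A0 : 0 < A.
  have := dom 1 0 ltr01; rewrite -(pmulr_lgt0 _ (gp0 1 sigma m 0 ltr01 s0)) => h.
  by apply: lt_le_trans h; rewrite mulr_gt0// gp0.
pose q p t := (m - t) ^+ 2 / (4 * (p + sigma)) - (m' - t) ^+ 2 / (4 * (p + sigma')).
have domq p t : 0 < p -> B * expR (q p t) <= A * Num.sqrt ((p + sigma') / (p + sigma)).
  move=> p0.
  have ps : 0 < p + sigma by rewrite ltr_pwDl.
  have ps' : 0 < p + sigma' by rewrite ltr_pwDl.
  have := dom p t p0; rewrite /gauss_peak.
  have -> : pi / (p + sigma) = pi / (p + sigma') * ((p + sigma') / (p + sigma)).
    by field; rewrite !gt_eqF.
  rewrite [Num.sqrt (_ * (_ / _))]sqrtrM; last by rewrite divr_ge0 ?pi_ge0// ltW.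
  have S0 : 0 < Num.sqrt (pi / (p + sigma')) by rewrite sqrtr_gt0 divr_gt0// pi_gt0.
  set S := Num.sqrt (pi / (p + sigma')) in S0 *; set Q := Num.sqrt (_ / _).
  set E' := expR _; set E := expR (- ((m - t) ^+ 2 / _)).
  have -> : expR (q p t) = E' / E.
    by rewrite /E' /E -expRN -expRD; congr expR; rewrite /q; ring.
  have E0 : 0 < E by exact: expR_gt0.
  rewrite mulrA ler_pdivrMr// => h.
  by rewrite -(ler_pM2l S0); apply: le_trans (le_trans _ h) _;
    rewrite le_eqVlt; apply/orP; left; apply/eqP; ring.
have q_quad p : 0 < p -> let al := (4 * (p + sigma))^-1 - (4 * (p + sigma'))^-1 in
    al <= 0 /\ (al = 0 -> - 2 * m / (4 * (p + sigma)) + 2 * m' / (4 * (p + sigma')) = 0).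
  move=> p0 al.
  apply: (@quadratic_ub al _ (m ^+ 2 / (4 * (p + sigma)) - m' ^+ 2 / (4 * (p + sigma')))
    (A * Num.sqrt ((p + sigma') / (p + sigma)) / B)) => t.
  have -> : al * t ^+ 2 + (- 2 * m / (4 * (p + sigma)) + 2 * m' / (4 * (p + sigma'))) * t +
    (m ^+ 2 / (4 * (p + sigma)) - m' ^+ 2 / (4 * (p + sigma'))) = q p t.
    by rewrite /al /q; ring.
  rewrite ler_pdivlMr// mulrC; apply: le_trans (domq p t p0).
  by rewrite ler_pM2l// (le_trans _ (expR_ge1Dx _))// lerDr.
have [al1 be1] := q_quad 1 ltr01.
have ps : 0 < 1 + sigma by rewrite ltr_pwDl.
have ps' : 0 < 1 + sigma' by rewrite ltr_pwDl.
have ss : sigma' <= sigma.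
  move: al1; rewrite subr_le0 lef_pV2 ?posrE ?mulr_gt0// ler_pM2l//.
  by rewrite lerD2l.
have [sE|sN] := eqVneq sigma sigma'.
  right; have mm : m = m'.
    have := be1; rewrite sE subrr => /(_ erefl) h.
    have : (2 * m' - 2 * m) / (4 * (1 + sigma')) = 0 by rewrite -h; ring.
    move/eqP; rewrite mulf_eq0 invr_eq0 mulf_eq0 pnatr_eq0 /= (gt_eqF ps') orbF.
    by rewrite subr_eq0 => /eqP; lra.
  split => //; have := dom 1 0 ltr01; rewrite sE mm ler_pM2r//.
  exact: gp0.
left; have {ss sN}ss : sigma' < sigma by rewrite lt_neqAle eq_sym sN.
pose X := expR ((m - m') ^+ 2 / (4 * (sigma - sigma'))).
have d0 : 0 < sigma - sigma' by rewrite subr_gt0.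
have domX p : 0 < p -> (B * X) ^+ 2 * (p + sigma) <= A ^+ 2 * (p + sigma').
  move=> p0.
  have pps : 0 < p + sigma by rewrite ltr_pwDl.
  have pps' : 0 < p + sigma' by rewrite ltr_pwDl.
  (* the vertex of the parabola [q p] *)
  have := domq p (((p + sigma) * m' - (p + sigma') * m) / (sigma - sigma')) p0.
  have -> : q p (((p + sigma) * m' - (p + sigma') * m) / (sigma - sigma')) =
      (m - m') ^+ 2 / (4 * (sigma - sigma')).
    by rewrite /q; field; rewrite !gt_eqF.
  rewrite -/X => h.
  have : (B * X) ^+ 2 <= (A * Num.sqrt ((p + sigma') / (p + sigma))) ^+ 2.
    by rewrite lerXn2r// ?nnegrE mulr_ge0 ?sqrtr_ge0 ?expR_ge0// ltW.
  rewrite [X in _ <= X]exprMn sqr_sqrtr; last by rewrite divr_ge0// ltW.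
  by rewrite mulrA ler_pdivlMr.
have lim : (B * X) ^+ 2 * sigma <= A ^+ 2 * sigma'.
  rewrite leNgt; apply/negP => h.
  have A20 : 0 < A ^+ 2 by rewrite exprn_gt0.
  pose e := (B * X) ^+ 2 * sigma - A ^+ 2 * sigma'.
  have e0 : 0 < e by rewrite subr_gt0.
  (* This [p] makes [A ^+ 2 * p] equal to half of the assumed excess [e], contradicting [domX]. *)
  have p0 : 0 < e / (2 * A ^+ 2) by rewrite divr_gt0// mulr_gt0.
  have := domX _ p0.
  have -> : A ^+ 2 * (e / (2 * A ^+ 2) + sigma') = e / 2 + A ^+ 2 * sigma'.
    by field; rewrite gt_eqF.
  have : 0 <= (B * X) ^+ 2 * (e / (2 * A ^+ 2)) by rewrite mulr_ge0 ?sqr_ge0// ltW.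
  by rewrite mulrDr; move: e0; rewrite /e; lra.
have sg0 : 0 < sigma by rewrite (le_lt_trans s0').
have X0 : 0 < X by exact: expR_gt0.
have sg0' : 0 < sigma'.
  have := lt_le_trans _ lim; rewrite -(pmulr_rgt0 _ (exprn_gt0 2 A0)); apply.
  by rewrite mulr_gt0// exprn_gt0// mulr_gt0.
split => //.
have h : (B * X) ^+ 2 <= (A * Num.sqrt (sigma' / sigma)) ^+ 2.
  rewrite [X in _ <= X]exprMn sqr_sqrtr; last by rewrite divr_ge0// ltW.
  by rewrite mulrA ler_pdivlMr.
rewrite expRN -/X mulrA ler_pdivlMr//.
rewrite -(@ler_pXn2r _ 2)// ?nnegrE mulr_ge0 ?sqrtr_ge0// ltW//.
Qed.

End gauss_domination.

(** * Slices over the finite part *)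

Section slices.
Context {R : realType} {G : finZmodType}.
Implicit Types (mu nu : probability (XG R G) R) (h : char_group R G).

Lemma sum_Z2 (V : nmodType) (F : 'Z_2 -> V) : \sum_m F m = F 0 + F 1.
Proof.
rewrite big_ord_recl big_ord1; congr (F _ + F _); exact: val_inj.
Qed.

Lemma sgZ2_0l n : sgZ2 0 n = 1 :> R[i]. Proof. by rewrite /sgZ2 mul0n expr0. Qed.

Lemma sgZ2_11 : sgZ2 1 1 = -1 :> R[i]. Proof. by rewrite /sgZ2 expr1. Qed.

Lemma Z2_cases (m : 'Z_2) : m = 0 \/ m = 1.
Proof. by case: m => [[|[|?]] ?]//; [left|right]; exact: val_inj. Qed.

Definition xslice (m : 'Z_2) (g : G) : set (XG R G) := [set x | x.1.2 = m /\ x.2 = g].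

Lemma measurable_xslice m g : measurable (xslice m g).
Proof.
have -> : xslice m g = (fun x : XG R G => x.1.2 : Z2) @^-1` [set m] `&`
  (fun x : XG R G => x.2 : discr G) @^-1` [set g] by [].
apply: measurableI; rewrite -[X in measurable X]setTI.
  exact: measurable_X12.
exact: measurable_X2.
Qed.

Definition xtransform mu m g (s : R) : R[i] :=
  slice_transform (fun x : XG R G => x.1.1) (xslice m g) mu s.

Definition Z2transform mu (n : 'Z_2) (g : G) (s : R) : R[i] :=
  \sum_(m : 'Z_2) sgZ2 m n * xtransform mu m g s.

Lemma charfunX_slices mu s n h :
  charfunX mu s n h = \sum_g Z2transform mu n g s * h g.
Proof.
pose F g (m : 'Z_2) (x : XG R G) : R[i] :=
  (h g * sgZ2 m n) * ((\1_(xslice m g) x : R)%:C%C * cexp (0 +i* (x.1.1 * s))%C).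
have cF g m : cbm (F g m).
  by apply: cbmM; [exact: cbm_cst|apply: cbm_slice; [exact: measurable_X11|exact: measurable_xslice]].
have -> : charfunX mu s n h = cintegral mu (fun x => \sum_g \sum_m F g m x).
  apply: eq_cintegral => x.
  rewrite (bigD1 x.2)//= [X in _ + X]big1 ?addr0; last first.
    move=> g gx; rewrite big1// => m _; rewrite /F indicE memNset ?mul0r ?mulr0//.
    by move=> [_ /= xg]; rewrite xg eqxx in gx.
  rewrite (bigD1 x.1.2)//= [X in _ + X]big1 ?addr0; last first.
    move=> m mx; rewrite /F indicE memNset ?mul0r ?mulr0//.
    by move=> [/= xm _]; rewrite xm eqxx in mx.
  by rewrite /F indicE mem_set// pairXE mul1r; ring.
rewrite cintegral_sum; last by move=> g; apply: cbm_sum => m; exact: cF.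
apply: eq_bigr => g _; rewrite cintegral_sum; last by move=> m; exact: cF.
rewrite /Z2transform mulr_suml; apply: eq_bigr => m _.
rewrite /F cintegralZ; last by apply: cbm_slice; [exact: measurable_X11|exact: measurable_xslice].
by rewrite /xtransform /slice_transform; ring.
Qed.

Lemma charfunX_inj_transform mu nu s n :
  (forall h, charfunX mu s n h = charfunX nu s n h) ->
  forall g, Z2transform mu n g s = Z2transform nu n g s.
Proof.
move=> mn g; apply/eqP; rewrite -subr_eq0; apply/eqP; move: g.
apply: (@finite_fourier_inj R G) => h; under eq_bigr do rewrite mulrBl.
by rewrite sumrB -!charfunX_slices mn subrr.
Qed.

Lemma Z2transformE mu g s :
  Z2transform mu 0 g s = xtransform mu 0 g s + xtransform mu 1 g s /\
  Z2transform mu 1 g s = xtransform mu 0 g s - xtransform mu 1 g s.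
Proof.
by rewrite /Z2transform !sum_Z2 !sgZ2_0l !sgZ2_r0 sgZ2_11 !mul1r mulN1r.
Qed.

Lemma xtransformE mu m g s :
  xtransform mu m g s = 2^-1 * (Z2transform mu 0 g s + sgZ2 m 1 * Z2transform mu 1 g s).
Proof.
have [-> ->] := Z2transformE mu g s.
by case: (Z2_cases m) => ->; rewrite ?sgZ2_0l ?sgZ2_11; field.
Qed.

(** Inverting the finite transforms over G and Z(2) isolates the line transform of each slice,
    uniqueness on the line identifies the slices, and [E] is a finite disjoint union of its parts in
    them. *)
Lemma charfunX_unique mu nu :
  (forall s n h, charfunX mu s n h = charfunX nu s n h) -> eq_dist mu nu.
Proof.
move=> mn E mE.
have xt m g s : xtransform mu m g s = xtransform nu m g s.
  rewrite !xtransformE; congr (_ * (_ + _ * _)); exact: charfunX_inj_transform.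
pose sec (p : 'Z_2 * G) : set R := [set t | E (t, p.1, p.2)].
have msec p : measurable (sec p).
  rewrite -[X in measurable X]setTI; pose i (t : R) : XG R G := (t, p.1 : Z2, p.2 : discr G).
  have mi : measurable_fun setT i.
    by apply: measurable_fun_pair => //; apply: measurable_fun_pair.
  exact: mi.
pose F (p : 'Z_2 * G) := xslice p.1 p.2 `&` (fun x : XG R G => x.1.1) @^-1` (sec p).
have -> : E = \bigcup_(p in [set: 'Z_2 * G]) F p.
  apply/seteqP; split => [[[t m] g] Ex|[[t m] g] [[m' g'] _ [[/= -> ->]]]]//.
  by exists (m, g).
have mF p : measurable (F p).
  apply: measurableI; first exact: measurable_xslice.
  by rewrite -[X in measurable X]setTI; exact: measurable_X11.
have tF : trivIset [set: 'Z_2 * G] F.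
  move=> [m g] [m' g'] _ _ [x [[[/= xm xg] _] [[/= xm' xg'] _]]].
  by rewrite -xm -xg xm' xg'.
have fs : finite_set [set: 'Z_2 * G] by exact: finite_finset.
rewrite (measure_fin_bigcup mu fs tF (fun p _ => mF p)).
rewrite (measure_fin_bigcup nu fs tF (fun p _ => mF p)).
apply: eq_fsbigr => p _.
apply: (real_fourier_unique measurable_X11 (measurable_xslice p.1 p.2)) => //.
by move=> s; exact: xt.
Qed.

End slices.

Section discrete_probability.
Context {R : realType} {V : finZmodType}.
Implicit Types (P : probability (discr V) R).

Lemma cintegral_discr P (f : V -> R[i]) :
  cintegral P (f : discr V -> R[i]) = \sum_v f v * (fine (P [set v]))%:C%C.
Proof.
have fE (x : discr V) : f x = \sum_v f v * ((\1_([set v] : set (discr V)) x : R)%:C%C).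
  rewrite (bigD1 (x : V))//= big1 ?addr0 => [|v vx].
    by rewrite indicE mem_set//= mulr1.
  rewrite indicE memNset ?mulr0//= => xv.
  by rewrite xv eqxx in vx.
rewrite (@eq_cintegral _ _ _ _ _ _ fE) cintegral_sum; last by move=> v; exact: cbm_discr.
apply: eq_bigr => v _; rewrite cintegralZ; last exact: cbm_discr.
congr (_ * _); apply: eqC; rewrite /= /Rintegral.
  by rewrite integral_indic// setIT.
by rewrite integral0.
Qed.

Lemma discr_probability_exists (p : V -> R) :
  (forall v, 0 <= p v) -> \sum_v p v = 1 ->
  exists P : probability (discr V) R, forall v, P [set v] = (p v)%:E.
Proof.
move=> p0 p1.
pose v_ i : discr V := nth 0 (enum V) i.
pose m_ i : {measure set (discr V) -> \bar R} := mscale (NngNum (p0 (v_ i))) (dirac (v_ i)).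
pose m : {measure set (discr V) -> \bar R} := msum m_ #|V|.
have mE A : m A = (\sum_v (p v)%:E * \d_(v : discr V) A)%E.
  transitivity (\sum_(v <- enum V) (p v)%:E * \d_(v : discr V) A)%E; last first.
    by rewrite big_enum.
  rewrite /m /= /msum (big_nth 0) -cardT big_mkord; apply: eq_bigr => i _.
  by rewrite /m_ /= /mscale.
clearbody m.
have mT : m setT = 1%E.
  rewrite mE; under eq_bigr do rewrite diracT mule1.
  by rewrite sumEFin p1.
(* The mass is already 1; normalising only equips the finite sum of point masses with the structure
   of a probability. *)
exists (mnormalize m (dirac (0 : discr V))) => v.
rewrite /= /mnormalize mT /= onee_eq0 /= invr1 mule1 mE.
rewrite (bigD1 v)//= big1 ?adde0 => [|w wv].
  by rewrite diracE mem_set// mule1.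
by rewrite diracE memNset ?mule0//= => wv'; rewrite wv' eqxx in wv.
Qed.

Lemma discr_probability_setE P (A : set (discr V)) :
  (forall v, ~ A v -> P [set v] = 0%E) -> P A = 1%E.
Proof.
move=> hA; rewrite -(setCK A) probability_setC//.
suff -> : P (~` A) = 0%E by rewrite sube0.
have -> : ~` A = \bigcup_(v in ~` A) [set v] by rewrite bigcup_imset1 image_id.
rewrite measure_fin_bigcup//; last 2 first.
  exact: (@finite_finset V).
  by move=> x y _ _ [z [/= <- <-]].
by rewrite fsbig1.
Qed.

End discrete_probability.

Section conditioning.
Context {d} {T : measurableType d} {R : realType}.

Lemma conditional_probability_exists (mu : probability T R) (D : set T) :
  measurable D -> mu D != 0%E ->
  exists nu : probability T R, forall f : T -> R[i], cbm f ->
    cintegral nu f =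
      ((fine (mu D))^-1)%:C%C * cintegral mu (fun x => (\1_D x : R)%:C%C * f x).
Proof.
move=> mD D0.
pose m : {measure set T -> \bar R} := mrestr mu mD.
have mT : m setT = mu D by rewrite /m /= /mrestr setTI.
have restr (A : set T) : A `<=` D -> m A = mu A.
  by move=> AD; rewrite /m /= /mrestr setIidl.
have mCD : m (~` D) = 0%E by rewrite /m /= /mrestr setICl measure0.
clearbody m.
have muDfin : mu D \is a fin_num by exact: fin_num_measure.
exists (mnormalize m mu) => f [rf If].
have r0 : 0 <= (fine (mu D))^-1 by rewrite invr_ge0 fine_ge0.
have key0 (g : T -> R) : bmf g -> (forall x, 0 <= g x) ->
    \int[mnormalize m mu]_x g x = (fine (mu D))^-1 * \int[mu]_x (\1_D x * g x).
  move=> bg g0; have [mg _] := bg; have mEg : measurable_fun setT (EFin \o g) by exact/measurable_EFinP.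
  rewrite /Rintegral (@eq_measure_integral _ _ _ _ (mscale (NngNum r0) m)); last first.
    move=> A mA _; rewrite /= /mnormalize mT (negbTE D0).
    have -> : (mu D == +oo)%E = false by apply/negbTE; rewrite -ltey -ge0_fin_numE.
    by rewrite /= /mscale /= muleC.
  rewrite ge0_integral_mscale//; last by move=> x _; rewrite lee_fin.
  have -> : (\int[m]_x (EFin \o g) x = \int[mu]_x (\1_D x * g x)%:E)%E.
    transitivity (\int[m]_(x in setT `\` ~` D) (g x)%:E)%E.
      apply: ge0_negligible_integral => //; first exact: measurableC.
      by move=> x _; rewrite lee_fin.
    rewrite setTD setCK (@eq_measure_integral _ _ _ _ mu); last by move=> A _; exact: restr.
    rewrite integral_mkcond; apply: eq_integral => x _.
    by rewrite /= patchE indicE; case: (x \in D); rewrite ?mul1r ?mul0r.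
  have bD : bmf (\1_D : T -> R) by exact: bmf_indic.
  rewrite fineM//.
  exact: (integrable_fin_num measurableT (bmf_integrable mu measurableT (bmfM bD bg))).
have key (g : T -> R) : bmf g ->
    \int[mnormalize m mu]_x g x = (fine (mu D))^-1 * \int[mu]_x (\1_D x * g x).
  move=> bg; have [mg [M gM]] := bg.
  have M0 : 0 <= M by rewrite (le_trans _ (gM point)).
  (* Adding the bound [M] makes the integrand nonnegative, where [key0] applies; the extra
     contribution on both sides is [M]. *)
  have bgM : bmf (fun x => g x + M) by apply: bmfD => //; exact: bmf_cst.
  have e (P : probability T R) : \int[P]_x g x = \int[P]_x (g x + M) - M.
    rewrite RintegralD//; last 2 first.
      exact: (bmf_integrable P measurableT bg).
      exact: (bmf_integrable P measurableT (bmf_cst M)).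
    by rewrite Rintegral_probability_cst addrK.
  have gM0 x : 0 <= g x + M by have := gM x; rewrite ler_norml; lra.
  have bD : bmf (\1_D : T -> R) by exact: bmf_indic.
  rewrite e key0//.
  have -> : \int[mu]_x (\1_D x * (g x + M)) = \int[mu]_x (\1_D x * g x) + M * fine (mu D).
    transitivity (\int[mu]_x (\1_D x * g x + M * \1_D x)).
      by apply: eq_Rintegral => x _; ring.
    rewrite RintegralD//; last 2 first.
      exact: (bmf_integrable mu measurableT (bmfM bD bg)).
      exact: (bmf_integrable mu measurableT (bmfM (bmf_cst M) bD)).
    rewrite RintegralZl//; last exact: (bmf_integrable mu measurableT bD).
    by rewrite [X in _ + _ * X]/Rintegral integral_indic// setIT.
  have D1 : fine (mu D) != 0 by rewrite fine_eq0.
  by field.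
apply: eqC.
  rewrite ReZ /= key//; congr (_ * _); apply: eq_Rintegral => x _.
  by rewrite ReZ.
rewrite ImZ /= key//; congr (_ * _); apply: eq_Rintegral => x _.
by rewrite ImZ.
Qed.

End conditioning.

(** * Concentration on the kernel *)

Section odd_group.
Context {G : finZmodType}.
Hypothesis G_no2 : forall g : G, g *+ 2 = 0 -> g = 0.

Lemma double_inj : injective (fun x : G => x *+ 2).
Proof. by move=> x y xy; apply/subr0_eq/G_no2; rewrite mulrnBl xy subrr. Qed.

(** Doubling is injective on a finite set, hence bijective, and its inverse inherits additivity. *)
Lemma half_exists : exists half : G -> G,
  (forall x, half x *+ 2 = x) /\ {morph half : x y / x + y}.
Proof.
exists (invF double_inj).
have hK x : invF double_inj x *+ 2 = x := f_invF double_inj x.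
by split => // x y; apply: double_inj; rewrite /= mulrnDl !hK.
Qed.

End odd_group.

(** * Iteration of the equation for the log-moduli *)

Section vanishing.
Context {R : realType} {G : finZmodType}.
Variables (phi psi : (G -> G) -> R) (t d al al' : G -> G).
Hypotheses (phi_ge0 : forall e, 0 <= phi e) (psi_ge0 : forall e, 0 <= psi e).
Let additive (e : G -> G) := {morph e : x y / x + y}.
Hypotheses (tD : additive t) (dD : additive d) (alD : additive al) (al'D : additive al').
Hypotheses (td : forall x, t (d x) = d (t x)) (ald : forall x, al (d x) = d (al x)).
Hypotheses (al't : forall x, al' (t x) = t (al' x)) (al'K : cancel al al').
Hypothesis H1 : forall e, additive e -> phi e + psi (e \o t) = psi (e \o d).
Hypothesis H2 : forall e, additive e -> phi (e \o t) + psi (e \o al) = phi (e \o d).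

Let additive_comp e f : additive e -> additive f -> additive (e \o f).
Proof. by move=> eD fD x y; rewrite /= fD eD. Qed.

(* Precomposition with [E] does not decrease [psi] and increases [phi] by at
   least [psi (e \o t)], while [phi] takes only finitely many values. *)
Let E := al' \o (d \o d).

Let ED : additive E. Proof. exact: additive_comp al'D (additive_comp dD dD). Qed.

(** The second relation at [e \o al' \o d], then the first at [e]; the inverse [al'] is there to
    cancel the [al] that the second relation introduces. *)
Let phi_step e : additive e -> phi e + psi (e \o t) <= phi (e \o E).
Proof.
move=> eD; pose e1 := e \o al'; have e1D : additive e1 by exact: additive_comp.
have -> : phi (e \o E) = phi ((e1 \o d) \o d) by [].
rewrite -H2; last exact: additive_comp.
have -> : (e1 \o d) \o al = (e1 \o al) \o d by apply/funext => x /=; rewrite ald.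
have e1al : e1 \o al = e by apply/funext => x; rewrite /e1 /= al'K.
by rewrite -H1 e1al// lerDr.
Qed.

Let psi_step e : additive e -> psi e <= psi (e \o E).
Proof.
move=> eD; pose e1 := e \o al'; have e1D : additive e1 by exact: additive_comp.
have -> : psi (e \o E) = psi ((e1 \o d) \o d) by [].
rewrite -H1; last exact: additive_comp.
rewrite -(H2 e1D).
have -> : e1 \o al = e by apply/funext => x; rewrite /e1 /= al'K.
by rewrite -addrA [psi e + _]addrC addrA lerDr addr_ge0.
Qed.

Let iterED n e : additive e -> additive (e \o iter n E).
Proof.
move=> eD; elim: n => // n IH x y.
by rewrite /= -!iterS !iterSr ED; exact: IH.
Qed.

Let tE x : t (E x) = E (t x).
Proof. by rewrite /E /= -al't !td. Qed.

Let titerE n x : t (iter n E x) = iter n E (t x).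
Proof. by elim: n => //= n IH; rewrite tE IH. Qed.

Let psi_iter n e : additive e -> psi e <= psi (e \o iter n E).
Proof.
move=> eD; elim: n => // n IH; apply: (le_trans IH).
have -> : e \o iter n.+1 E = (e \o iter n E) \o E by apply/funext => x; rewrite /= -iterS iterSr.
exact/psi_step/iterED.
Qed.

Let phi_iter n e : additive e -> phi e + psi (e \o t) *+ n <= phi (e \o iter n E).
Proof.
move=> eD; elim: n => [|n IH]; first by rewrite mulr0n addr0.
have -> : e \o iter n.+1 E = (e \o iter n E) \o E by apply/funext => x; rewrite /= -iterS iterSr.
apply: le_trans (phi_step (iterED _ eD)).
rewrite mulrS addrCA [leLHS]addrC lerD//.
have -> : (e \o iter n E) \o t = (e \o t) \o iter n E by apply/funext => x /=; rewrite titerE.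
by apply: psi_iter; exact: additive_comp.
Qed.

Let psi_vanish e : additive e -> psi (e \o t) = 0.
Proof.
move=> eD; apply/eqP; rewrite eq_le psi_ge0 andbT leNgt; apply/negP => p0.
pose B := \sum_(f : {ffun G -> G}) phi f.
have phiB f : phi f <= B.
  have -> : phi f = phi [ffun x => f x] by congr phi; apply/funext => x; rewrite ffunE.
  by rewrite /B (bigD1 [ffun x => f x])//= lerDl sumr_ge0.
have := phi_iter (Num.truncn (B / psi (e \o t))).+1 eD.
apply/negP; rewrite -ltNge (le_lt_trans (phiB _))//.
rewrite ltr_wpDl// -mulr_natl -ltr_pdivrMr//.
exact: truncnS_gt.
Qed.

(** For [phi], the first relation at [e \o t] involves [psi] only at maps that factor through [t],
    where it is already known to vanish. *)
Lemma heyde_vanishing e : additive e -> phi (e \o t) = 0 /\ psi (e \o t) = 0.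
Proof.
move=> eD; split; last exact: psi_vanish.
have := H1 (additive_comp eD tD); rewrite psi_vanish ?addr0; last exact: additive_comp.
move=> ->; have -> : (e \o t) \o d = (e \o d) \o t by apply/funext => x /=; rewrite td.
by apply: psi_vanish; exact: additive_comp.
Qed.

End vanishing.

Section log_modulus.
Context {R : realType}.
Implicit Types z w : R[i].

Definition cmod z : R := complex.Re `|z|.

Lemma cmodE z : `|z| = (cmod z)%:C%C.
Proof. by rewrite /cmod normc_def. Qed.

Lemma cmodM z w : cmod (z * w) = cmod z * cmod w.
Proof. by apply: (@complexI R); rewrite rmorphM /= -!cmodE normrM. Qed.

Lemma cmod_gt0 z : z != 0 -> 0 < cmod z.
Proof. by move=> z0; rewrite -ltcR -cmodE normr_gt0. Qed.

Lemma cmod_conj z : cmod z^*%C = cmod z.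
Proof. by rewrite /cmod normcJ. Qed.

Definition nlog z : R := - ln (cmod z).

Lemma nlog_ge0 z : `|z| <= 1 -> 0 <= nlog z.
Proof.
move=> z1; rewrite oppr_ge0 ln_le0//.
by rewrite -lecR -cmodE.
Qed.

Lemma nlogM z w : z != 0 -> w != 0 -> nlog (z * w) = nlog z + nlog w.
Proof.
by move=> z0 w0; rewrite /nlog cmodM lnM ?opprD// posrE cmod_gt0.
Qed.

Lemma nlog_eq0 z : z != 0 -> nlog z = 0 -> `|z| = 1.
Proof.
move=> z0 /eqP; rewrite oppr_eq0 ln_eq0 ?cmod_gt0// => /eqP z1.
by rewrite cmodE z1.
Qed.

End log_modulus.

Section fibers.
Context {R : realType} {G : finZmodType}.
Implicit Types (mu : probability (XG R G) R) (Q : G -> Prop).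

Definition fiber (g : G) : set (XG R G) := [set x | x.2 = g].

Lemma measurable_fiber g : measurable (fiber g).
Proof.
by rewrite -[X in measurable X]setTI; apply: (measurable_X2 _ (Y := [set g])).
Qed.

Lemma measurable_snd_pred Q : measurable [set x : XG R G | Q x.2].
Proof.
by rewrite -[X in measurable X]setTI; apply: (measurable_X2 _ (Y := [set g | Q g])).
Qed.

Lemma ae_fiber mu Q g : {ae mu, forall x, Q x.2} -> mu (fiber g) != 0%E -> Q g.
Proof.
move=> aeQ; apply: contra_neqP => nQ.
have : mu.-negligible [set x : XG R G | ~ Q x.2] by [].
move=> /negligibleP -/(_ (measurable_snd_pred (fun g => ~ Q g))) h0.
apply/eqP; rewrite -measure_le0 -h0 le_measure ?inE//.
- exact: measurable_fiber.
- exact: (measurable_snd_pred (fun g => ~ Q g)).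
- by move=> x /= ->.
Qed.

(** The last coordinate is discrete, so an almost sure property of it is a property of the finitely
    many fibres of positive mass. *)
Lemma fiber_ae mu Q : (forall g, mu (fiber g) != 0%E -> Q g) -> {ae mu, forall x, Q x.2}.
Proof.
move=> hQ; apply/negligibleP; first exact: (measurable_snd_pred (fun g => ~ Q g)).
have -> : ~` (fun x : XG R G => Q x.2) = \bigcup_(g in [set g : G | ~ Q g]) fiber g.
  by apply/seteqP; split => [x nQ|x [g nQ xg]]; [exists x.2|rewrite /= xg].
rewrite measure_fin_bigcup//.
- by rewrite fsbig1// => g /= nQ; apply/eqP; apply: contra_notT nQ; exact: hQ.
- exact: finite_finset.
- by move=> x y _ _ [z [/= <- <-]].
- by move=> g _; exact: measurable_fiber.
Qed.

Lemma fiber_exists mu : exists g, mu (fiber g) != 0%E.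
Proof.
apply: contrapT => /forallNP h.
have [|N [mN N0 sN]] := @fiber_ae mu (fun=> False); first by move=> g; exact: h.
move: N0; have -> : N = setT by apply/seteqP; split => // x _; apply: sN.
by rewrite probability_setT => /eqP; rewrite onee_eq0.
Qed.

Definition shiftX (g : G) (x : XG R G) : XG R G := (x.1, x.2 - g).

Lemma measurable_shiftX g : measurable_fun setT (shiftX g).
Proof.
apply: measurable_fun_pair; first exact: measurable_fst.
exact: (measurableT_comp (@measurable_fun_discr G _ (discr G) (fun m => m - g)) measurable_X2).
Qed.

Definition shift_dist mu g : probability (XG R G) R :=
  distribution mu (mfun_of (measurable_shiftX g)).

Lemma charfunX_shift mu g s n h : charfunX mu s n h = charfunX (shift_dist mu g) s n h * h g.
Proof.
rewrite mulrC /charfunX cintegral_distribution; last exact: cbm_pairX.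
rewrite -cintegralZ; last exact: (cbm_comp (measurable_shiftX g) (cbm_pairX s n h)).
apply: eq_cintegral => x; rewrite !pairXE /= charB.
by field; exact: char_neq0.
Qed.

Lemma shift_fiber mu g g' : shift_dist mu g (fiber g') = mu (fiber (g' + g)).
Proof.
rewrite /shift_dist /= /distribution /pushforward /=; congr (mu _).
by apply/seteqP; split => x; rewrite /fiber /shiftX /=; [move=> <-; rewrite subrK|move=> ->; rewrite addrK].
Qed.

End fibers.

(** * Shifting both distributions onto the kernel *)

Section concentration.
Context {R : realType} {G : finZmodType}.
Hypothesis G_no2 : forall g : G, g *+ 2 = 0 -> g = 0.
Variables (a : R) (alpha : G -> G) (aD : {morph alpha : x y / x + y}).
Implicit Types (mu nu : probability (XG R G) R) (h k : char_group R G).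

Definition heyde mu1 mu2 := forall s s' n h k,
  charfunX mu1 (s + s') n (charM h k) *
  charfunX mu2 (s + a * s') n (charM h (char_comp k aD)) =
  charfunX mu1 (s - s') n (charM h (charV k)) *
  charfunX mu2 (s - a * s') n (charM h (charV (char_comp k aD))).

Hypothesis alpha_bij : bijective alpha.

Lemma additive0 (e : G -> G) : {morph e : x y / x + y} -> e 0 = 0.
Proof. by move=> eD; apply: (@addrI _ (e 0)); rewrite -eD !addr0. Qed.

Lemma additiveN (e : G -> G) : {morph e : x y / x + y} -> {morph e : x / - x}.
Proof. by move=> eD x; apply: (@addrI _ (e x)); rewrite -eD !subrr additive0. Qed.

(** The characteristic function at the character [k] composed with [e]. Indexing by maps [e] for a
    fixed [k], additive or not, lets the iteration act by composition on a finite set. *)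
Let Fc mu k (e : G -> G) := cintegral mu (fun x : XG R G => k (e x.2)).

Let Fc_le1 mu k e : `|Fc mu k e| <= 1.
Proof.
apply: cintegral_norm_le1; last by move=> x; rewrite char_norm1.
exact: (cbm_comp measurable_X2 (cbm_discr (fun g => k (e g)))).
Qed.

Let FcE mu k h e : (forall g, h g = k (e g)) -> charfunX mu 0 0 h = Fc mu k e.
Proof.
move=> he; apply: eq_cintegral => x; rewrite pairXE mulr0 cexp_im0 sgZ2_r0 !mul1r.
exact: he.
Qed.

Variables mu1 mu2 : probability (XG R G) R.
Hypothesis mu1_neq0 : forall s n h, charfunX mu1 s n h != 0.
Hypothesis mu2_neq0 : forall s n h, charfunX mu2 s n h != 0.
Hypothesis HE : heyde mu1 mu2.

Variables (half : G -> G) (halfK : forall x, half x *+ 2 = x)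
  (halfD : {morph half : x y / x + y}).

(** The maps [t] and [d] are (I + alpha)/2 and (I - alpha)/2. The halves make the equation with both
    characters equal to [k \o e \o half] relate exactly [e], [e \o t] and [e \o d]. *)
Let t x := half (x + alpha x).
Let d x := half (x - alpha x).

Let half_inj : injective half.
Proof. by move=> x y xy; rewrite -(halfK x) xy halfK. Qed.

Let halfE x : half x + half x = x.
Proof. by rewrite -mulr2n halfK. Qed.

Let half_alpha x : half (alpha x) = alpha (half x).
Proof. by apply: (double_inj G_no2); rewrite /= halfK mulr2n -aD halfE. Qed.

Let tD : {morph t : x y / x + y}.
Proof. by move=> x y; rewrite /t aD -halfD; congr half; rewrite addrACA. Qed.

Let dD : {morph d : x y / x + y}.
Proof. by move=> x y; rewrite /d aD -halfD; congr half; rewrite opprD addrACA. Qed.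

Let comm_d x : alpha (d x) = d (alpha x).
Proof. by rewrite /d -half_alpha aD (additiveN aD). Qed.

Let comm_t x : alpha (t x) = t (alpha x).
Proof. by rewrite /t -half_alpha aD. Qed.

Let td x : t (d x) = d (t x).
Proof.
rewrite /t comm_d -dD /d; congr half; rewrite /t.
by rewrite [LHS]halfD (additiveN halfD) half_alpha.
Qed.

Let Fc_neq0 mu k e : (forall s n h, charfunX mu s n h != 0) ->
  {morph e : x y / x + y} -> Fc mu k e != 0.
Proof. by move=> mu0 eD; rewrite -(@FcE mu k (char_comp k eD)). Qed.

Let heyde1 k e : {morph e : x y / x + y} ->
  Fc mu1 k e * Fc mu2 k (e \o t) = Fc mu2 k (e \o d).
Proof.
move=> eD.
have ehD : {morph e \o half : x y / x + y} by move=> x y; rewrite /= halfD eD.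
have := HE 0 0 0 (char_comp k ehD) (char_comp k ehD); rewrite mulr0 addr0 subr0.
rewrite (FcE mu1 (e := e) (k := k)); last by move=> g; rewrite /= -char_add -eD halfE.
rewrite (FcE mu2 (e := e \o t) (k := k)); last first.
  by move=> g; rewrite /= -char_add -eD /t halfD.
rewrite (charfunX_ext mu1 0 0 (k := char1)) ?charfunX0 ?mul1r; last first.
  by move=> g; rewrite /= divff// char_neq0.
move=> ->; apply: FcE => g.
by rewrite /= /d halfD (additiveN halfD) eD (additiveN eD) char_add charN.
Qed.

(** The characters are chosen with u = bv, so that the second factor on the right is at the trivial
    character; the first is at minus [e \o d], hence the conjugate. *)
Let heyde2 k e : {morph e : x y / x + y} ->
  Fc mu1 k (e \o t) * Fc mu2 k (e \o alpha) = (Fc mu1 k (e \o d))^*%C.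
Proof.
move=> eD.
have ehD : {morph e \o half : x y / x + y} by move=> x y; rewrite /= halfD eD.
have ehaD : {morph e \o (half \o alpha) : x y / x + y} by move=> x y; rewrite /= aD halfD eD.
have edD : {morph e \o d : x y / x + y} by move=> x y; rewrite /= dD eD.
have := HE 0 0 0 (char_comp k ehaD) (char_comp k ehD); rewrite mulr0 addr0 subr0.
rewrite (FcE mu1 (e := e \o t) (k := k)); last first.
  by move=> g; rewrite /= -char_add -eD -halfD addrC.
rewrite (FcE mu2 (e := e \o alpha) (k := k)); last first.
  by move=> g; rewrite /= -char_add -eD halfE.
rewrite [X in _ = _ * X](charfunX_ext mu2 0 0 (k := char1)) ?charfunX0 ?mulr1; last first.
  by move=> g; rewrite /= divff// char_neq0.
move=> ->; rewrite -(@FcE mu1 k (char_comp k edD))// -charfunX_conj oppr0.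
apply: charfunX_ext => g.
by rewrite /= /d halfD (additiveN halfD) eD (additiveN eD) char_add charN invf_div.
Qed.

Lemma unimodular_t k : `|Fc mu1 k t| = 1 /\ `|Fc mu2 k t| = 1.
Proof.
have [al' al'K alK] := alpha_bij.
have al'D : {morph al' : x y / x + y}.
  by move=> x y; apply: (can_inj al'K); rewrite aD !alK.
have al't x : al' (t x) = t (al' x).
  by apply: (can_inj al'K); rewrite alK comm_t alK.
have idD : {morph @id G : x y / x + y} by [].
pose phi1 e := nlog (Fc mu1 k e); pose phi2 e := nlog (Fc mu2 k e).
have phi1_ge0 e : 0 <= phi1 e by apply: nlog_ge0.
have phi2_ge0 e : 0 <= phi2 e by apply: nlog_ge0.
have H1 e : {morph e : x y / x + y} -> phi1 e + phi2 (e \o t) = phi2 (e \o d).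
  move=> eD; rewrite /phi1 /phi2 -heyde1// nlogM//; apply: Fc_neq0 => //.
  by move=> x y; rewrite /= tD eD.
have H2 e : {morph e : x y / x + y} -> phi1 (e \o t) + phi2 (e \o alpha) = phi1 (e \o d).
  move=> eD; rewrite /phi1 /phi2 -[nlog (Fc mu1 k (e \o d))]/(- ln _) -cmod_conj -heyde2//.
  rewrite -/(nlog _) nlogM//; apply: Fc_neq0 => //.
    by move=> x y; rewrite /= tD eD.
  by move=> x y; rewrite /= aD eD.
have [h1 h2] := heyde_vanishing phi1_ge0 phi2_ge0 tD dD al'D td comm_d al't al'K H1 H2 idD.
by split; apply: nlog_eq0 => //; exact: Fc_neq0.
Qed.

Let t_inj x y : t x = t y -> (x - y) + alpha (x - y) = 0.
Proof. by move/half_inj => xy; rewrite aD (additiveN aD) addrACA -opprD xy subrr. Qed.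

(** A mean of unit modulus forces each [k \o t] to be almost surely constant, and characters
    separate the values of [t]. *)
Lemma ae_t_const mu : (forall k, `|Fc mu k t| = 1) ->
  exists g, forall g', mu (fiber g') != 0%E -> t g' = t g.
Proof.
move=> mod1; have [g gP] := fiber_exists mu; exists g => g' g'P.
apply: (@char_separation R) => k.
have ck : cbm (fun x : XG R G => k (t x.2)).
  exact: (cbm_comp measurable_X2 (cbm_discr (fun g => k (t g)))).
have aek : {ae mu, forall x : XG R G, k (t x.2) = Fc mu k t}.
  apply: (cintegral_norm_eq1 ck _ (mod1 k)) => x; by rewrite char_norm1.
have h := @ae_fiber R G mu (fun y => k (t y) = Fc mu k t).
by rewrite (h g' aek g'P) (h g aek gP).
Qed.

Lemma Fc_ae_t mu k g : (forall g', mu (fiber g') != 0%E -> t g' = t g) ->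
  forall e : G -> G, Fc mu k (e \o t) = k (e (t g)).
Proof.
move=> hg e; rewrite -[RHS](cintegral_cst mu); apply: ae_eq_cintegral.
- exact: (cbm_comp measurable_X2 (cbm_discr (fun g => k (e (t g))))).
- exact: cbm_cst.
- by apply: (@fiber_ae R G mu (fun y => k ((e \o t) y) = k (e (t g)))) => g' /hg /= ->.
Qed.

(** The shifts divide both sides by values of [h] and [k] that already agree for [h]; the condition
    on [g1] and [g2] makes those of [k] cancel. *)
Lemma heyde_shift g1 g2 : g1 + alpha g2 = 0 ->
  heyde (shift_dist mu1 g1) (shift_dist mu2 g2).
Proof.
move=> g12 s s' n h k.
have fE mu g s0 n0 h0 : charfunX (shift_dist mu g) s0 n0 h0 = charfunX mu s0 n0 h0 / h0 g.
  by rewrite [charfunX mu _ _ _](charfunX_shift mu g) mulfK// char_neq0.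
have kg : k (alpha g2) = (k g1)^-1.
  by rewrite -charN; congr (k _); apply/eqP; rewrite -addr_eq0 addrC g12.
rewrite !fE mulf_div HE mulf_div; congr (_ / _) => /=.
by rewrite kg; field; rewrite !char_neq0.
Qed.

Lemma heyde_reduction : exists g1 g2,
  [/\ heyde (shift_dist mu1 g1) (shift_dist mu2 g2),
    {ae shift_dist mu1 g1, forall x, x.2 + alpha x.2 = 0}
    & {ae shift_dist mu2 g2, forall x, x.2 + alpha x.2 = 0}].
Proof.
have [al' al'K alK] := alpha_bij.
have [g1 g1P] := ae_t_const (fun k => (unimodular_t k).1).
have [g2' g2'P] := ae_t_const (fun k => (unimodular_t k).2).
(* The equation survives only for this [g2], whereas concentration is known around [g2']. It remains
   to see that the two differ by an element of the kernel. *)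
pose g2 := al' (- g1).
have ag2 : alpha g2 = - g1 by rewrite alK.
exists g1, g2; split.
- by apply: heyde_shift; rewrite ag2 subrr.
- apply: (@fiber_ae R G _ (fun y => y + alpha y = 0)) => g; rewrite shift_fiber => /g1P /t_inj.
  by rewrite addrK.
(* [heyde1] at [e = t] evaluates every factor at a point; since [t - d = alpha], it says that each
   character is 1 at [t (g1 + alpha g2')]. *)
have key : t (g1 + alpha g2') = 0.
  apply: (@char_separation R) => k; rewrite char0.
  have := heyde1 k tD.
  rewrite (Fc_ae_t k g1P id) (Fc_ae_t k g2'P t).
  have -> : t \o d = d \o t.
    by apply/funext => x /=; exact: td.
  rewrite (Fc_ae_t k g2'P d) => h.
  have : k (t g1 + t (t g2') - d (t g2')) = 1.
    by rewrite char_add charN char_add h divff// char_neq0.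
  move=> <-; congr (k _); rewrite tD -addrA; congr (_ + _).
  set y := t g2'.
  have -> : t (alpha g2') = alpha y by rewrite /y /t -half_alpha aD.
  rewrite /t /d -(additiveN halfD) -halfD opprB [alpha y - y]addrC addrACA subrr.
  by rewrite add0r halfD halfE.
have K1 : (g1 + alpha g2') + alpha (g1 + alpha g2') = 0.
  have := @t_inj (g1 + alpha g2') 0; rewrite subr0; apply.
  by rewrite key (additive0 tD).
have K2 : (g2' - g2) + alpha (g2' - g2) = 0.
  apply: (can_inj al'K); rewrite aD (additive0 aD).
  have -> : alpha (g2' - g2) = g1 + alpha g2' by rewrite aD (additiveN aD) ag2 opprK addrC.
  exact: K1.
apply: (@fiber_ae R G _ (fun y => y + alpha y = 0)) => g; rewrite shift_fiber => /g2'P /t_inj gg.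
have -> : g = (g + g2 - g2') + (g2' - g2) by rewrite addrA subrK addrK.
by rewrite aD addrACA gg K2 addr0.
Qed.

End concentration.

(** * The equation on the kernel *)

Section charfun_regularity.
Context {R : realType} {G : finZmodType}.
Implicit Types (nu : probability (XG R G) R) (h k p q : char_group R G).

Lemma Re_cexp_im (x : R) : complex.Re (cexp (0 +i* x)%C) = cos x.
Proof. by rewrite /cexp /= expR0 mul1r. Qed.

Lemma Im_cexp_im (x : R) : complex.Im (cexp (0 +i* x)%C) = sin x.
Proof. by rewrite /cexp /= expR0 mul1r. Qed.

Lemma charfunX_continuous nu n h :
  continuous (fun s => complex.Re (charfunX nu s n h)) /\
  continuous (fun s => complex.Im (charfunX nu s n h)).
Proof.
have [c1 c2] : (forall x : XG R G, continuous (fun s => complex.Re (pairX x s n h))) /\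
    (forall x : XG R G, continuous (fun s => complex.Im (pairX x s n h))).
  have cx (f : R -> R) (x : XG R G) : continuous f -> continuous (fun s => f (x.1.1 * s)).
    move=> cf s; apply: (@continuous_comp _ _ _ (fun s : R => x.1.1 * s) f s); last exact: cf.
    by apply: cvgM; [exact: cvg_cst|exact: cvg_id].
  split=> x.
    have -> : (fun s => complex.Re (pairX x s n h)) = fun s =>
        cos (x.1.1 * s) * complex.Re (sgZ2 x.1.2 n * h x.2) -
        sin (x.1.1 * s) * complex.Im (sgZ2 x.1.2 n * h x.2).
      by apply/funext => s; rewrite pairXE -mulrA [LHS]ReM Re_cexp_im Im_cexp_im.
    move=> s; apply: cvgB; apply: cvgM; [|exact: cvg_cst| |exact: cvg_cst].
      by apply: cx; exact: continuous_cos.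
    by apply: cx; exact: continuous_sin.
  have -> : (fun s => complex.Im (pairX x s n h)) = fun s =>
      cos (x.1.1 * s) * complex.Im (sgZ2 x.1.2 n * h x.2) +
      sin (x.1.1 * s) * complex.Re (sgZ2 x.1.2 n * h x.2).
    by apply/funext => s; rewrite pairXE -mulrA [LHS]ImM Re_cexp_im Im_cexp_im.
  move=> s; apply: cvgD; apply: cvgM; [|exact: cvg_cst| |exact: cvg_cst].
    by apply: cx; exact: continuous_cos.
  by apply: cx; exact: continuous_sin.
have nR (z : R[i]) : `|z| = 1 -> `|complex.Re z| <= 1 /\ `|complex.Im z| <= 1.
  rewrite normc_def => -[] z1.
  have : complex.Re z ^+ 2 + complex.Im z ^+ 2 = 1.
    by rewrite -[RHS](expr1n _ 2) -z1 sqr_sqrtr// addr_ge0 ?sqr_ge0.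
  have sq (x : R) : x ^+ 2 <= 1 -> `|x| <= 1.
    by move=> x1; rewrite -(@expr_le1 _ 2)// real_normK ?num_real.
  by move=> zE; split; apply: sq; rewrite -zE ?lerDl ?lerDr sqr_ge0.
have key (F : R -> XG R G -> R) : (forall s, bmf (F s)) ->
    (forall s x, `|F s x| <= 1) -> (forall x, continuous (F ^~ x)) ->
    continuous (fun s => \int[nu]_x F s x).
  move=> bF F1 cF s.
  have := @continuity_under_integral R _ _ nu F setT measurableT (s - 1) (s + 1)
    (fun x _ => bmf_integrable nu measurableT (bF x)).
  move=> /(_ _ (fun=> 1) (bmf_integrable nu measurableT (bmf_cst 1))); apply.
  - by apply: aeW => x _ z _; exact: cF.
  - by move=> x _; apply: aeW => y _; exact: F1.
  - by rewrite inE /= in_itv/= ltrBlDr !ltrDl ltr01.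
split.
  apply: (key (fun s x => complex.Re (pairX x s n h))) => // [s|s x].
    by have [] := cbm_pairX s n h.
  by have [] := nR _ (pairX_norm x s n h).
apply: (key (fun s x => complex.Im (pairX x s n h))) => // [s|s x].
  by have [] := cbm_pairX s n h.
by have [] := nR _ (pairX_norm x s n h).
Qed.

Lemma charfunX_hermitian nu s n : charfunX nu (- s) n char1 = (charfunX nu s n char1)^*%C.
Proof. by rewrite -charfunX_conj; apply: charfunX_ext => g; rewrite /= invr1. Qed.

Lemma charfunX_real nu n : exists r : R, charfunX nu 0 n char1 = r%:C%C.
Proof.
have := charfunX_hermitian nu 0 n; rewrite oppr0; case: (charfunX nu 0 n char1) => x y [] yN.
by exists x; apply: eqC => //=; lra.
Qed.

(** Unit modulus makes the character at [s0] constant almost surely, so it leaves the integral as a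
    factor. *)
Lemma charfunX_unimodular nu s0 s n h : `|charfunX nu s0 0 char1| = 1 ->
  charfunX nu (s + s0) n h = charfunX nu s n h * charfunX nu s0 0 char1.
Proof.
move=> f1.
have ae1 : {ae nu, forall x : XG R G, pairX x s0 0 char1 = charfunX nu s0 0 char1}.
  by apply: (cintegral_norm_eq1 (cbm_pairX s0 0 char1) _ f1) => x; rewrite pairX_norm.
rewrite mulrC -cintegralZ; last exact: cbm_pairX.
rewrite (charfunX_ext nu (s + s0) n (k := charM h char1)); last by move=> g; rewrite /= mulr1.
apply: ae_eq_cintegral; first exact: cbm_pairX.
  by apply: cbmM; [exact: cbm_cst|exact: cbm_pairX].
by apply: filterS ae1 => x <-; rewrite -pairXM mulrC.
Qed.

Definition gauss_char (sigma m s : R) : R[i] := cexp ((- (sigma * s ^+ 2)) +i* (m * s))%C.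

Lemma gauss_char_mod sigma m s : cmod (gauss_char sigma m s) = expR (- (sigma * s ^+ 2)).
Proof.
rewrite /gauss_char /cmod normc_def /cexp /= !exprMn -mulrDr cos2Dsin2 mulr1.
by rewrite sqrtr_sqr ger0_norm// expR_ge0.
Qed.

Lemma gauss_char_sigma_ge0 nu n sigma m : charfunX nu 0 n char1 != 0 ->
  (forall s, charfunX nu s n char1 = gauss_char sigma m s * charfunX nu 0 n char1) ->
  0 <= sigma.
Proof.
move=> f0 fE; rewrite leNgt; apply/negP => s0.
pose c := cmod (charfunX nu 0 n char1); have c0 : 0 < c by exact: cmod_gt0.
(* At this [s] the modulus is [c * expR c^-1], which exceeds 1 because [expR c^-1 >= 1 + c^-1]. *)
pose s := Num.sqrt (c^-1 / - sigma).
have := charfunX_norm_le1 nu s n char1.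
rewrite fE cmodE cmodM -/c gauss_char_mod -[1]/((1 : R)%:C%C) lecR.
have -> : - (sigma * s ^+ 2) = c^-1.
  rewrite sqr_sqrtr; first by field; rewrite gt_eqF//= lt_eqF.
  by rewrite divr_ge0 ?invr_ge0 ?(ltW c0)// oppr_ge0 ltW.
rewrite -ler_pdivlMr// div1r => h.
have := le_trans (expR_ge1Dx c^-1) h; lra.
Qed.

End charfun_regularity.

Section heyde_on_kernel.
Context {R : realType} {G : finZmodType}.
Hypothesis G_no2 : forall g : G, g *+ 2 = 0 -> g = 0.
Variables (alpha : G -> G) (aD : {morph alpha : x y / x + y}).
Implicit Types (nu : probability (XG R G) R) (h k p q : char_group R G).

(** The general equation at u = (p + q)/2, v = (p - q)/2: as alpha is -I on the kernel, u + bv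
    restricts to q and u - bv to p, so the second factor sees the two characters exchanged. *)
Definition kernel_heyde (a : R) nu1 nu2 := forall s s' n p q,
  charfunX nu1 (s + s') n p * charfunX nu2 (s + a * s') n q =
  charfunX nu1 (s - s') n q * charfunX nu2 (s - a * s') n p.

Lemma charfunX_ext_kernel nu s n h k :
  {ae nu, forall x : XG R G, x.2 + alpha x.2 = 0} ->
  (forall g, g + alpha g = 0 -> h g = k g) -> charfunX nu s n h = charfunX nu s n k.
Proof.
move=> aeK hk; apply: ae_eq_cintegral; [exact: cbm_pairX|exact: cbm_pairX|].
by apply: filterS aeK => x xK; rewrite !pairXE hk.
Qed.

Lemma kernel_heyde_of a nu1 nu2 : heyde a aD nu1 nu2 ->
  {ae nu1, forall x : XG R G, x.2 + alpha x.2 = 0} ->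
  {ae nu2, forall x : XG R G, x.2 + alpha x.2 = 0} -> kernel_heyde a nu1 nu2.
Proof.
move=> HE ae1 ae2 s s' n p q.
have [half [halfK halfD]] := half_exists G_no2.
have hE (h : char_group R G) g : h g = h (half g) * h (half g).
  by rewrite -char_add -mulr2n halfK.
have al g : g + alpha g = 0 -> alpha g = - g by move=> g0; apply/eqP; rewrite -addr_eq0 addrC g0.
have halfN g : half (- g) = - half g by exact: additiveN.
pose h := char_comp (charM p q) halfD; pose k := char_comp (charM p (charV q)) halfD.
have e1 : charfunX nu1 (s + s') n p = charfunX nu1 (s + s') n (charM h k).
  by apply: charfunX_ext_kernel ae1 _ => g _; rewrite /= (hE p g); field; exact: char_neq0.
have e2 : charfunX nu2 (s + a * s') n q =
    charfunX nu2 (s + a * s') n (charM h (char_comp k aD)).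
  apply: charfunX_ext_kernel ae2 _ => g /al gK; rewrite /= gK halfN !charN (hE q g); field.
  by rewrite !char_neq0.
have e3 : charfunX nu1 (s - s') n (charM h (charV k)) = charfunX nu1 (s - s') n q.
  by apply: charfunX_ext_kernel ae1 _ => g _; rewrite /= (hE q g); field; rewrite !char_neq0.
have e4 : charfunX nu2 (s - a * s') n (charM h (charV (char_comp k aD))) =
    charfunX nu2 (s - a * s') n p.
  apply: charfunX_ext_kernel ae2 _ => g /al gK; rewrite /= gK halfN !charN (hE p g); field.
  by rewrite !char_neq0.
apply: etrans (congr2 *%R e1 e2) _; apply: etrans (HE s s' n h k) _.
by rewrite e3 e4.
Qed.

(** Rescaling [s'] exchanges the two distributions, so results about [nu1] transfer to [nu2]. *)
Lemma kernel_heyde_sym a nu1 nu2 : a != 0 -> kernel_heyde a nu1 nu2 -> kernel_heyde a^-1 nu2 nu1.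
Proof.
move=> a0 HE s s' n p q.
have := HE s (a^-1 * s') n q p; rewrite mulVKf// => h.
by rewrite mulrC h mulrC.
Qed.

Section factorization.
Variables (a : R) (nu1 nu2 : probability (XG R G) R).
Hypothesis HE : kernel_heyde a nu1 nu2.
Hypothesis nu1_neq0 : forall s n h, charfunX nu1 s n h != 0.
Hypothesis nu2_neq0 : forall s n h, charfunX nu2 s n h != 0.

Lemma kernel_ratio n p :
  charfunX nu2 0 n p = charfunX nu2 0 n char1 / charfunX nu1 0 n char1 * charfunX nu1 0 n p.
Proof.
have := HE 0 0 n p char1; rewrite mulr0 addr0 subr0 => h.
by apply: (mulfI (nu1_neq0 0 n char1)); rewrite -h; field; exact: nu1_neq0.
Qed.

(** For [a = -1] the arguments [s - s'] and [s + a * s'] vanish together, so taking both variables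
    equal to [s / 2] extends [kernel_ratio] to all [s]. *)
Lemma kernel_ratioN1 s n p : a = -1 ->
  charfunX nu2 s n p = charfunX nu2 0 n char1 / charfunX nu1 0 n char1 * charfunX nu1 s n p.
Proof.
move=> aN1; have := HE (s / 2) (s / 2) n p char1.
rewrite aN1 mulN1r subrr opprK -splitr => h.
by apply: (mulfI (nu1_neq0 0 n char1)); rewrite -h; field; exact: nu1_neq0.
Qed.

(** With first variable [a * s'] the last factor sits at real frequency 0, where [kernel_ratio]
    applies. Dividing by the case of the trivial character cancels the unknown factors; [a != -1]
    makes [(1 + a) * s'] reach every [s]. *)
Lemma kernel_separation s n p : a != -1 ->
  charfunX nu1 s n p = charfunX nu1 s n char1 / charfunX nu1 0 n char1 * charfunX nu1 0 n p.
Proof.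
move=> aN1; have a1 : 1 + a != 0 by rewrite addrC -[1]opprK subr_eq0.
pose s' := s / (1 + a).
have sE : a * s' + s' = s by rewrite /s'; field.
have h q := HE (a * s') s' n q char1.
move: (h p) (h char1); rewrite !sE !subrr [charfunX nu2 0 n p]kernel_ratio => hp h1.
apply: (@mulIf _ (charfunX nu2 (a * s' + a * s') n char1)) => //.
rewrite hp -[charfunX nu1 s n char1](mulfK (nu2_neq0 (a * s' + a * s') n char1)) h1; field.
by rewrite nu1_neq0 nu2_neq0.
Qed.

Lemma kernel_gaussian n : a != -1 -> exists sigma m, 0 <= sigma /\ forall s p,
  charfunX nu1 s n p = gauss_char sigma m s * charfunX nu1 0 n p.
Proof.
move=> aN1.
suff [sigma [m E]] : exists sigma m, forall s,
    charfunX nu1 s n char1 = gauss_char sigma m s * charfunX nu1 0 n char1.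
  exists sigma, m; split; first exact: gauss_char_sigma_ge0 E.
  by move=> s p; rewrite kernel_separation// E; field.
have [a1|a1] := eqVneq a 1; last first.
  have [cR cI] := charfunX_continuous nu1 n char1.
  have [sigma [m E]] := @heyde_gaussian R (fun s => charfunX nu1 s n char1)
    (fun s => charfunX nu2 s n char1) a a1 aN1 (fun s => nu1_neq0 s n char1)
    (fun s => nu2_neq0 s n char1) cR cI (fun s => charfunX_hermitian nu1 s n)
    (fun s t => HE s t n char1 char1).
  by exists sigma, m => s; rewrite E mulrC.
(* For [a = 1] the equation at [(s / 2, s / 2)] reads f(s) g(s) = 1, while both moduli are at most
   1. Hence [sigma = 0], and the phase found for [n = 0] serves every [n]. *)
have f1 s : `|charfunX nu1 s 0 char1| = 1.
  have := HE (s / 2) (s / 2) 0 char1 char1.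
  rewrite a1 mul1r subrr -splitr !charfunX0 mulr1 => h.
  apply/eqP; rewrite eq_le charfunX_norm_le1 /=.
  have -> : 1 = `|charfunX nu1 s 0 char1| * `|charfunX nu2 s 0 char1| by rewrite -normrM h normr1.
  by rewrite ler_piMr// charfunX_norm_le1.
pose f s := charfunX nu1 s 0 char1.
have fD x y : f (x + y) = f x * f y by rewrite /f charfunX_unimodular.
have [cR cI] := charfunX_continuous nu1 0 char1.
have [m mE] : exists m, forall s, complex.Re (f s) = cos (m * s) /\ complex.Im (f s) = sin (m * s).
  apply: circle_character => //.
  - move=> s; apply: (@complexI R); rewrite add_Re2_Im2 f1 expr1n//.
  - by move=> x y; rewrite fD ReM.
  - by move=> x y; rewrite fD ImM; ring.
exists 0, m => s; rewrite -[s in LHS]add0r charfunX_unimodular// mulrC; congr (_ * _).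
have [hR hI] := mE s.
by apply: eqC; rewrite /gauss_char /cexp /= mul0r oppr0 expR0 mul1r.
Qed.

End factorization.

End heyde_on_kernel.

HB.instance Definition _ (U V : finZmodType) := Finite.on (U * V)%type.

(** * Assembling the factors *)

Section assembly.
Context {R : realType} {G : finZmodType}.
Implicit Types (nu : probability (XG R G) R) (h : char_group R G) (K : set G).

Lemma concentrated_ae nu K : {ae nu, forall x : XG R G, K x.2} ->
  concentrated_on (subRZ2K K) nu.
Proof.
move=> aeK; rewrite /concentrated_on -(setCK (subRZ2K K)).
have mK : measurable (~` subRZ2K K : set (XG R G)).
  exact: (measurable_snd_pred (fun g => ~ K g)).
have h0 : nu (~` subRZ2K K) = 0%E by apply/negligibleP.
by rewrite probability_setC// h0 sube0.
Qed.

Lemma Z2_multiplier nu1 nu2 (c : R) : `|c| <= 1 ->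
  (forall s h, charfunX nu2 s 0 h = charfunX nu1 s 0 h) ->
  (forall s h, charfunX nu2 s 1 h = c%:C%C * charfunX nu1 s 1 h) ->
  exists theta : probability Z2 R, eq_dist nu2 (convol nu1 (embZ2 G theta)).
Proof.
move=> c1 h0 h1.
(* The weights whose transform on Z(2) is 1 at the trivial character and [c] at the other; they are
   nonnegative because [|c| <= 1]. *)
pose p (m : 'Z_2) : R := if m == 0 then (1 + c) / 2 else (1 - c) / 2.
have c1' : -1 <= c <= 1 by rewrite -ler_norml.
have [|| theta thE] := @discr_probability_exists R 'Z_2 p.
- by move=> m; rewrite /p; case: ifP => _; lra.
- by rewrite sum_Z2 /p eqxx /=; field.
exists theta; apply: charfunX_unique => s n h.
rewrite charfunX_convol charfunX_embZ2 (cintegral_discr theta (fun m => sgZ2 m n)).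
rewrite sum_Z2 !thE /p eqxx /= sgZ2_0l mul1r.
case: (Z2_cases n) => ->.
  by rewrite sgZ2_r0 mul1r h0 -rmorphD /= -mulrDl addrACA subrr addr0 -{1}[1]/(1%:R) divff ?mulr1.
by rewrite sgZ2_11 mulN1r h1 -rmorphB /= mulrC; congr (_ * (_)%:C%C); field.
Qed.

Lemma Z2_related_multiple nu1 nu2 (c : R) : c != 0 ->
  (forall s h, charfunX nu2 s 0 h = charfunX nu1 s 0 h) ->
  (forall s h, charfunX nu2 s 1 h = c%:C%C * charfunX nu1 s 1 h) ->
  Z2_related nu1 nu2.
Proof.
move=> c0 h0 h1; have [c1|c1] := leP `|c| 1.
  by right; exact: Z2_multiplier c1 h0 h1.
left; apply: (@Z2_multiplier _ _ c^-1) => [|s h|s h].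
- by rewrite normfV invf_le1 ?normr_gt0// ltW.
- by rewrite h0.
- by rewrite h1 mulrA -rmorphM /= mulVf// mul1r.
Qed.

Lemma eq_dist_shift mu g nu : (forall s n h, charfunX nu s n h = charfunX (shift_dist mu g) s n h) ->
  eq_dist mu (convol nu (Edeg R g)).
Proof.
move=> nuE; apply: charfunX_unique => s n h.
by rewrite charfunX_convol charfunX_Edeg nuE; exact: charfunX_shift.
Qed.

Lemma cintegral_indic d (T : measurableType d) (mu : probability T R) (D : set T) :
  measurable D -> cintegral mu (fun x => (\1_D x : R)%:C%C) = (fine (mu D))%:C%C.
Proof.
move=> mD; apply: eqC; rewrite /= /Rintegral.
  by rewrite integral_indic// setIT.
by rewrite integral0.
Qed.

(** For [n = 0] the sum, for [n = 1] the difference, of the masses over [(0, g)] and [(1, g)]. The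
    transform is real at frequency 0, so taking the real part loses nothing. *)
Definition fiber_weight nu (n : 'Z_2) (g : G) : R := complex.Re (Z2transform nu n g 0).

Lemma xtransform0 nu m g : xtransform nu m g 0 = (fine (nu (xslice m g)))%:C%C.
Proof.
rewrite -cintegral_indic; last exact: measurable_xslice.
by apply: eq_cintegral => x; rewrite mulr0 cexp_im0 mulr1.
Qed.

Lemma Z2transform0 nu n g : Z2transform nu n g 0 = (fiber_weight nu n g)%:C%C.
Proof.
have [h0 h1] := Z2transformE nu g 0; rewrite !xtransform0 in h0 h1.
by rewrite /fiber_weight; case: (Z2_cases n) => ->; rewrite ?h0 ?h1 -?rmorphD -?rmorphB.
Qed.

Lemma fiber_weight_bound nu g : `|fiber_weight nu 1 g| <= fiber_weight nu 0 g.
Proof.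
have [h0 h1] := Z2transformE nu g 0.
rewrite /fiber_weight h0 h1 !xtransform0 /= ler_norml.
have f0 : 0 <= fine (nu (xslice 0 g)) by exact: fine_ge0.
have f1 : 0 <= fine (nu (xslice 1 g)) by exact: fine_ge0.
by apply/andP; split; lra.
Qed.

Lemma charfunX_fiber_weight nu n h :
  charfunX nu 0 n h = \sum_g (fiber_weight nu n g)%:C%C * h g.
Proof. by rewrite charfunX_slices; apply: eq_bigr => g _; rewrite Z2transform0. Qed.

Lemma fiber_transform nu g s n :
  cintegral nu (fun x => (\1_(fiber g) x : R)%:C%C * pairRZ2 x.1 s n) = Z2transform nu n g s.
Proof.
pose F (m : 'Z_2) (x : XG R G) : R[i] :=
  sgZ2 m n * ((\1_(xslice m g) x : R)%:C%C * cexp (0 +i* (x.1.1 * s))%C).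
have cs m : cbm (fun x : XG R G => (\1_(xslice m g) x : R)%:C%C * cexp (0 +i* (x.1.1 * s))%C).
  by apply: cbm_slice; [exact: measurable_X11|exact: measurable_xslice].
have -> : (fun x : XG R G => (\1_(fiber g) x : R)%:C%C * pairRZ2 x.1 s n) =
    fun x => \sum_m F m x.
  apply/funext => x; rewrite (bigD1 x.1.2)//= big1 ?addr0; last first.
    move=> m mx; rewrite /F indicE memNset ?mul0r ?mulr0//.
    by move=> [/= xm _]; rewrite xm eqxx in mx.
  have -> : \1_(fiber g) x = \1_(xslice x.1.2 g) x :> R.
    by rewrite !indicE; congr (nat_of_bool _)%:R; apply/idP/idP; rewrite !inE /fiber /xslice /= // => -[].
  by rewrite /F /pairRZ2 -/(sgZ2 _ _); ring.
rewrite cintegral_sum; last by move=> m; apply: cbmM; [exact: cbm_cst|exact: cs].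
by apply: eq_bigr => m _; rewrite cintegralZ.
Qed.

Lemma fiber_mass nu g : nu (fiber g) = (fiber_weight nu 0 g)%:E.
Proof.
rewrite -[LHS]fineK; last exact: (fin_num_measure nu _ (measurable_fiber g)).
congr (_%:E); apply: (@complexI R).
rewrite -cintegral_indic; last exact: measurable_fiber.
rewrite -Z2transform0 -fiber_transform; apply: eq_cintegral => x.
by rewrite /pairRZ2 mulr0 cexp_im0 muln0 expr0 !mulr1.
Qed.

Lemma fiber_weight_eq0 nu K g : {ae nu, forall x : XG R G, K x.2} -> ~ K g ->
  forall n, fiber_weight nu n g = 0.
Proof.
move=> aeK nK.
have w0 : fiber_weight nu 0 g = 0.
  have : nu (fiber g) = 0%E.
    by apply/eqP; apply: contra_notT nK => ng; exact: ae_fiber aeK ng.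
  by rewrite fiber_mass => -[].
move=> n; case: (Z2_cases n) => -> //.
by apply/eqP; rewrite -normr_le0 -w0; exact: fiber_weight_bound.
Qed.

Lemma discrete_factor nu K (kappa : R) : kappa != 0 ->
  (forall g, `|fiber_weight nu 1 g| <= `|kappa| * fiber_weight nu 0 g) ->
  {ae nu, forall x : XG R G, K x.2} ->
  exists omega : probability (XG R G) R,
    [/\ concentrated_on (subZ2K K) omega,
      forall s h, charfunX omega s 0 h = charfunX nu 0 0 h
      & forall s h, charfunX omega s 1 h = (kappa^-1)%:C%C * charfunX nu 0 1 h].
Proof.
move=> k0 kb aeK.
pose w := fiber_weight nu.
pose p (v : 'Z_2 * G) : R := (w 0 v.2 + (if v.1 == 0 then 1 else -1) * (w 1 v.2 / kappa)) / 2.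
have pb g : - w 0 g <= w 1 g / kappa <= w 0 g.
  by rewrite -ler_norml normrM normfV ler_pdivrMr ?normr_gt0// mulrC; exact: kb.
have sumZ2G (V : nmodType) (F : 'Z_2 * G -> V) :
    \sum_v F v = \sum_g (F (0, g) + F (1, g)).
  transitivity (\sum_m \sum_g F (m, g)); last by rewrite sum_Z2 big_split.
  by rewrite pair_bigA; apply: eq_bigr => -[].
have [|| P PE] := @discr_probability_exists R ('Z_2 * G)%type p.
- by move=> [m g]; rewrite /p /=; have /andP[] := pb g; case: ifP => _; lra.
- rewrite sumZ2G (eq_bigr (w 0)); last by move=> g _; rewrite /p /=; field.
  apply: (@complexI R); rewrite rmorph_sum /=; apply: etrans (charfunX0 nu).
  rewrite charfunX_fiber_weight.
  by apply: eq_bigr => g _; rewrite mulr1.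
pose i (v : discr ('Z_2 * G)%type) : XG R G := (0, v.1 : Z2, v.2 : discr G).
have mi : measurable_fun setT i by exact: measurable_fun_discr.
have cfE s n h : charfunX (distribution P (mfun_of mi)) s n h =
    \sum_g (sgZ2 0 n * (p (0, g))%:C%C + sgZ2 1 n * (p (1, g))%:C%C) * h g.
  rewrite /charfunX cintegral_distribution; last exact: cbm_pairX.
  pose f (v : 'Z_2 * G) : R[i] := sgZ2 v.1 n * h v.2.
  rewrite (@eq_cintegral _ _ _ _ _ (f : discr ('Z_2 * G)%type -> R[i])); last first.
    by move=> v; rewrite pairXE /= mul0r cexp_im0 mul1r.
  rewrite (cintegral_discr P f) sumZ2G.
  by apply: eq_bigr => g _; rewrite !PE /f /=; ring.
exists (distribution P (mfun_of mi)); split.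
- rewrite /concentrated_on /= /distribution /pushforward /=.
  apply: discr_probability_setE => -[m g] nK.
  have {nK} nK : ~ K g by move=> Kg; apply: nK; split.
  by rewrite PE /p /w /= !(fiber_weight_eq0 aeK nK) mul0r mulr0 addr0 mul0r.
- move=> s h; rewrite cfE charfunX_fiber_weight; apply: eq_bigr => g _; congr (_ * _).
  rewrite !sgZ2_r0 !mul1r -rmorphD /= /p /=; congr (_%:C%C).
  by rewrite /w; field.
- move=> s h; rewrite cfE charfunX_fiber_weight mulr_sumr; apply: eq_bigr => g _.
  rewrite mulrA; congr (_ * _).
  rewrite sgZ2_0l sgZ2_11 mul1r mulN1r -rmorphB -rmorphM /= /p /=; congr (_%:C%C).
  by rewrite /w; field.
Qed.

(** The Gaussian factor does not depend on the character of G, so finite Fourier inversion passes it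
    to each fibre. *)
Lemma gaussian_fibers nu n sigma m :
  (forall s h, charfunX nu s n h = gauss_char sigma m s * charfunX nu 0 n h) ->
  forall g s, Z2transform nu n g s = gauss_char sigma m s * (fiber_weight nu n g)%:C%C.
Proof.
move=> cE g s; rewrite -Z2transform0; apply/eqP; rewrite -subr_eq0; apply/eqP; move: g.
apply: (@finite_fourier_inj R G) => h; under eq_bigr do rewrite mulrBl -mulrA.
by rewrite sumrB -mulr_sumr -!charfunX_slices cE subrr.
Qed.

Section gaussian_factor.
Variables (nu : probability (XG R G) R) (sigma sigma' m m' : R).
Hypothesis sigma_ge0 : 0 <= sigma.
Hypothesis sigma'_ge0 : 0 <= sigma'.
Hypothesis charfun0 : forall s h, charfunX nu s 0 h = gauss_char sigma m s * charfunX nu 0 0 h.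
Hypothesis charfun1 : forall s h, charfunX nu s 1 h = gauss_char sigma' m' s * charfunX nu 0 1 h.

Lemma fiber_theta g : fiber_weight nu 1 g != 0 ->
  [/\ 0 < sigma', sigma' < sigma
    & `|fiber_weight nu 1 g| <= fiber_weight nu 0 g *
      (Num.sqrt (sigma' / sigma) * expR (- ((m - m') ^+ 2 / (4 * (sigma - sigma')))))]
  \/ [/\ sigma = sigma', m = m' & `|fiber_weight nu 1 g| <= fiber_weight nu 0 g].
Proof.
set w0 := fiber_weight nu 0 g; set w1 := fiber_weight nu 1 g => w1_neq0.
(* The slice in which the odd part enters with a negative sign: positivity of its transform is the
   domination of one peak by the other. *)
have [l le1] : exists l : 'Z_2, sgZ2 l 1 * w1%:C%C = (- `|w1|)%:C%C.
  have [w1_ge0|w1_lt0] := leP 0 w1.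
    by exists 1; rewrite sgZ2_11 mulN1r ger0_norm// rmorphN.
  by exists 0; rewrite sgZ2_0l mul1r ltr0_norm// opprK.
have pos := @gauss_transform_positivity _ _ R nu (fun x : XG R G => x.1.1) (xslice l g)
  (w0 / 2) (- (`|w1| / 2)) sigma sigma' m m' measurable_X11 (measurable_xslice l g)
  sigma_ge0 sigma'_ge0.
have B0 : 0 < `|w1| / 2 by rewrite divr_gt0// normr_gt0.
have half2 (x y z : R) : x / 2 <= y / 2 * z -> x <= y * z.
  by rewrite mulrAC ler_pM2r.
have [|[s0 ss B]|[ss mm B]] := @gauss_peak_domination R (w0 / 2) (`|w1| / 2) sigma sigma' m m'
  sigma_ge0 sigma'_ge0 B0.
- move=> p t p0; have /pos -/(_ p t p0) : forall s, slice_transform (fun x : XG R G => x.1.1)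
    (xslice l g) nu s = (w0 / 2)%:C%C * gauss_char sigma m s +
      (- (`|w1| / 2))%:C%C * gauss_char sigma' m' s.
    move=> s; rewrite -/(xtransform nu l g s) xtransformE.
    rewrite (gaussian_fibers charfun0) (gaussian_fibers charfun1) -/w0 -/w1.
    rewrite [sgZ2 l 1 * _]mulrCA le1 -mulNr !rmorphM /= !rmorphV ?unitfE ?pnatr_eq0//=.
    by rewrite rmorph_nat; ring.
  by rewrite mulNr subr_ge0.
- by left; split=> //; exact: half2 B.
- by right; split=> //; move: B; lra.
Qed.

(** The factor is the conditional law on the fibre over [g], projected to R x Z(2); being a genuine
    distribution, it needs no separate existence argument. *)
Lemma gaussian_factor g : fiber_weight nu 1 g != 0 ->
  exists gamma : probability (RZ2 R) R,
  [/\ Theta gamma, forall s, charfunRZ2 gamma s 0 = gauss_char sigma m s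
    & forall s, charfunRZ2 gamma s 1 =
        (fiber_weight nu 1 g / fiber_weight nu 0 g)%:C%C * gauss_char sigma' m' s].
Proof.
move=> w1_neq0.
set w0 := fiber_weight nu 0 g; set w1 := fiber_weight nu 1 g.
have w0_gt0 : 0 < w0 by rewrite (lt_le_trans _ (fiber_weight_bound nu g))// normr_gt0.
have fg0 : nu (fiber g) != 0%E by rewrite fiber_mass eqe gt_eqF.
have [nu' nu'E] := conditional_probability_exists (measurable_fiber g) fg0.
pose mfst := mfun_of (@measurable_fst _ _ (RZ2 R) (discr G)).
have cfE s n : charfunRZ2 (distribution nu' mfst) s n =
    (w0^-1)%:C%C * Z2transform nu n g s.
  rewrite /charfunRZ2 cintegral_distribution; last exact: cbm_pairRZ2.
  rewrite nu'E; last exact: (cbm_comp measurable_fst (cbm_pairRZ2 s n)).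
  by rewrite fiber_transform fiber_mass.
have cf0 s : charfunRZ2 (distribution nu' mfst) s 0 = gauss_char sigma m s.
  rewrite cfE (gaussian_fibers charfun0) mulrCA -rmorphM /= mulVf ?mulr1//.
  by rewrite gt_eqF.
have cf1 s : charfunRZ2 (distribution nu' mfst) s 1 = (w1 / w0)%:C%C * gauss_char sigma' m' s.
  by rewrite cfE (gaussian_fibers charfun1) mulrCA -rmorphM /= mulrC [w0^-1 * _]mulrC.
exists (distribution nu' mfst); split=> //.
exists sigma, sigma', m, m', (w1 / w0); split=> //.
have nE : `|w1 / w0| = `|w1| / w0 by rewrite normrM normfV (gtr0_norm w0_gt0).
have [[s0 ss B]|[ss mm B]] := fiber_theta w1_neq0.
  left; split=> //; first by rewrite nE divr_gt0// normr_gt0.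
  by rewrite nE ler_pdivrMr// mulrC.
by right; split=> //; rewrite nE ler_pdivrMr// mul1r.
Qed.

End gaussian_factor.

End assembly.

(** * Decomposition of distributions on R x Z(2) x K *)

Section kernel_decomposition.
Context {R : realType} {G : finZmodType}.
Variables (a : R) (nu1 nu2 : probability (XG R G) R).
Hypothesis HE : kernel_heyde a nu1 nu2.
Hypothesis nu1_neq0 : forall s n (h : char_group R G), charfunX nu1 s n h != 0.
Hypothesis nu2_neq0 : forall s n (h : char_group R G), charfunX nu2 s n h != 0.

Lemma kernel_ratio_real : exists2 c : R, c != 0 &
  charfunX nu2 0 1 char1 / charfunX nu1 0 1 char1 = c%:C%C.
Proof.
have [r1 E1] := charfunX_real nu1 1; have [r2 E2] := charfunX_real nu2 1.
have := nu1_neq0 0 1 char1; have := nu2_neq0 0 1 char1; rewrite E1 E2 => r20 r10.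
have {}r10 : r1 != 0 by apply: contra_neq r10 => ->.
have {}r20 : r2 != 0 by apply: contra_neq r20 => ->.
exists (r2 / r1); first by rewrite mulf_neq0// invr_neq0.
by rewrite rmorphM /= fmorphV.
Qed.

Lemma kernel_decompositionN1 : a = -1 -> Z2_related nu1 nu2.
Proof.
move=> aN1; have [c c0 cE] := kernel_ratio_real.
apply: (Z2_related_multiple c0) => s h.
  by rewrite (kernel_ratioN1 HE nu1_neq0 s 0 h aN1) !charfunX0 divr1 mul1r.
by rewrite (kernel_ratioN1 HE nu1_neq0 s 1 h aN1) cE.
Qed.

Lemma kernel_decomposition (K : set G) : a != 0 -> a != -1 ->
  {ae nu1, forall x : XG R G, K x.2} ->
  exists (gamma1 gamma2 : probability (RZ2 R) R) (omega : probability (XG R G) R),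
  [/\ Theta gamma1 /\ Theta gamma2, concentrated_on (subZ2K K) omega,
    forall s n h, charfunX nu1 s n h = charfunX (convol (embRZ2 G gamma1) omega) s n h
    & forall s n h, charfunX nu2 s n h = charfunX (convol (embRZ2 G gamma2) omega) s n h].
Proof.
move=> a0 aN1 aeK.
have [c c0 cE] := kernel_ratio_real.
have aVN1 : a^-1 != -1 by rewrite -[-1]invrK (inj_eq invr_inj) invrN invr1.
have HE' := kernel_heyde_sym a0 HE.
have [sg10 [m10 [sg10_ge0 E10]]] := kernel_gaussian HE nu1_neq0 nu2_neq0 0 aN1.
have [sg11 [m11 [sg11_ge0 E11]]] := kernel_gaussian HE nu1_neq0 nu2_neq0 1 aN1.
have [sg20 [m20 [sg20_ge0 E20]]] := kernel_gaussian HE' nu2_neq0 nu1_neq0 0 aVN1.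
have [sg21 [m21 [sg21_ge0 E21]]] := kernel_gaussian HE' nu2_neq0 nu1_neq0 1 aVN1.
have ratio0 h : charfunX nu2 0 0 h = charfunX nu1 0 0 h.
  by rewrite (kernel_ratio HE nu1_neq0 0 h) !charfunX0 divr1 mul1r.
have ratio1 h : charfunX nu2 0 1 h = c%:C%C * charfunX nu1 0 1 h.
  by rewrite (kernel_ratio HE nu1_neq0 1 h) cE.
have w20 g : fiber_weight nu2 0 g = fiber_weight nu1 0 g.
  by rewrite /fiber_weight (charfunX_inj_transform ratio0).
have w21 g : fiber_weight nu2 1 g = c * fiber_weight nu1 1 g.
  have : Z2transform nu2 1 g 0 - c%:C%C * Z2transform nu1 1 g 0 = 0.
    move: g; apply: (@finite_fourier_inj R G) => h.
    under eq_bigr do rewrite mulrBl -mulrA.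
    by rewrite sumrB -mulr_sumr -!charfunX_slices ratio1 subrr.
  by move/subr0_eq; rewrite /fiber_weight => ->; rewrite ReZ.
pose r g := `|fiber_weight nu1 1 g / fiber_weight nu1 0 g|.
(* If every difference of masses vanished, so would the characteristic function at [n = 1]. *)
have [g0 w_neq0] : exists g0, fiber_weight nu1 1 g0 != 0.
  apply: contrapT => /forallNP w0; move: (nu1_neq0 0 1 char1).
  rewrite charfunX_fiber_weight big1 ?eqxx// => g _.
  by have /negP := w0 g; rewrite negbK => /eqP ->; rewrite mul0r.
have w0P g : fiber_weight nu1 1 g != 0 -> fiber_weight nu1 0 g != 0.
  move=> wg; rewrite gt_eqF// (lt_le_trans _ (fiber_weight_bound nu1 g))// normr_gt0//.
(* Maximality keeps the weights of [omega] nonnegative when the ratio of the two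
   masses at [g] is moved into [gamma1] and [gamma2]. *)
have [g rmax] : exists g, forall g', r g' <= r g.
  by case: (@arg_maxP _ _ G g0 xpredT r erefl) => g _ gP; exists g => g'; exact: gP.
have wg : fiber_weight nu1 1 g != 0.
  have : 0 < r g.
    by rewrite (lt_le_trans _ (rmax g0))// normr_gt0 mulf_neq0// invr_neq0// w0P.
  by apply: contraTneq; rewrite /r => ->; rewrite mul0r normr0 ltxx.
pose kappa := fiber_weight nu1 1 g / fiber_weight nu1 0 g.
have kappa0 : kappa != 0 by rewrite mulf_neq0// invr_neq0// w0P.
have bound g' : `|fiber_weight nu1 1 g'| <= `|kappa| * fiber_weight nu1 0 g'.
  have w_ge0 : 0 <= fiber_weight nu1 0 g' := le_trans (normr_ge0 _) (fiber_weight_bound nu1 g').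
  have [->|wg'] := eqVneq (fiber_weight nu1 1 g') 0; first by rewrite normr0 mulr_ge0.
  have w_gt0 : 0 < fiber_weight nu1 0 g' by rewrite lt_neqAle eq_sym w0P.
  by have := rmax g'; rewrite /r normrM normfV (gtr0_norm w_gt0) ler_pdivrMr.
have [omega [oK o0 o1]] := discrete_factor kappa0 bound aeK.
have [gamma1 [T1 g10 g11]] := gaussian_factor sg10_ge0 sg11_ge0 E10 E11 wg.
(* The weights of [nu2] are those of [nu1] with the difference multiplied by [c]. Using the same
   fibre [g] puts all of [c] into [gamma2], so [omega] need not change. *)
have wg2 : fiber_weight nu2 1 g != 0 by rewrite w21 mulf_neq0.
have [gamma2 [T2 g20 g21]] := gaussian_factor sg20_ge0 sg21_ge0 E20 E21 wg2.
have kappaC (x : R[i]) : kappa%:C%C * ((kappa^-1)%:C%C * x) = x.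
  by rewrite mulrA -rmorphM /= mulfV// mul1r.
have ckE : (c * fiber_weight nu1 1 g / fiber_weight nu1 0 g)%:C%C = c%:C%C * kappa%:C%C.
  by rewrite -rmorphM /= mulrA.
exists gamma1, gamma2, omega; split=> // s n h; rewrite charfunX_convol charfunX_embRZ2;
  case: (Z2_cases n) => ->.
- by rewrite g10 o0 E10.
- by rewrite g11 o1 E11 -/kappa [_ * gauss_char _ _ _]mulrC -mulrA kappaC.
- by rewrite g20 o0 E20 ratio0.
- rewrite g21 o1 E21 ratio1 w20 w21 ckE.
  by rewrite -[in LHS](kappaC (charfunX nu1 0 1 h)); ring.
Qed.

End kernel_decomposition.
Theorem theorem3p1 (R : realType) (G : finZmodType)
    (G_no2 : forall g : G, g *+ 2 = 0 -> g = 0)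
    (a : R) (a_neq0 : a != 0)
    (alphaG : {additive G -> G}) (alphaG_bij : bijective alphaG)
    (d : measure_display) (Omega : measurableType d) (P : probability Omega R)
    (xi1 xi2 : {mfun Omega >-> XG R G})
    (xi_indep : independent_RV P xi1 xi2)
    (mu1 mu2 : probability (XG R G) R)
    (mu1E : eq_dist mu1 (distribution P xi1))
    (mu2E : eq_dist mu2 (distribution P xi2))
    (mu1_neq0 : forall s n (h : char_group R G), charfunX mu1 s n h != 0)
    (mu2_neq0 : forall s n (h : char_group R G), charfunX mu2 s n h != 0)
    (L2_sym : cond_symmetric P (fun w => xi1 w + autX a alphaG (xi2 w))
                               (fun w => xi1 w + xi2 w)) :
  (a != -1 ->
     exists (gamma1 gamma2 : probability (RZ2 R) R)
            (omega1 omega2 : probability (XG R G) R) (g1 g2 : G),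
       [/\ Theta gamma1 /\ Theta gamma2,
           concentrated_on (subZ2K (kerIplus alphaG)) omega1 /\
             concentrated_on (subZ2K (kerIplus alphaG)) omega2,
           Z2_related omega1 omega2,
           eq_dist mu1 (convol (convol (embRZ2 G gamma1) omega1) (Edeg R g1))
         & eq_dist mu2 (convol (convol (embRZ2 G gamma2) omega2) (Edeg R g2))])
  /\
  (a = -1 ->
     exists (omega1 omega2 : probability (XG R G) R) (g1 g2 : G),
       [/\ concentrated_on (subRZ2K (kerIplus alphaG)) omega1 /\
             concentrated_on (subRZ2K (kerIplus alphaG)) omega2,
           Z2_related omega1 omega2,
           eq_dist mu1 (convol omega1 (Edeg R g1))
         & eq_dist mu2 (convol omega2 (Edeg R g2))]).
Proof.
have aD : {morph alphaG : x y / x + y} by exact: raddfD.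
have HE : heyde a aD mu1 mu2.
  by move=> s s' n h k; exact: (heyde_equation aD xi_indep mu1E mu2E L2_sym).
have [half [halfK halfD]] := half_exists G_no2.
have [g1 [g2 [HE' ae1 ae2]]] :=
  heyde_reduction G_no2 alphaG_bij mu1_neq0 mu2_neq0 HE halfK halfD.
have shift_neq0 mu g : (forall s n (h : char_group R G), charfunX mu s n h != 0) ->
    forall s n (h : char_group R G), charfunX (shift_dist mu g) s n h != 0.
  by move=> mu0 s n h; have := mu0 s n h; rewrite (charfunX_shift mu g) mulf_eq0 negb_or => /andP[].
have nu1_neq0 := shift_neq0 mu1 g1 mu1_neq0.
have nu2_neq0 := shift_neq0 mu2 g2 mu2_neq0.
have KE := kernel_heyde_of G_no2 HE' ae1 ae2.
split=> [aN1|aN1].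
  have [gamma1 [gamma2 [omega [T oK E1 E2]]]] :=
    kernel_decomposition KE nu1_neq0 nu2_neq0 (K := kerIplus alphaG) a_neq0 aN1 ae1.
  exists gamma1, gamma2, omega, omega, g1, g2; split=> //.
  (* Both discrete factors are the same [omega], so the ratio is 1. *)
  - by apply: (@Z2_related_multiple _ _ _ _ 1) => // s h; rewrite mul1r.
  - by apply: eq_dist_shift => s n h; rewrite E1.
  - by apply: eq_dist_shift => s n h; rewrite E2.
exists (shift_dist mu1 g1), (shift_dist mu2 g2), g1, g2; split.
- by split; exact: concentrated_ae.
- exact: kernel_decompositionN1 KE nu1_neq0 nu2_neq0 aN1.
- exact: eq_dist_shift.
- exact: eq_dist_shift.
Qed.
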